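(* Let $n\ge2$, $0<\lambda\le\Lambda<\infty$, $\gamma\in(0,1)$, $p>\frac n2$ and $C_0>0$. There is a constant $\tilde c>0$ depending only on $n,\gamma,C_0,\lambda,\Lambda$ such that the following holds. Let $A\in\mathcal M_{\lambda,\Lambda}(B_1)$, let $f\in L^{p,\infty}(B_1)$ with $f\ge C_0$ in $B_1$, and let $u$ be a nonnegative weak solution of $$\mathrm{div}(A(x)\nabla u)=\gamma f(x)u^{\gamma-1}\quad\text{in }\{u>0\}\cap B_1.$$ Then for any $y_0\in\partial\{u>0\}$ and $r>0$ with $B_{2r}(y_0)\subset B_1$, $$\sup_{\partial B_r(y_0)}u\ge\tilde c\,r^{\frac{2}{2-\gamma}}.$$
   Context: $B_r(x_0)\subset\mathbb R^n$ is the open ball and $B_r=B_r(0)$. $\mathcal M_{\lambda,\Lambda}(B_1)$ is the class of measurable symmetric-matrix-valued functions $A:B_1\to\mathrm{Sym}(n)$ with $\lambda|\xi|^2\le\langle A(x)\xi,\xi\rangle\le\Lambda|\xi|^2$ for all $\xi\in\mathbb R^n$ and a.e. $x\in B_1$. $L^{p,\infty}(\Omega)$ is the space of measurable $f$ with $\sup_{t>0}t\,|\{x\in\Omega:|f(x)|>t\}|^{1/p}<\infty$. A nonnegative weak solution is a nonnegative function $u\in H^1(B_1)$, continuous in $B_1$ (so that $\{u>0\}$ is open), with $\int\langle A\nabla u,\nabla\varphi\rangle\,dx+\int\gamma f u^{\gamma-1}\varphi\,dx=0$ for all $\varphi\in C_0^\infty(\{u>0\}\cap B_1)$. *)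

(* Defs.v *)
From HB Require Import structures.
From mathcomp Require Import all_boot all_order all_algebra.
From mathcomp Require Import all_classical all_reals all_analysis.

Set Implicit Arguments.
Unset Strict Implicit.
Unset Printing Implicit Defensive.

Import Order.TTheory GRing.Theory Num.Theory.
Import numFieldNormedType.Exports.

Local Open Scope classical_set_scope.
Local Open Scope ring_scope.

(* Lebesgue measure on R^n, with R^n = 'rV[R]_n: the product measure on the
   Borel sigma-algebra (the one generated by the coordinates) is built by
   induction on n, then completed by Caratheodory's construction. *)
Section lebesgue_measure_on_rV.
Variable R : realType.

Definition borel_rV_gen (n : nat) : set (set 'rV[R]_n) :=
  \big[setU/set0]_(i < n)
     preimage_set_system setT (fun v : 'rV[R]_n => v ord0 i) measurable.

Definition borel_rV (n : nat) := g_sigma_algebraType (@borel_rV_gen n).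

Definition cons_rV (n : nat) (x : R * borel_rV n) : borel_rV n.+1 :=
  row_mx (x.1%:M : 'rV[R]_1) (x.2 : 'rV[R]_n).

Lemma measurable_coord_borel_rV (n : nat) (i : 'I_n) :
  measurable_fun setT (fun v : borel_rV n => (v : 'rV[R]_n) ord0 i).
Proof.
move=> _ Y mY; rewrite setTI; apply: sub_sigma_algebra.
rewrite /borel_rV_gen -bigcup_seq/=; exists i => /=.
  by rewrite mem_index_enum.
by exists Y => //; rewrite setTI.
Qed.

Lemma measurable_fun_borel_rV d (T : measurableType d) (n : nat)
    (f : T -> borel_rV n) :
  (forall i : 'I_n, measurable_fun setT (fun t => (f t : 'rV[R]_n) ord0 i)) ->
  measurable_fun setT f.
Proof.
move=> mf; apply: measurability => //; last first.
move=> _ [B GB <-]; move: GB; rewrite /borel_rV_gen -bigcup_seq/=.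
by case=> i _ [A mA <-]; rewrite setTI; exact: mf.
Qed.

Lemma measurable_cons_rV (n : nat) : measurable_fun setT (@cons_rV n).
Proof.
apply: measurable_fun_borel_rV => i.
case: (split_ordP (i : 'I_(1 + n))) => j ->.
  rewrite (_ : (fun _ => _) = fst); first exact: measurable_fst.
  apply/funext => x; apply: etrans (@row_mxEl R 1 1 n _ _ _ _) _.
  by rewrite mxE (ord1 j).
rewrite (_ : (fun _ => _) = (fun v : borel_rV n => (v : 'rV[R]_n) ord0 j) \o snd).
  exact: measurableT_comp (measurable_coord_borel_rV j) measurable_snd.
by apply/funext => x; exact: (@row_mxEr R 1 1 n).
Qed.

Section product_step.
Context (n : nat) (mu : {measure set (borel_rV n) -> \bar R}).

Definition lebesgue_product : set (borel_rV n.+1) -> \bar R :=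
  pushforward (@lebesgue_measure R \x^ mu)%E (@cons_rV n).

Let mcons : measurable_fun setT
  (@cons_rV n : measurableTypeR R * borel_rV n -> borel_rV n.+1).
Proof. exact: measurable_cons_rV. Qed.

Let lebesgue_product0 : lebesgue_product set0 = 0%E.
Proof. by rewrite /lebesgue_product measure0. Qed.

Let lebesgue_product_ge0 A : (0 <= lebesgue_product A)%E.
Proof. exact: measure_ge0. Qed.

Let lebesgue_product_sigma_additive : semi_sigma_additive lebesgue_product.
Proof. exact: measure_semi_sigma_additive. Qed.

HB.instance Definition _ := isMeasure.Build _ _ _ lebesgue_product
  lebesgue_product0 lebesgue_product_ge0 lebesgue_product_sigma_additive.

End product_step.

Fixpoint lebesgue_borel_rV (n : nat) :
    {measure set (borel_rV n) -> \bar R} :=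
  match n with
  | 0 => @dirac _ (borel_rV 0) (0 : 'rV[R]_0) R
  | m.+1 => lebesgue_product (lebesgue_borel_rV m)
  end.

Local Notation outer n := (mu_ext (lebesgue_borel_rV n)).

HB.instance Definition _ (n : nat) :=
  @isMeasurable.Build (caratheodory_display (outer n)) 'rV[R]_n
    (outer n).-caratheodory
    (caratheodory_measurable_set0 (outer n))
    (@caratheodory_measurable_setC _ _ (outer n))
    (@caratheodory_measurable_bigcup _ _ (outer n)).

Definition lebesgue_rV (n : nat) : set 'rV[R]_n -> \bar R := outer n.

HB.instance Definition _ (n : nat) :=
  isMeasure.Build _ 'rV[R]_n R (@lebesgue_rV n)
    (@caratheodory_measure0 R _ (outer n))
    (@caratheodory_measure_ge0 R _ (outer n))
    (@caratheodory_measure_sigma_additive R _ (outer n)).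

End lebesgue_measure_on_rV.

Section euclidean.
Variables (R : realType) (n : nat).
Implicit Types (x y xi eta : 'rV[R]_n) (r : R).

Definition dot xi eta : R := \sum_(i < n) xi ord0 i * eta ord0 i.

(* The library norm on 'rV[R]_n is the sup norm: it gives the right topology,
   but not the Euclidean balls. *)
Definition enorm xi : R := Num.sqrt (dot xi xi).

Definition eball x r : set 'rV[R]_n := [set y | enorm (y - x) < r].

Definition boundary (E : set 'rV[R]_n) : set 'rV[R]_n := closure E `\` E^°.

(* A xi for a row vector xi, i.e. the transpose of the column A *m xi^T *)
Definition mxact (A : 'M[R]_n) xi : 'rV[R]_n := (A *m xi^T)^T.

End euclidean.

Section function_spaces.
Variables (R : realType) (n : nat).
Implicit Types (Om : set 'rV[R]_n) (u phi : 'rV[R]_n -> R)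
  (Du : 'rV[R]_n -> 'rV[R]_n).

Local Notation mu := (@lebesgue_rV R n).

Definition pderiv (i : 'I_n) phi : 'rV[R]_n -> R :=
  fun x => 'D_(delta_mx ord0 i) phi x.

Definition grad phi : 'rV[R]_n -> 'rV[R]_n :=
  fun x => \row_i pderiv i phi x.

(* C^oo: all iterated partial derivatives exist and are continuous *)
Definition smooth phi : Prop :=
  forall s : seq 'I_n,
    continuous (foldr pderiv phi s) /\
    forall i x, derivable (foldr pderiv phi s) x (delta_mx ord0 i).

(* C_0^oo(Om), its elements being extended by 0 to the whole space *)
Definition test_function Om phi : Prop :=
  let supp := closure [set x | phi x != 0] in
  [/\ smooth phi, compact supp & supp `<=` Om].

Definition weak_gradient Om u Du : Prop :=
  forall phi, test_function Om phi -> forall i : 'I_n,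
    \int[mu]_(x in Om) (u x * pderiv i phi x) =
    - \int[mu]_(x in Om) (Du x ord0 i * phi x).

(* Functions on Om are represented by total functions whose values outside Om
   are irrelevant; u \_ Om is the extension by 0 of the restriction to Om. *)
Definition L2 Om u : Prop := u \_ Om \in Lfun mu 2%:E.

(* u is in H^1(Om), with weak gradient Du *)
Definition H1_with_gradient Om u Du : Prop :=
  [/\ L2 Om u, forall i : 'I_n, L2 Om (fun x => Du x ord0 i)
    & weak_gradient Om u Du].

Definition weak_Lp (p : R) Om (f : 'rV[R]_n -> R) : Prop :=
  measurable_fun Om f /\
  (ereal_sup [set t%:E * mu [set x | Om x /\ (t < `|f x|)%R] `^ p^-1
             | t in [set t : R | (0 < t)%R]] < +oo)%E.

End function_spaces.

Section problem.
Variables (R : realType) (n : nat).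

Local Notation mu := (@lebesgue_rV R n).
Local Notation B1 := (@eball R n 0 1).

Definition elliptic (lam Lam : R) (A : 'rV[R]_n -> 'M[R]_n) : Prop :=
  [/\ forall i j, measurable_fun B1 (fun x => A x i j),
      forall x, B1 x -> (A x)^T = A x &
      {ae mu, forall x, B1 x -> forall xi : 'rV[R]_n,
        lam * enorm xi ^+ 2 <= dot (mxact (A x) xi) xi <= Lam * enorm xi ^+ 2}].

Definition positivity_set (u : 'rV[R]_n -> R) : set 'rV[R]_n :=
  [set x | B1 x /\ 0 < u x].

(* Weak gradients are unique up to null sets, so which one is chosen does not
   matter. In the second integral, phi vanishes off a compact subset of
   {u > 0}, where u is bounded away from 0. *)
Definition nonneg_weak_solution (gamma : R) (A : 'rV[R]_n -> 'M[R]_n)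
    (f u : 'rV[R]_n -> R) : Prop :=
  [/\ forall x, B1 x -> 0 <= u x,
      {within B1, continuous u} &
      exists Du : 'rV[R]_n -> 'rV[R]_n,
        H1_with_gradient B1 u Du /\
        forall phi, test_function (positivity_set u) phi ->
          \int[mu]_(x in positivity_set u) dot (mxact (A x) (Du x)) (grad phi x)
          + \int[mu]_(x in positivity_set u)
              (gamma * f x * u x `^ (gamma - 1) * phi x) = 0].

End problem.

(* Main.v *)
From HB Require Import structures.
Require Import Defs.
From mathcomp Require Import all_boot all_order all_algebra.
From mathcomp Require Import all_classical all_reals all_analysis.
From mathcomp Require Import measurable_realfun.
From mathcomp Require Import ring lra.

Set Implicit Arguments.
Unset Strict Implicit.
Unset Printing Implicit Defensive.

Import Order.TTheory GRing.Theory Num.Theory.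
Import numFieldNormedType.Exports.

Local Open Scope classical_set_scope.
Local Open Scope ring_scope.

(* Nondegeneracy is reduced to the following claim, where d = kappa u(z)^((2-gamma)/2):
   if kappa is large, no z with u(z) > 0 satisfies u <= 4 u(z) on the cube Q_d(z).
   Testing the equation with g g'(u) eta^2, g a smooth version of (s - l)_+, gives
   Caccioppoli's inequality with an additional term c0 \int g g'(u) eta^2 on the left,
   c0 = gamma C0 (4 u(z))^(gamma - 1), since f >= C0 and u <= 4 u(z). With l = u(z)/4 this
   term alone forces the mean square of (u - u(z)/2)_+ over Q_(d/2)(z) to be at most
   C u(z)^2 / kappa^2, and De Giorgi's iteration turns this into u(z) <= 3 u(z) / 4.
   Instead of Sobolev's inequality, the iteration step uses that a function vanishing on
   most of Q_s is controlled in L^2(Q_(s/2)) by its increments, hence by its gradient.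

   If u < S = c r^(2/(2-gamma)) on the sphere, the maximum principle extends this bound to
   the ball. Take z0 near y0 with u(z0) > 0 and let z maximise
   u^((2-gamma)/2) - |x - z0| / kappa on a small cube around y0: for c small this maximum
   is interior and z contradicts the claim. *)

(** * Lebesgue measure on row vectors *)

(** Since [A] is merely measurable, [u] cannot be compared with an explicit barrier, and every bound
    comes from energy estimates. The factor u^(gamma - 1) decreases in u, so it is bounded below
    where u is bounded above: hence the claim assumes u <= 4 u(z) on a whole cube. The size d is
    dictated by scaling: u(z)^(gamma - 1) d^2 = kappa^2 u(z), so a large kappa makes the zero-order
    term dominate the gradient of the cut-off. The number 4 comes from (2 - gamma)/2 >= 1/2, hence
    4^((2 - gamma)/2) >= 2, which beats the penalty |x - z0| / kappa at the maximum point. The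
    equation may be tested only with smooth functions compactly supported in {u > 0}. Therefore u
    itself is never differentiated: a mollification w, uniformly close to u and with gradient close
    to [Du] in L^2, enters the test function, and the energy inequality is stated for w with an
    error tau. The level l > 0 keeps the test function away from the free boundary, where u^(gamma -
    1) blows up. *)

Section sup_norm.
Context {R : realType} {n : nat}.
Implicit Types (x y z : 'rV[R]_n) (r : R).

Lemma coord_le_norm x i : `|x ord0 i| <= `|x|.
Proof.
rewrite [leRHS]/Num.norm/= mx_normrE.
by apply/bigmax_geP; right => /=; exists (ord0, i).
Qed.

Lemma norm_rV_le x r : 0 <= r -> (forall i, `|x ord0 i| <= r) -> `|x| <= r.
Proof.
move=> r0 h; rewrite [leLHS]/Num.norm/= mx_normrE; apply/bigmax_leP; split => //.
by move=> [a b] _ /=; rewrite (ord1 a).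
Qed.

Lemma norm_rV_lt x r : 0 < r -> (`|x| < r) <-> (forall i, `|x ord0 i| < r).
Proof.
move=> r0; split=> [h i|h]; first exact: le_lt_trans (coord_le_norm x i) h.
rewrite [ltLHS]/Num.norm/= mx_normrE; apply/bigmax_ltP; split => //.
by move=> [a b] _ /=; rewrite (ord1 a).
Qed.

Lemma ball_rVE z r : 0 < r ->
  ball z r = [set v | forall i, `|v ord0 i - z ord0 i| < r].
Proof.
move=> r0; apply/seteqP; split=> v /=; rewrite -ball_normE /ball_ /=.
  by move=> /(norm_rV_lt _ r0) h i; have := h i; rewrite !mxE distrC.
by move=> h; apply/(norm_rV_lt _ r0) => i; rewrite !mxE distrC.
Qed.

End sup_norm.

Lemma ge0_integral_transport d1 d2 (X : measurableType d1)
    (Y : measurableType d2) (R : realType) (phi : X -> Y)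
    (m1 : {measure set X -> \bar R}) (m2 : {measure set Y -> \bar R})
    (f : Y -> \bar R) :
  measurable_fun setT phi ->
  (forall A, measurable A -> m1 (phi @^-1` A) = m2 A) ->
  measurable_fun setT f -> (forall y, 0 <= f y)%E ->
  (\int[m2]_y f y = \int[m1]_x f (phi x))%E.
Proof.
move=> mphi m12 mf f0.
rewrite -(ge0_integral_pushforward mphi m1 measurableT mf) //.
by apply: eq_measure_integral => A mA _; rewrite -m12.
Qed.

Section borel.
Context {R : realType} {n : nat}.
Local Notation muB := (@lebesgue_borel_rV R n).
Local Notation mu := (@lebesgue_rV R n).

Lemma borel_ball (z : 'rV[R]_n) r : measurable (ball z r : set (borel_rV R n)).
Proof.
have [r0|r0] := ltP 0 r; last first.
  rewrite (_ : ball z r = set0) //; apply/seteqP; split=> // x.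
  by rewrite -ball_normE /= => /(le_lt_trans (normr_ge0 _)); rewrite ltNge r0.
have -> : ball z r = \bigcap_(i in [set: 'I_n])
    ((fun v : borel_rV R n => (v : 'rV[R]_n) ord0 i) @^-1` (ball (z ord0 i) r)).
  rewrite ball_rVE //; apply/seteqP; split => v /= h i.
    by rewrite /ball /= distrC => _; exact: h.
  by rewrite distrC; exact: h.
apply: fin_bigcap_measurable => [|i _]; first exact: finite_finset.
rewrite -[X in measurable X]setTI; apply: measurable_coord_borel_rV => //.
exact: measurable_ball.
Qed.

(** Rational centres and radii 1/(k+1) suffice. A ball that leaves [U] is replaced by the empty set,
    which keeps one fixed countable index type. Both Borel measurability and L^2 approximation of
    open sets are thereby reduced to balls. *)
Lemma open_bigcup_ball (U : set 'rV[R]_n) : open U ->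
  exists F : 'rV[rat]_n * nat -> set 'rV[R]_n, U = \bigcup_i F i /\
    forall i, F i = set0 \/ exists z r, 0 < r /\ F i = ball z r.
Proof.
move=> oU.
pose c (q : 'rV[rat]_n) : 'rV[R]_n := map_mx ratr q.
exists (fun qk => [set x | ball (c qk.1) (qk.2.+1%:R^-1) x /\
            ball (c qk.1) (qk.2.+1%:R^-1) `<=` U]); split; last first.
  move=> [q k] /=.
  have [h|h] := pselect (ball (c q) (k.+1%:R^-1) `<=` U); [right|left].
    exists (c q), (k.+1%:R^-1); split; first by rewrite invr_gt0.
    by apply/seteqP; split => x /=; [case|].
  by apply/seteqP; split => x //= [].
apply/seteqP; split => [x Ux|x [qk _ [/= + h]]]; last exact: h.
have /nbhs_ballP[e /= e0 he] : nbhs x U by exact: open_nbhs_nbhs.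
have [k /= ke] : exists k : nat, k.+1%:R^-1 < e / 2.
  exists (Num.truncn (e / 2)^-1).
  by rewrite invf_plt ?posrE ?divr_gt0 // truncnS_gt.
have k0 : 0 < k.+1%:R^-1 :> R by rewrite invr_gt0.
have [q hq] : exists q : 'rV[rat]_n, forall i, `|c q ord0 i - x ord0 i| < k.+1%:R^-1.
  have /choice[f hf] : forall i : 'I_n, exists q : rat,
      `|ratr q - x ord0 i| < k.+1%:R^-1.
    move=> i.
    have [] := @rat_in_itvoo R (x ord0 i) (x ord0 i + k.+1%:R^-1).
      by rewrite ltrDl.
    move=> q; rewrite in_itv /= => /andP[h1 h2]; exists q.
    by rewrite ger0_norm ?subr_ge0 1?ltW // ltrBlDl.
  by exists (\row_i f i) => i; rewrite !mxE.
exists (q, k) => //; split => /=.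
  by rewrite ball_rVE // => i /=; rewrite distrC.
move=> y; rewrite ball_rVE //= => hy; apply: he.
rewrite ball_rVE // => i /=.
rewrite -(subrKA (c q ord0 i)) (le_lt_trans (ler_normD _ _)) //.
by rewrite [ltRHS](splitr e) ltrD // (lt_trans _ ke) //; exact: hy.
Qed.

Lemma open_borel (U : set 'rV[R]_n) : open U ->
  measurable (U : set (borel_rV R n)).
Proof.
move=> /open_bigcup_ball[F [-> hF]].
apply: countable_bigcupT_measurable => [|i]; first exact: countableP.
by have [->//|[z [r [_ ->]]]] := hF i; exact: borel_ball.
Qed.

Lemma borel_caratheodory (A : set 'rV[R]_n) :
  measurable (A : set (borel_rV R n)) -> measurable A.
Proof. by move=> mA; apply: sub_caratheodory; exact: sub_sigma_algebra. Qed.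

Lemma lebesgue_rV_borel (A : set 'rV[R]_n) :
  measurable (A : set (borel_rV R n)) -> mu A = muB A.
Proof. by move=> mA; rewrite /lebesgue_rV measurable_mu_extE. Qed.

Lemma open_measurable_rV (U : set 'rV[R]_n) : open U -> measurable U.
Proof. by move=> oU; apply: borel_caratheodory; exact: open_borel. Qed.

Lemma closed_measurable_rV (U : set 'rV[R]_n) : closed U -> measurable U.
Proof.
by move=> cU; rewrite -(setCK U); apply/measurableC/open_measurable_rV/closed_openC.
Qed.

(** Maps built from coordinates are shown measurable for the Borel sigma-algebra, which the
    coordinates generate; composing with this identity carries the result over to the completed
    one. *)
Lemma measurable_to_borel : measurable_fun setT (id : 'rV[R]_n -> borel_rV R n).
Proof. by move=> _ Y mY; rewrite setTI; exact: borel_caratheodory. Qed.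

Lemma measurable_coord (i : 'I_n) :
  measurable_fun setT (fun v : 'rV[R]_n => v ord0 i).
Proof. exact: measurableT_comp (measurable_coord_borel_rV i) measurable_to_borel. Qed.

Lemma continuous_borel (f : 'rV[R]_n -> R) : continuous f ->
  measurable_fun [set: borel_rV R n] f.
Proof.
move=> cf; apply: (measurability _ (measurable_realfun.RGenOpens.measurableE R)).
move=> _ [_ [a [b ->]] <-]; rewrite setTI; apply: open_borel.
by apply: open_comp => // x _; exact: cf.
Qed.

Lemma continuous_measurable_rV (f : 'rV[R]_n -> R) : continuous f ->
  measurable_fun setT f.
Proof.
by move=> cf; exact: measurableT_comp (continuous_borel cf) measurable_to_borel.
Qed.


Lemma integral_borel (f : borel_rV R n -> \bar R) :
  measurable_fun setT f -> (forall x, 0 <= f x)%E ->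
  (\int[mu]_x f x = \int[muB]_x f x)%E.
Proof.
move=> mf f0; apply/esym.
apply: (ge0_integral_transport measurable_to_borel _ mf f0) => A mA.
exact: lebesgue_rV_borel.
Qed.

End borel.

(** * Translation invariance and the measure of cubes *)

Section translation.
Context {R : realType}.
Local Notation leb := (@lebesgue_measure R).

Lemma lebesgue_measure_translation (a : R) (A : set R) : measurable A ->
  leb ((fun x => x + a) @^-1` A) = leb A.
Proof.
move=> mA; rewrite -[LHS]/(pushforward leb (fun x => x + a : measurableTypeR R) A).
apply/esym/lebesgue_measure_unique => //= [|ma _ [[b c]] _ <-].
  exact: measurable_funD.
rewrite /pushforward.
have -> : (fun x => x + a) @^-1` `]b, c]%classic = `]b - a, c - a]%classic.
  by apply/seteqP; split => x /=; rewrite !in_itv /= ltrBlDr lerBrDr.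
rewrite !lebesgue_measure_itv /= !lte_fin ltrD2r.
by case: ifP => // _; rewrite -!EFinD; congr EFin; ring.
Qed.

Lemma row_mx_coord0 n (t : R) (y : 'rV[R]_n) :
  (row_mx (t%:M : 'rV[R]_1) y : 'rV[R]_(1 + n)) ord0 ord0 = t.
Proof.
rewrite (_ : ord0 = lshift n ord0 :> 'I_(1 + n)); last exact: val_inj.
by rewrite row_mxEl mxE.
Qed.

Lemma measurable_translation_borel n (a : 'rV[R]_n) :
  measurable_fun [set: borel_rV R n] (fun x => x + a : borel_rV R n).
Proof.
apply: measurable_fun_borel_rV => i.
rewrite (_ : (fun _ => _) = (fun x : borel_rV R n => (x : 'rV_n) ord0 i + a ord0 i)).
  by apply: measurable_funD => //; exact: measurable_coord_borel_rV.
by apply/funext => x; rewrite mxE.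
Qed.

(** Induction along the product construction: the first coordinate of [a] is absorbed inside each
    section by invariance on the line, the others by the induction hypothesis applied to the outer
    integral. *)
Lemma lebesgue_borel_translation n (a : 'rV[R]_n) (A : set (borel_rV R n)) :
  measurable A ->
  lebesgue_borel_rV R n ((fun x => x + a) @^-1` A) = lebesgue_borel_rV R n A.
Proof.
elim: n a A => [a A mA|n IH a A mA].
  rewrite (_ : _ @^-1` A = A) //; apply/seteqP.
  by split => x /=; rewrite (_ : x + a = x) //; apply/rowP => -[].
have mcA : measurable (@cons_rV R n @^-1` A).
  by rewrite -[X in measurable X]setTI; exact: measurable_cons_rV.
rewrite /= /lebesgue_product /pushforward /product_measure2.
pose a0 := a ord0 ord0; pose a' : 'rV_n := @rsubmx R 1 1 n a.
have aE : a = row_mx (a0%:M : 'rV[R]_1) a'.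
  apply/rowP => i; case: (split_ordP (i : 'I_(1 + n))) => j ->.
    rewrite (@row_mxEl R 1 1 n) mxE !ord1 /= mulr1n /a0.
    by congr (a _ _); apply: val_inj.
  by rewrite (@row_mxEr R 1 1 n) mxE.
transitivity (\int[lebesgue_borel_rV R n]_y
   leb (ysection (@cons_rV R n @^-1` A) (y + a')%R))%E.
  apply: eq_integral => y _ /=.
  rewrite -[RHS](lebesgue_measure_translation a0); last exact: measurable_ysection.
  congr (leb _); apply/seteqP; split => t;
    rewrite /ysection /= !inE /= /cons_rV /= aE => h.
  by move: h; rewrite (add_row_mx (t%:M : 'rV_1)) -raddfD.
  by rewrite (add_row_mx (t%:M : 'rV_1)) -raddfD.
apply/esym; apply: (ge0_integral_transport (m1 := lebesgue_borel_rV R n)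
  (m2 := lebesgue_borel_rV R n) (phi := fun y : borel_rV R n => y + a' : borel_rV R n)
  (f := fun y => leb (ysection (@cons_rV R n @^-1` A) y))) => //.
- exact: measurable_translation_borel.
- by move=> B mB; exact: IH.
- exact: measurable_fun_ysection.
Qed.

(** A sup-norm ball is the product of an interval and a ball of one dimension less; this explicit
    measure is a reason for working with cubes later. *)
Lemma lebesgue_borel_ball n (z : 'rV[R]_n) r : 0 < r ->
  lebesgue_borel_rV R n (ball z r) = ((2 * r) ^+ n)%:E.
Proof.
move=> r0; elim: n z => [z|n IH z].
  rewrite expr0 /= (_ : ball z r = setT) ?diracT //.
  by apply/seteqP; split => // x _; rewrite (_ : x = z) //; [exact: ballxx|apply/rowP=> -[]].
rewrite /= /lebesgue_product /pushforward.
pose z' : 'rV_n := @rsubmx R 1 1 n z.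
have -> : @cons_rV R n @^-1` ball z r = ball (z ord0 ord0) r `*` ball z' r.
  rewrite !ball_rVE //; apply/seteqP; split => -[t y] /=.
    move=> h; split.
      by rewrite /ball /= distrC; have := h ord0; rewrite row_mx_coord0.
    move=> i; have := h (rshift 1 i).
    by rewrite /cons_rV (@row_mxEr R 1 1 n) /z' mxE.
  move=> [h1 h2] i; case: (split_ordP (i : 'I_(1 + n))) => j ->.
    rewrite /cons_rV (@row_mxEl R 1 1 n) mxE !ord1 /= distrC.
    by move: h1; rewrite /ball /=; congr (`|_ - _| < _); congr (z _ _); apply: val_inj.
  by rewrite /cons_rV (@row_mxEr R 1 1 n); have := h2 j; rewrite /z' mxE.
rewrite product_measure2E; last 2 first.
- exact: measurable_ball.
- exact: borel_ball.
apply: (etrans (congr2 mule (lebesgue_measure_ball _ (ltW r0)) (IH _))).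
by rewrite -EFinM -[r *+ 2]mulr_natl -exprS.
Qed.

End translation.

Section lebesgue_rV_theory.
Context {R : realType} {n : nat}.
Local Notation mu := (@lebesgue_rV R n).

Lemma lebesgue_rV_ball (z : 'rV[R]_n) r : 0 < r ->
  mu (ball z r) = ((2 * r) ^+ n)%:E.
Proof.
by move=> r0; rewrite lebesgue_rV_borel ?lebesgue_borel_ball //; exact: borel_ball.
Qed.

Lemma integral_translation (f : borel_rV R n -> \bar R) (a : 'rV[R]_n) :
  measurable_fun setT f -> (forall x, 0 <= f x)%E ->
  (\int[mu]_x f (x + a)%R = \int[mu]_x f x)%E.
Proof.
move=> mf f0.
rewrite (integral_borel mf f0) integral_borel //; last first.
  exact: (measurableT_comp mf (measurable_translation_borel a)).
apply/esym; apply: (ge0_integral_transport _ _ mf f0).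
- exact: measurable_translation_borel.
- by move=> A mA; exact: lebesgue_borel_translation.
Qed.

Let sigma_finite_rV : sigma_finite setT mu.
Proof.
exists (fun k : nat => ball (0 : 'rV[R]_n) k.+1%:R).
  apply/esym/seteqP; split => // x _.
  exists (Num.truncn `|x|) => //; rewrite -ball_normE /= sub0r normrN.
  exact: truncnS_gt.
move=> k; split; first exact/open_measurable_rV/ball_open.
by rewrite lebesgue_rV_ball ?ltr0n // ltry.
Qed.

HB.instance Definition _ := @Measure_isSigmaFinite.Build _ _ _ mu sigma_finite_rV.

End lebesgue_rV_theory.

(** * Density of continuous functions in L^2 *)

Lemma sqrD_le2 (R : realDomainType) (a b : R) :
  (a + b) ^+ 2 <= 2 * a ^+ 2 + 2 * b ^+ 2.
Proof. by have := sqr_ge0 (a - b); nra. Qed.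

(** When the two maxima are attained on different sides, their difference lies between [a - h] and
    [b - k], so its square is at most the sum of the two squares. It makes L^2 approximation stable
    under maxima. *)
Lemma sqrB_max_le (R : realDomainType) (a b h k : R) :
  (Num.max a b - Num.max h k) ^+ 2 <= 2 * (a - h) ^+ 2 + 2 * (b - k) ^+ 2.
Proof.
have key u v w : u <= v <= w -> v ^+ 2 <= u ^+ 2 + w ^+ 2 :> R.
  by move=> /andP[uv vw]; case: (lerP 0 v) => v0; nra.
have p1 := sqr_ge0 (a - h); have p2 := sqr_ge0 (b - k).
case: (leP a b) => ab; case: (leP h k) => hk; first by lra.
- by have := key (a - h) (b - h) (b - k); rewrite lerD2r lerD2l lerN2 ab ltW //; lra.
- by have := key (b - k) (a - k) (a - h); rewrite lerD2r lerD2l lerN2 hk ltW //; lra.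
- by lra.
Qed.

Lemma sqr_max0_le (R : realDomainType) (a : R) : (Num.max a 0) ^+ 2 <= a ^+ 2.
Proof. by case: (leP a 0) => // _; rewrite [0 ^+ 2]expr2 mul0r sqr_ge0. Qed.

Lemma max0_subE (R : realDomainType) (a : R) :
  Num.max a 0 + -1 * Num.max (- a) 0 = a.
Proof. by case: (leP a 0) => ?; case: leP => ?; lra. Qed.

Lemma dominated_small d (T : measurableType d) (R : realType)
    (mu : {measure set T -> \bar R}) (D : set T) (f : nat -> T -> R) (g : T -> R) :
  measurable D -> (forall k, measurable_fun D (f k)) ->
  (forall k x, D x -> 0 <= f k x <= g x) ->
  mu.-integrable D (EFin \o g) ->
  (forall x, D x -> f ^~ x @ \oo --> (0 : R)) ->
  forall e, 0 < e -> exists k, (\int[mu]_(x in D) (f k x)%:E <= e%:E)%E.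
Proof.
move=> mD mf fg ig f0 e e0.
have : (\int[mu]_(x in D) (f k x)%:E @[k --> \oo] --> \int[mu]_(x in D) cst 0%E x)%E.
  apply: (@dominated_cvg _ _ _ mu D mD _ _ (EFin \o g)) => //.
  - by move=> k; exact/measurable_EFinP.
  - by move=> x Dx; apply: cvg_EFin; [exact: nearW|exact: f0].
  - move=> k x Dx /=; have /andP[h1 h2] := fg k x Dx.
    by rewrite lee_fin ger0_norm.
rewrite integral0 => /fine_cvgP[[N _ hN]] /cvgrPdist_le /(_ _ e0)[M _ hM].
exists (maxn N M).
have hf := hN _ (leq_maxl N M); have := hM _ (leq_maxr N M).
rewrite sub0r normrN -(fineK hf) lee_fin; apply: le_trans.
exact: ler_norm.
Qed.

Section sq_integral.
Context d (T : measurableType d) (R : realType).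
Variables (mu : {measure set T -> \bar R}) (Q : set T).
Hypothesis mQ : measurable Q.

Lemma measurable_sqr_EFin (h : T -> R) : measurable_fun Q h ->
  measurable_fun Q (fun x => ((h x) ^+ 2)%:E).
Proof. by move=> mh; apply/measurable_EFinP/measurable_funX. Qed.

(** Stands in for the triangle inequality in L^2; the factors 2 avoid square roots. *)
Lemma le_integral_sqD (f a b : T -> R) (ea eb : R) :
  measurable_fun Q f -> measurable_fun Q a -> measurable_fun Q b ->
  (forall x, Q x -> (f x) ^+ 2 <= 2 * (a x) ^+ 2 + 2 * (b x) ^+ 2) ->
  (\int[mu]_(x in Q) ((a x) ^+ 2)%:E <= ea%:E)%E ->
  (\int[mu]_(x in Q) ((b x) ^+ 2)%:E <= eb%:E)%E ->
  (\int[mu]_(x in Q) ((f x) ^+ 2)%:E <= (2 * ea + 2 * eb)%:E)%E.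
Proof.
move=> mf ma mb fab ha hb.
apply: (@le_trans _ _ (\int[mu]_(x in Q) (2%:E * ((a x) ^+ 2)%:E + 2%:E * ((b x) ^+ 2)%:E))%E).
  apply: ge0_le_integral => //.
  - by move=> x _; rewrite lee_fin sqr_ge0.
  - exact: measurable_sqr_EFin.
  - by apply: emeasurable_funD; apply: measurable_funeM; exact: measurable_sqr_EFin.
rewrite ge0_integralD //; first last.
- by apply: measurable_funeM; exact: measurable_sqr_EFin.
- by move=> x _; rewrite -EFinM lee_fin mulr_ge0 ?sqr_ge0.
- by apply: measurable_funeM; exact: measurable_sqr_EFin.
- by move=> x _; rewrite -EFinM lee_fin mulr_ge0 ?sqr_ge0.
rewrite !ge0_integralZl_EFin //; try exact: measurable_sqr_EFin;
  try by move=> x _; rewrite lee_fin sqr_ge0.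
have -> : ((2 * ea + 2 * eb)%:E = 2%:E * ea%:E + 2%:E * eb%:E)%E.
  by rewrite -!EFinM -EFinD.
by apply: leeD; rewrite lee_pmul2l.
Qed.

Lemma integral_sqZ (f : T -> R) (c : R) : measurable_fun Q f ->
  (\int[mu]_(x in Q) ((c * f x) ^+ 2)%:E =
   (c ^+ 2)%:E * \int[mu]_(x in Q) ((f x) ^+ 2)%:E)%E.
Proof.
move=> mf; under eq_integral do rewrite exprMn EFinM.
rewrite ge0_integralZl_EFin ?sqr_ge0 //.
- by move=> x _; rewrite lee_fin sqr_ge0.
- exact: measurable_sqr_EFin.
Qed.

Lemma integral_sqB_indic_le (A B : set T) : measurable A -> measurable B ->
  A `&` Q `<=` B ->
  (\int[mu]_(x in Q) ((\1_A x - \1_B x : R) ^+ 2)%:E <= mu (B `\` (A `&` Q)))%E.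
Proof.
move=> mA mB AB.
have mBA : measurable (B `\` (A `&` Q)) by apply: measurableD => //; exact: measurableI.
rewrite -(setIT (B `\` (A `&` Q))) -integral_indic // integral_mkcond.
apply: ge0_le_integral => //.
- by move=> x _; rewrite patchE; case: ifP => // _; rewrite lee_fin sqr_ge0.
- apply/(measurable_restrictT _ mQ); apply: measurable_sqr_EFin.
  by apply/measurable_funTS/measurable_funB; exact: measurable_indic.
- by apply/measurable_EFinP; exact: measurable_indic.
move=> x _; rewrite patchE; case: ifPn => xQ; last by rewrite lee_fin indicE.
rewrite lee_fin !indicE in_setD in_setI xQ andbT.
have [xA|xA] := boolP (x \in A).
  have xB : x \in B.
    by rewrite inE; apply: AB; split; [rewrite inE in xA|rewrite inE in xQ].
  by rewrite xB /= subrr expr0n.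
by rewrite /= sub0r sqrrN; case: (x \in B); rewrite /= ?expr1n ?expr0n.
Qed.

End sq_integral.

(* The L^2(Q)-closure of a class C of functions stable under the operations
   needed to recover all of L^2(Q) from it. *)
Section density.
Import HBNNSimple.
Context d (T : measurableType d) (R : realType).
Variables (mu : {measure set T -> \bar R}) (Q : set T) (C : set (T -> R)).
Hypotheses (mQ : measurable Q) (finQ : (mu Q < +oo)%E).
Hypotheses (mC : forall h, C h -> measurable_fun setT h)
  (CD : forall f g, C f -> C g -> C (f \+ g))
  (CZ : forall c f, C f -> C (fun x => c * f x))
  (Cmax : forall f g, C f -> C g -> C (fun x => Num.max (f x) (g x)))
  (C1 : C (cst 1)).

Definition L2_approx (w : T -> R) := measurable_fun setT w /\
  forall e, 0 < e -> exists2 h : T -> R, C h &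
    (\int[mu]_(x in Q) ((w x - h x) ^+ 2)%:E <= e%:E)%E.

Lemma L2_approx_mem h : C h -> L2_approx h.
Proof.
move=> Ch; split; first exact: mC.
move=> e e0; exists h => //; under eq_integral do rewrite subrr expr0n /=.
by rewrite integral0 lee_fin ltW.
Qed.

Let mB (f g : T -> R) : measurable_fun setT f -> measurable_fun setT g ->
  measurable_fun Q (fun x => f x - g x).
Proof. by move=> mf mg; apply/measurable_funTS/measurable_funB. Qed.

Lemma L2_approx_lim (w : T -> R) : measurable_fun setT w ->
  (forall e : R, 0 < e -> exists2 w' : T -> R, L2_approx w' &
    (\int[mu]_(x in Q) ((w x - w' x) ^+ 2)%:E <= e%:E)%E) -> L2_approx w.
Proof.
move=> mw hw; split => // e e0.
have e4 : 0 < e / 4 by rewrite divr_gt0.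
have [w' [mw' aw'] ww'] := hw _ e4.
have [h Ch w'h] := aw' _ e4; exists h => //.
have mh := mC Ch.
apply: le_trans (le_integral_sqD mQ (mB mw mh) (mB mw mw') (mB mw' mh) _ ww' w'h) _.
- by move=> x _; apply: le_trans (sqrD_le2 _ _); rewrite addrA subrK.
- by rewrite lee_fin; lra.
Qed.

Lemma L2_approxD f g : L2_approx f -> L2_approx g -> L2_approx (f \+ g).
Proof.
move=> [mf af] [mg ag]; have mfg := measurable_funD mf mg; split => // e e0.
have e4 : 0 < e / 4 by rewrite divr_gt0.
have [h ch fh] := af _ e4; have [k ck gk] := ag _ e4.
have mh := mC ch; have mk := mC ck.
exists (h \+ k); first exact: CD.
apply: le_trans (le_integral_sqD mQ (mB mfg (mC (CD ch ck))) (mB mf mh) (mB mg mk) _ fh gk) _.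
- by move=> x _; apply: le_trans (sqrD_le2 _ _) => /=; rewrite opprD addrACA.
- by rewrite lee_fin; lra.
Qed.

Lemma L2_approxZ c f : L2_approx f -> L2_approx (fun x => c * f x).
Proof.
move=> [mf af]; split; first exact: measurable_funM.
move=> e e0; have c0 : 0 < c ^+ 2 + 1 by have := sqr_ge0 c; lra.
have [h ch fh] := af _ (divr_gt0 e0 c0).
have mh := mC ch.
exists (fun x => c * h x); first exact: CZ.
under eq_integral do rewrite -mulrBr.
rewrite integral_sqZ //; last exact: mB.
apply: (@le_trans _ _ ((c ^+ 2)%:E * (e / (c ^+ 2 + 1))%:E)%E).
  by apply: lee_wpmul2l => //; rewrite lee_fin sqr_ge0.
rewrite -EFinM lee_fin mulrA ler_pdivrMr //.
by have := sqr_ge0 c; nra.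
Qed.

Lemma L2_approx_max f g : L2_approx f -> L2_approx g ->
  L2_approx (fun x => Num.max (f x) (g x)).
Proof.
move=> [mf af] [mg ag]; have mfg := measurable_maxr mf mg; split => // e e0.
have e4 : 0 < e / 4 by rewrite divr_gt0.
have [h ch fh] := af _ e4; have [k ck gk] := ag _ e4.
have mh := mC ch; have mk := mC ck.
exists (fun x => Num.max (h x) (k x)); first exact: Cmax.
apply: le_trans (le_integral_sqD mQ (mB mfg (mC (Cmax ch ck))) (mB mf mh) (mB mg mk) _ fh gk) _.
- by move=> x _; exact: sqrB_max_le.
- by rewrite lee_fin; lra.
Qed.

Lemma L2_approx_cvg (w : nat -> T -> R) (v g : T -> R) :
  measurable_fun setT v -> (forall k, L2_approx (w k)) ->
  (forall k x, Q x -> (v x - w k x) ^+ 2 <= g x) ->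
  mu.-integrable Q (EFin \o g) ->
  (forall x, Q x -> w ^~ x @ \oo --> v x) -> L2_approx v.
Proof.
move=> mv aw wg ig wv; apply: L2_approx_lim => // e e0.
have [|||k hk] := dominated_small mQ
    (f := fun k x => (v x - w k x) ^+ 2) _ _ ig _ e0.
- by move=> k; apply: measurable_funX; apply: mB => //; exact: (aw k).1.
- by move=> k x Qx; rewrite sqr_ge0 wg.
- move=> x Qx; rewrite -[X in _ --> X](_ : (v x - v x) ^+ 2 = 0 :> R); last first.
    by rewrite subrr expr0n.
  by apply: cvgM; apply: cvgB; [exact: cvg_cst|exact: wv|exact: cvg_cst|exact: wv].
- by exists (w k).
Qed.

Lemma L2_approx_setC A : measurable A -> L2_approx \1_A -> L2_approx \1_(~` A).
Proof.
move=> mA aA; rewrite (_ : \1_(~` A) = cst 1 \+ (fun x => (-1) * \1_A x)).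
  by apply: L2_approxD; [exact: L2_approx_mem|exact: L2_approxZ].
apply/funext => x /=; rewrite !indicE in_setC.
by case: (x \in A) => /=; rewrite ?mulr0 ?addr0 // mulr1 subrr.
Qed.

Let ig_cst (c : R) : mu.-integrable Q (EFin \o cst c).
Proof.
apply/integrableP; split; first exact/measurable_EFinP/measurable_cst.
by rewrite /= integral_cst // lte_mul_pinfty // lee_fin.
Qed.

(** Finite unions are maxima of indicator functions. The countable union follows by dominated
    convergence, the constant 1 being integrable because [Q] has finite measure. *)
Lemma L2_approx_bigcup (A : (set T)^nat) : (forall k, measurable (A k)) ->
  (forall k, L2_approx \1_(A k)) -> L2_approx \1_(\bigcup_k A k).
Proof.
move=> mA aA.
pose B k : set T := \big[setU/set0]_(i < k) A i.
have aB k : L2_approx \1_(B k).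
  elim: k => [|k IH]; rewrite /B.
    rewrite big_ord0 indic0 (_ : cst 0 = (fun x => 0 * cst 1 x)) /=.
      by apply: L2_approxZ; exact: L2_approx_mem.
    by apply/funext => x; rewrite mul0r.
  rewrite big_ord_recr /= (_ : \1_(_ `|` _) = fun x => Num.max (\1_(B k) x) (\1_(A k) x)).
    exact: L2_approx_max.
  apply/funext => x; rewrite !indicE in_setU.
  rewrite -/(B k); case: (x \in B k); case: (x \in A k) => /=; rewrite ?maxxx //.
    by rewrite max_l.
  by rewrite max_r.
apply: (@L2_approx_cvg (fun k => \1_(B k)) _ (cst 1)) => //.
- by apply: measurable_indic; exact: bigcupT_measurable.
- move=> k x _ /=; rewrite !indicE.
  by case: (x \in _); case: (x \in _); rewrite /= ?subrr ?sub0r ?subr0 ?sqrrN ?expr0n ?expr1n ?ler01.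
- move=> x _; apply/cvgrPdist_lt => e e0.
  have [[i _ Aix]|nA] := pselect ((\bigcup_k A k) x).
    exists i.+1 => // m /= im; rewrite !indicE.
    rewrite !mem_set ?subrr ?normr0 //; last by exists i.
    rewrite /B -bigcup_mkord; exists i => //.
  exists 0%N => // m _; rewrite !indicE !memNset ?subrr ?normr0 //.
  by rewrite /B -bigcup_mkord => -[i _ Aix]; apply: nA; exists i.
Qed.

(** The increasing simple approximations [s k] lie between 0 and [w], so (w - s k)^2 <= w^2 and
    dominated convergence applies. *)
Lemma L2_approx_ge0 (w : T -> R) : measurable_fun setT w -> (forall x, 0 <= w x) ->
  mu.-integrable Q (EFin \o (fun x => (w x) ^+ 2)) ->
  (forall A, measurable A -> L2_approx \1_A) -> L2_approx w.
Proof.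
move=> mw w0 iw aA.
have mwE : measurable_fun setT (EFin \o w) by exact/measurable_EFinP.
pose s := nnsfun_approx measurableT mwE.
have w0E x : setT x -> (0 <= (EFin \o w) x)%E by move=> _; rewrite lee_fin.
have := @L2_approx_cvg (fun k => s k : T -> R) w (fun x => (w x) ^+ 2) mw.
apply => //.
- move=> k.
  rewrite (_ : (s k : T -> R) = \sum_(y \in range (s k)) (fun x => y * \1_(s k @^-1` [set y]) x)).
    rewrite fsbig_finite //=; elim/big_ind : _ => [|f g|y _].
    + rewrite (_ : 0 = (fun x => 0 * cst 1 x)) /=.
        by apply: L2_approxZ; exact: L2_approx_mem.
      by apply/funext => x; rewrite mul0r.
    + exact: L2_approxD.
    + by apply: L2_approxZ; apply: aA; exact: measurable_funPTI.
  apply/funext => x; rewrite [LHS]fimfunE fsbig_finite //= [in RHS]fsbig_finite //=.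
  by rewrite fct_sumE.
- move=> k x _.
  have h : s k x <= w x.
    by have := le_approx (f := EFin \o w) k w0E (x := x) Logic.I; rewrite /s nnsfun_approxE lee_fin.
  rewrite ler_sqr ?nnegrE ?subr_ge0 //.
  by rewrite lerBlDr lerDl.
- move=> x _.
  have := cvg_nnsfun_approx measurableT mwE w0E (x := x) Logic.I.
  by move=> /fine_cvg.
Qed.

Lemma L2_dense (w : T -> R) : measurable_fun setT w ->
  mu.-integrable Q (EFin \o (fun x => (w x) ^+ 2)) ->
  (forall A, measurable A -> L2_approx \1_A) -> L2_approx w.
Proof.
move=> mw iw aA.
have mp := measurable_maxr mw (measurable_cst (0 : R)).
have mn := measurable_maxr (measurable_funN mw) (measurable_cst (0 : R)).
have le_int (f : T -> R) : measurable_fun setT f -> (forall x, (f x) ^+ 2 <= (w x) ^+ 2) ->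
    mu.-integrable Q (EFin \o (fun x => (f x) ^+ 2)).
  move=> mf fw; apply: le_integrable iw => //.
    exact/measurable_sqr_EFin/measurable_funTS.
  by move=> x _ /=; rewrite lee_fin !ger0_norm ?sqr_ge0.
have := L2_approxD
  (L2_approx_ge0 mp (fun x => ltac:(by rewrite le_max lexx orbT)) (le_int _ mp _) aA)
  (L2_approxZ (-1) (L2_approx_ge0 mn (fun x => ltac:(by rewrite le_max lexx orbT)) (le_int _ mn _) aA)).
case.
- by move=> x; exact: sqr_max0_le.
- by move=> x; rewrite -(sqrrN (w x)); exact: sqr_max0_le.
move=> h1 h2; split => // e /h2[h Ch hh]; exists h => //.
apply: le_trans hh; rewrite le_eqVlt; apply/orP; left; apply/eqP.
apply: eq_integral => x _; congr (_ ^+ 2)%:E; congr (_ - _).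
by rewrite /= max0_subE.
Qed.

End density.

Lemma continuous_constr (T : topologicalType) (R : realType) (c : R) :
  continuous (fun _ : T => c).
Proof. by move=> x; exact: cvg_cst. Qed.

Section density_rV.
Context {R : realType} {n : nat}.
Local Notation mu := (@lebesgue_rV R n).
Variable Q : set 'rV[R]_n.
Hypotheses (mQ : measurable Q) (finQ : (mu Q < +oo)%E).

Let C : set ('rV[R]_n -> R) := [set h | continuous h].
Let mC (h : 'rV[R]_n -> R) : C h -> measurable_fun setT h.
Proof. exact: continuous_measurable_rV. Qed.
Let CD (f g : 'rV[R]_n -> R) : C f -> C g -> C (f \+ g).
Proof. by move=> cf cg x; apply: continuousD; [exact: cf|exact: cg]. Qed.
Let CZ (c : R) (f : 'rV[R]_n -> R) : C f -> C (fun x => c * f x).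
Proof. by move=> cf x; exact: (cvgM (cvg_cst c) (cf x)). Qed.
Let Cmax (f g : 'rV[R]_n -> R) : C f -> C g -> C (fun x => Num.max (f x) (g x)).
Proof. by move=> cf cg x; apply: continuous_max; [exact: cf|exact: cg]. Qed.
Let C1 : C (cst 1).
Proof. exact: continuous_constr. Qed.

Local Notation appr := (L2_approx mu Q C).

Let appr0 : appr \1_set0.
Proof.
rewrite indic0 (_ : cst 0 = (fun x : 'rV[R]_n => 0 * cst 1 x)) /=.
  by apply: L2_approx_mem => //; exact: continuous_constr.
by apply/funext => x; rewrite mul0r.
Qed.

Let appr_ball (z : 'rV[R]_n) (r : R) : 0 < r -> appr \1_(ball z r).
Proof.
move=> r0.
(* Continuous truncations at 1 of k (r - |x - z|), positive part taken: they converge to 1 inside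
   the ball and vanish outside it. *)
pose h (k : nat) (x : 'rV[R]_n) : R := Num.min 1 (k%:R * Num.max 0 (r - `|x - z|)).
have hP k x : 0 <= h k x <= 1.
  rewrite /h ge_min lexx /= le_min ler01 /= mulr_ge0 //.
  by rewrite le_max lexx.
have cnorm : continuous (fun x : 'rV[R]_n => r - `|x - z|).
  by move=> x; exact: (cvgB (cvg_cst r) (cvg_norm (cvgB cvg_id (cvg_cst z)))).
have ch k : C (h k).
  pose m (x : 'rV[R]_n) : R := Num.max 0 (r - `|x - z|).
  have cm : C m := Cmax (@continuous_constr _ _ 0) cnorm.
  rewrite (_ : h k = fun x => (-1) * Num.max ((-1) * cst 1 x) ((-1) * (k%:R * m x))).
    by apply: CZ; apply: Cmax; apply: CZ => //; exact: CZ.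
  apply/funext => x; by rewrite /h -/(m x) !mulN1r oppr_max !opprK.
apply: (@L2_approx_cvg _ _ _ mu Q C mQ mC h _ (cst 1)).
- by apply: measurable_indic; apply: open_measurable_rV; exact: ball_open.
- by move=> k; apply: L2_approx_mem => //; exact: ch.
- move=> k x _ /=; have /andP[h0 h1] := hP k x; rewrite indicE.
  by case: (x \in _) => /=; nra.
- apply/integrableP; split; first by apply/measurable_EFinP; exact: measurable_cst.
  by rewrite /= integral_cst // lte_mul_pinfty // lee_fin.
- move=> x _; rewrite indicE; case: (pselect (ball z r x)) => [bx|nbx].
    rewrite mem_set //=; move: bx; rewrite -ball_normE /= distrC => bx.
    have p0 : 0 < r - `|x - z| by rewrite subr_gt0.
    apply: cvg_near_cst; exists (Num.truncn (r - `|x - z|)^-1).+1 => // k /= hk.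
    rewrite /h (max_r (ltW p0)); apply/min_idPl.
    rewrite -ler_pdivrMr // mul1r (le_trans (ltW (truncnS_gt _))) //.
    by rewrite ler_nat.
  rewrite memNset //=; apply: cvg_near_cst; exists 0%N => // k _.
  rewrite /h max_l ?mulr0; last first.
    by rewrite subr_le0 leNgt; apply/negP => hx; apply: nbx; rewrite -ball_normE /= distrC.
  by rewrite minC; apply/min_idPl.
Qed.

Let appr_countable (I : countType) (F : I -> set 'rV[R]_n) :
  (forall i, measurable (F i)) -> (forall i, appr \1_(F i)) ->
  appr \1_(\bigcup_i F i).
Proof.
move=> mF aF.
pose A k : set 'rV[R]_n := if @unpickle I k is Some i then F i else set0.
rewrite (_ : \bigcup_i F i = \bigcup_k A k).
  apply: (L2_approx_bigcup mQ finQ mC CZ Cmax C1) => k; rewrite /A; case: (unpickle k) => [i|].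
  - exact: mF.
  - exact: measurable0.
  - exact: aF.
  - exact: appr0.
apply/seteqP; split => x [i _ Fx].
  by exists (pickle i) => //; rewrite /A pickleK.
by move: Fx; rewrite /A; case: (unpickle i) => // j; exists j.
Qed.

Let appr_open (U : set 'rV[R]_n) : open U -> appr \1_U.
Proof.
move=> /open_bigcup_ball[F [-> hF]]; apply: appr_countable => i.
  have [->|[z [r [_ ->]]]] := hF i; first exact: measurable0.
  by apply: open_measurable_rV; exact: ball_open.
by have [->|[z [r [r0 ->]]]] := hF i; [exact: appr0|exact: appr_ball].
Qed.

(** The good sets form a sigma-algebra containing the open sets. Minimality is used twice: for the
    coordinate preimages that generate [borel_rV], and for the open sets, whose sigma-algebra
    contains those preimages. *)
Let appr_borel (A : set (borel_rV R n)) : measurable A -> appr \1_(A : set 'rV[R]_n).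
Proof.
move=> mA.
pose G : set (set 'rV[R]_n) := [set B | measurable B /\ appr \1_B].
have sG : sigma_algebra setT G.
  split.
  - by split; [exact: measurable0|exact: appr0].
  - move=> B [mB aB]; rewrite setTD; split; first exact: measurableC.
    exact: (L2_approx_setC mQ mC CD CZ C1 mB aB).
  - move=> F hF; split; first by apply: bigcupT_measurable => k; exact: (hF k).1.
    by apply: (L2_approx_bigcup mQ finQ mC CZ Cmax C1) => k; [exact: (hF k).1|exact: (hF k).2].
suff : G A by case.
have := mA; apply: (smallest_sub sG) => B.
rewrite /borel_rV_gen -bigcup_seq/= => -[i _ [Y mY <-]]; rewrite setTI.
pose gT := g_sigma_algebraType (@open 'rV[R]_n).
have mi : @measurable_fun _ _ gT R setT (fun v : gT => (v : 'rV[R]_n) ord0 i).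
  apply: (measurability _ (measurable_realfun.RGenOpens.measurableE R)).
  move=> _ [_ [a [b ->]] <-]; rewrite setTI; apply: sub_sigma_algebra.
  by apply: open_comp => // x _; exact: coord_continuous.
have := mi measurableT _ mY; rewrite setTI; apply: (smallest_sub sG) => U oU.
by split; [exact: open_measurable_rV|exact: appr_open].
Qed.

Let appr_measurable (A : set 'rV[R]_n) : measurable A -> appr \1_A.
Proof.
move=> mA; apply: (L2_approx_lim mQ mC); first exact: (measurable_indic mA).
move=> e e0.
have mAQ : measurable (A `&` Q) by exact: measurableI.
have finAQ : (mu (A `&` Q) < +oo)%E.
  by apply: le_lt_trans finQ; apply: le_measure; rewrite ?inE //; exact: subIsetr.
have mue : (mu (A `&` Q) < mu (A `&` Q) + e%:E)%E.
  by rewrite lteDl ?lte_fin // ge0_fin_numE.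
(* The completed measure is an infimum over countable Borel covers, so some cover of A intersected
   with Q exceeds its measure by less than [e]. *)
have /ereal_inf_lt[_ [B [mB AB] <-] hB] := mue.
pose B' : set 'rV[R]_n := \bigcup_k B k.
have mB'b : @measurable _ (borel_rV R n) B' by exact: bigcupT_measurable.
have mB' : measurable B' by exact: borel_caratheodory.
exists \1_B'; first exact: appr_borel.
have hB' : (mu B' < mu (A `&` Q) + e%:E)%E.
  apply: le_lt_trans hB; rewrite [leLHS]lebesgue_rV_borel //.
  exact: measure_sigma_subadditive.
have mBA : measurable (B' `\` (A `&` Q)) by exact: measurableD.
apply: le_trans (integral_sqB_indic_le mu mQ mA mB' AB) _.
rewrite measureD //; last first.
  by apply: (lt_trans hB'); rewrite lte_add_pinfty // ltry.
rewrite (_ : B' `&` (A `&` Q) = A `&` Q); last by apply: setIidr; exact: AB.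
rewrite leeBlDl; last by rewrite ge0_fin_numE.
exact: ltW.
Qed.

Lemma L2_dense_continuous (w : 'rV[R]_n -> R) : measurable_fun setT w ->
  mu.-integrable Q (EFin \o (fun x => (w x) ^+ 2)) ->
  forall e : R, 0 < e -> exists2 h : 'rV[R]_n -> R, continuous h &
    (\int[mu]_(x in Q) ((w x - h x) ^+ 2)%:E <= e%:E)%E.
Proof.
move=> mw iw.
by have [] := L2_dense mQ mC CD CZ C1 mw iw appr_measurable.
Qed.

End density_rV.

(** * Smooth functions *)

(* The functions x |-> P(1/x) exp(-1/x) for x > 0, extended by 0: this class is
   stable under derivation. *)
Section flat_exp.
Context {R : realType}.
Implicit Types (P Q : {poly R}) (x t : R).

Definition flat_exp P x : R := if 0 < x then P.[x^-1] * expR (- x^-1) else 0.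

(** With y = 1/x, the derivative in x of P(y) exp(-y) is y^2 (P - P')(y) exp(-y). *)
Definition flat_deriv P : {poly R} := 'X^2 * (P - P^`()).

(** Coefficientwise, t^i exp(-t) <= i!, from a single term of the exponential series. *)
Lemma horner_expRN_bounded P : exists2 C : R, 0 <= C &
  forall t, 0 <= t -> `|P.[t]| * expR (- t) <= C.
Proof.
exists (\sum_(i < size P) `|P`_i| * i`!%:R).
  by apply: sumr_ge0 => i _; rewrite mulr_ge0.
move=> t t0; rewrite horner_coef.
apply: (@le_trans _ _ (\sum_(i < size P) `|P`_i| * (t ^+ i * expR (- t)))).
  apply: le_trans (ler_wpM2r (expR_ge0 _) (ler_norm_sum _ _ _)) _.
  rewrite mulr_suml; apply: ler_sum => i _.
  by rewrite normrM (ger0_norm (exprn_ge0 _ t0)) mulrA.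
apply: ler_sum => i _; apply: ler_wpM2l => //.
rewrite expRN ler_pdivrMr ?expR_gt0 //.
case: (nat_of_ord i) => [|k].
  by rewrite expr0 fact0 mul1r; apply: le_trans (expR_ge1Dx t); rewrite lerDl.
have f0 : 0 < (k.+1)`!%:R :> R by rewrite ltr0n fact_gt0.
rewrite -ler_pdivrMl // mulrC.
by apply: le_trans (expR_ge1Dxn k t0); rewrite lerDr ler01.
Qed.

(** This is the previous bound for X^2 P at 1/x, multiplied by x^2. Quadratic flatness gives
    differentiability at 0; it also bounds [ramp2] and the gradient of [cube_bump]. *)
Lemma flat_exp_le_sqr P : exists2 C : R, 0 <= C &
  forall x, `|flat_exp P x| <= C * x ^+ 2.
Proof.
have [C C0 hC] := horner_expRN_bounded ('X^2 * P).
exists C => // x; rewrite /flat_exp; case: ifPn => x0; last first.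
  by rewrite normr0 mulr_ge0 ?sqr_ge0.
have xV : 0 <= x^-1 by rewrite invr_ge0 ltW.
have := hC _ xV; rewrite hornerM hornerXn normrM (ger0_norm (exprn_ge0 2 xV)) => h.
rewrite normrM (ger0_norm (expR_ge0 _)).
rewrite -ler_pdivrMr ?exprn_gt0 // (le_trans _ h) // exprVn.
by rewrite le_eqVlt; apply/orP; left; apply/eqP; ring.
Qed.

Lemma is_derive_flat_exp P x : is_derive x 1 (flat_exp P) (flat_exp (flat_deriv P) x).
Proof.
have [x0|x0|x0] := ltrgtP x 0.
- rewrite [X in is_derive _ _ _ X]/flat_exp ltNge (ltW x0) /=.
  apply: (@near_eq_is_derive _ _ _ (cst 0)).
  near=> y; rewrite /flat_exp ifF //; apply/negbTE; rewrite -leNgt ltW //.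
  near: y; exact: lt_nbhsl.
- have xn : x != 0 by rewrite gt_eqF.
  have dV : is_derive x 1 (fun y : R => y^-1) (- x ^- 2).
    apply: DeriveDef; first exact: derivableV.
    by rewrite deriveV // derive_id /GRing.scale /= mulr1.
  have dVN : is_derive x 1 (fun y : R => - y^-1) (x ^- 2).
    by apply: is_derive_eq (is_deriveN dV) _; rewrite opprK.
  have d1 := is_derive1_comp (is_derive_poly P x^-1) dV.
  have d2 := @is_derive1_comp _ expR (fun y : R => - y^-1) x _ _ (is_derive_expR _) dVN.
  apply: (near_eq_is_derive _ (is_derive_eq (is_deriveM d1 d2) _)).
    near=> y; rewrite [RHS]/flat_exp ifT //; near: y; exact: lt_nbhsr.
  rewrite /flat_exp x0 /flat_deriv hornerM hornerXn hornerD hornerN /GRing.scale /=.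
  by rewrite -exprVn; ring.
- rewrite x0 [X in is_derive _ _ _ X]/flat_exp ltxx.
  have [C C0 hC] := flat_exp_le_sqr P.
  have f0 : flat_exp P 0 = 0 by rewrite /flat_exp ltxx.
  (* At 0 the slope of Caratheodory's criterion is [flat_exp P z / z], at most C |z| in absolute
     value. The convention that division by 0 gives 0 supplies the right value at z = 0. *)
  apply/is_derive1_caratheodory; exists (fun z => flat_exp P z / z); split.
  + move=> z; rewrite f0 !subr0; have [->|z0] := eqVneq z 0.
      by rewrite f0 mulr0.
    by rewrite divfK.
  + apply/cvgrPdist_le => e e0.
    near=> z; rewrite /= f0 mul0r sub0r normrN normrM normfV.
    have [->|z0] := eqVneq z 0; first by rewrite f0 normr0 mul0r ltW.
    rewrite ler_pdivrMr ?normr_gt0 //; apply: le_trans (hC z) _.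
    rewrite -real_normK ?num_real // expr2 mulrA ler_pM2r ?normr_gt0 //.
    have : `|z| <= e / (C + 1).
      near: z; apply/nbhs_ballP; exists (e / (C + 1)) => /=.
        by rewrite divr_gt0 // ltr_wpDl.
      by move=> y; rewrite /ball_ /= sub0r normrN => /ltW.
    by rewrite ler_pdivlMr ?ltr_wpDl //; have := normr_ge0 z; nra.
  + by rewrite f0 mul0r.
Unshelve. all: by end_near. Qed.

Lemma continuous_flat_exp P : continuous (flat_exp P).
Proof.
move=> x; apply/differentiable_continuous/derivable1_diffP.
by have [] := is_derive_flat_exp P x.
Qed.

End flat_exp.

Section chain_rule.
Context {R : realType} {V : normedModType R}.

Lemma is_derive_line (f : V -> R) x v (l : R) :
  is_derive x v f l <-> is_derive (0 : R) 1 (fun h : R => f (h *: v + x)) l.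
Proof.
have e : 'D_1 (fun h : R => f (h *: v + x)) 0 = 'D_v f x.
  rewrite /derive; set g1 := fun h => h^-1 *: _; set g2 := fun h => h^-1 *: _.
  suff -> : g1 = g2 by [].
  by rewrite funeqE /g1 /g2 => h /=; rewrite addr0 scale0r add0r [_%:A]mulr1.
split=> -[d dl]; apply: DeriveDef.
- exact: (iffLR (derivable1P f x v) d).
- by rewrite e.
- exact: (iffRL (derivable1P f x v) d).
- by rewrite -e.
Qed.

Lemma is_derive_comp_line (e : R -> R) (f : V -> R) x v (a b : R) :
  is_derive (f x) 1 e a -> is_derive x v f b ->
  is_derive x v (fun y => e (f y)) (a * b).
Proof.
move=> de /is_derive_line df; apply/is_derive_line.
apply: (@is_derive1_comp _ e (fun h : R => f (h *: v + x))) => //.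
by rewrite scale0r add0r.
Qed.

Lemma is_derive_along (f : V -> R) (df : V -> R) x v (t : R) :
  (forall y, is_derive y v f (df y)) ->
  is_derive t 1 (fun h : R => f (h *: v + x)) (df (t *: v + x)).
Proof.
move=> d; have /is_derive_line h := d (t *: v + x).
rewrite (_ : (fun h : R => f (h *: v + x)) =
  (fun h : R => f (h *: v + (t *: v + x))) \o (fun h : R => h - t)); last first.
  by apply/funext => k /=; rewrite addrA -scalerDl subrK.
rewrite -[df _]mulr1; apply: is_derive1_comp; first by rewrite subrr.
exact: is_derive_shift.
Qed.

End chain_rule.

Section smooth_functions.
Context {R : realType} {n : nat}.
Implicit Types (f g : 'rV[R]_n -> R) (S : set ('rV[R]_n -> R)).
Local Notation e_ i := (delta_mx ord0 i : 'rV[R]_n).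

Definition smooth_stable S := forall f, S f -> continuous f /\
  forall i, (forall x, derivable f x (e_ i)) /\ S (pderiv i f).

(** A coinduction principle: exhibiting a class closed under one differentiation replaces formulas
    for iterated partial derivatives. *)
Lemma smooth_coind S : smooth_stable S -> forall f, S f -> smooth f.
Proof.
move=> hS f Sf s; have : S (foldr (@pderiv R n) f s).
  by elim: s => //= i s /hS[_ /(_ i)[]].
by move=> /hS[c d]; split => // i x; exact: (d i).1.
Qed.

Lemma smooth_continuous f : smooth f -> continuous f.
Proof. by move=> /(_ [::])[]. Qed.

Lemma smooth_derive f i x : smooth f -> is_derive x (e_ i) f (pderiv i f x).
Proof. by move=> /(_ [::])[_ d]; apply/derivableP/d. Qed.

Lemma smooth_pderiv f i : smooth f -> smooth (pderiv i f).
Proof. by move=> sf s; have := sf (rcons s i); rewrite foldr_rcons. Qed.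

(** A differential algebra of expressions. Composition with [flat_exp P] is allowed for every [P] at
    once because differentiation turns [P] into [flat_deriv P]. *)
Inductive smooth_gen : ('rV[R]_n -> R) -> Prop :=
| smooth_gen_base f : smooth f -> smooth_gen f
| smooth_gen_cst c : smooth_gen (cst c)
| smooth_gen_coord i : smooth_gen (fun x => x ord0 i)
| smooth_gen_add f g : smooth_gen f -> smooth_gen g -> smooth_gen (f \+ g)
| smooth_gen_mul f g : smooth_gen f -> smooth_gen g -> smooth_gen (f \* g)
| smooth_gen_flat P f : smooth_gen f -> smooth_gen (fun x => flat_exp P (f x)).

Lemma is_derive_coord (i j : 'I_n) (x : 'rV[R]_n) :
  is_derive x (e_ i) (fun y : 'rV[R]_n => y ord0 j) ((i == j)%:R).
Proof.
apply/is_derive_line; rewrite (_ : (fun h : R => _) = (fun h : R => (i == j)%:R * h + x ord0 j)).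
  apply: is_derive_eq (is_deriveD (is_deriveZ (i == j)%:R (is_derive_id _ _)) (is_derive_cst _ _ _)) _.
  by rewrite addr0 /GRing.scale /= mulr1.
by apply/funext => h; rewrite !mxE eqxx /= eq_sym mulrC.
Qed.

Lemma smooth_gen_derive f : smooth_gen f -> continuous f /\
  forall i, exists2 g, smooth_gen g & forall x, is_derive x (e_ i) f (g x).
Proof.
elim=> {f}[f sf|c|j|f g gf [cf df] gg [cg dg]|f g gf [cf df] gg [cg dg]|P f gf [cf df]].
- split; first exact: smooth_continuous.
  move=> i; exists (pderiv i f); first exact/smooth_gen_base/smooth_pderiv.
  by move=> x; exact: smooth_derive.
- split; first exact: continuous_constr.
  by move=> i; exists (cst 0); [exact: smooth_gen_cst|move=> x; exact: is_derive_cst].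
- split; first exact: coord_continuous.
  move=> i; exists (cst (i == j)%:R); first exact: smooth_gen_cst.
  by move=> x; exact: is_derive_coord.
- split; first by move=> x; exact: (cvgD (cf x) (cg x)).
  move=> i; have [f' gf' df'] := df i; have [g' gg' dg'] := dg i.
  exists (f' \+ g'); first exact: smooth_gen_add.
  by move=> x; exact: is_deriveD.
- split; first by move=> x; exact: (cvgM (cf x) (cg x)).
  move=> i; have [f' gf' df'] := df i; have [g' gg' dg'] := dg i.
  exists ((f \* g') \+ (g \* f')).
    by apply: smooth_gen_add; exact: smooth_gen_mul.
  by move=> x; exact: is_deriveM.
- split; first by move=> x; apply: (cvg_comp _ _ (cf x)); exact: continuous_flat_exp.
  move=> i; have [f' gf' df'] := df i.
  exists ((fun x => flat_exp (flat_deriv P) (f x)) \* f').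
    by apply: smooth_gen_mul => //; exact: smooth_gen_flat.
  by move=> x; apply: is_derive_comp_line => //; exact: is_derive_flat_exp.
Qed.

Lemma smooth_gen_smooth f : smooth_gen f -> smooth f.
Proof.
apply: smooth_coind => {}f /smooth_gen_derive[cf df]; split => // i.
have [g gg dg] := df i; split; first by move=> x; have [] := dg x.
rewrite (_ : pderiv i f = g) //; apply/funext => x.
by have [_ <-] := dg x.
Qed.

Lemma smooth_cst c : smooth (cst c : 'rV[R]_n -> R).
Proof. exact/smooth_gen_smooth/smooth_gen_cst. Qed.

Lemma smooth_coord i : smooth (fun x : 'rV[R]_n => x ord0 i).
Proof. exact/smooth_gen_smooth/smooth_gen_coord. Qed.

Lemma smoothD f g : smooth f -> smooth g -> smooth (f \+ g).
Proof. by move=> sf sg; apply/smooth_gen_smooth/smooth_gen_add; exact: smooth_gen_base. Qed.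

Lemma smoothM f g : smooth f -> smooth g -> smooth (f \* g).
Proof. by move=> sf sg; apply/smooth_gen_smooth/smooth_gen_mul; exact: smooth_gen_base. Qed.

Lemma smooth_flat_exp P f : smooth f -> smooth (fun x => flat_exp P (f x)).
Proof. by move=> sf; apply/smooth_gen_smooth/smooth_gen_flat; exact: smooth_gen_base. Qed.

Lemma smooth_prod (I : Type) (s : seq I) (F : I -> 'rV[R]_n -> R) :
  (forall i, smooth (F i)) -> smooth (fun x => \prod_(i <- s) F i x).
Proof.
move=> sF; elim: s => [|i s IH].
  by rewrite (_ : (fun x => _) = cst 1); [exact: smooth_cst|apply/funext => x; rewrite big_nil].
rewrite (_ : (fun x => _) = F i \* (fun x => \prod_(i <- s) F i x)); first exact: smoothM.
by apply/funext => x; rewrite big_cons.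
Qed.

Lemma pderivE f i x (l : R) : is_derive x (e_ i) f l -> pderiv i f x = l.
Proof. by case. Qed.

Lemma is_derive_translate f (a : 'rV[R]_n) i x (l : R) : is_derive (x + a) (e_ i) f l ->
  is_derive x (e_ i) (fun y => f (y + a)) l.
Proof.
move=> /is_derive_line h; apply/is_derive_line.
by rewrite (_ : (fun t : R => _) = (fun t : R => f (t *: e_ i + (x + a)))) //;
  apply/funext => t; rewrite addrA.
Qed.

Lemma smooth_translate f (a : 'rV[R]_n) : smooth f -> smooth (fun y => f (y + a)).
Proof.
move=> sf; apply: (@smooth_coind [set g | exists2 h, smooth h & g = fun y => h (y + a)]); last first.
  by exists f.
move=> _ [h sh ->]; split.
  move=> x; apply: (@cvg_comp _ _ _ (fun y => y + a) h _ (nbhs (x + a))).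
    exact: (cvgD cvg_id (cvg_cst a)).
  exact: smooth_continuous.
move=> i; have d x := is_derive_translate (smooth_derive i (x + a) sh).
split; first by move=> x; have [] := d x.
exists (pderiv i h); first exact: smooth_pderiv.
by apply/funext => x; exact: pderivE (d x).
Qed.

End smooth_functions.

(** * Convolution *)

Section bounded_multiplier.
Context d (T : measurableType d) (R : realType) (mu : {measure set T -> \bar R}).
Variable w : T -> R.
Hypothesis iw : mu.-integrable setT (EFin \o w).

Lemma integrable_bounded_mul (h : T -> R) (c : R) :
  measurable_fun setT h -> (forall y, `|h y| <= c) ->
  mu.-integrable setT (EFin \o (fun y => h y * w y)).
Proof.
move=> mh hc.
have mw : measurable_fun setT w by apply/measurable_EFinP; exact: measurable_int iw.
apply: (@le_integrable _ _ _ _ _ _ _ (fun y => c%:E * (EFin \o w) y)%E) => //.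
- by apply/measurable_EFinP; exact: measurable_funM.
- move=> y _ /=; rewrite lee_fin !normrM ler_wpM2r //.
  by rewrite (le_trans (hc y)) // ler_norm.
- exact: (integrableZl measurableT c iw).
Qed.

Lemma RintegralZ (f : T -> R) (c : R) : mu.-integrable setT (EFin \o f) ->
  \int[mu]_y (c * f y) = c * \int[mu]_y f y.
Proof. by move=> If; rewrite RintegralZl. Qed.

Lemma Rintegral_mul_le (h : T -> R) (c : R) :
  measurable_fun setT h -> (forall y, `|h y| <= c) ->
  `|\int[mu]_y (h y * w y)| <= c * \int[mu]_y `|w y|.
Proof.
move=> mh hc.
have iaw : mu.-integrable setT (EFin \o (fun y => `|w y|)) by exact: integrable_norm.
apply: le_trans (le_normr_Rintegral measurableT (integrable_bounded_mul mh hc)) _.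
rewrite -RintegralZl //; apply: le_Rintegral => //.
- by apply: integrable_norm; exact: (integrable_bounded_mul mh hc).
- exact: (integrableZl measurableT c iaw).
- by move=> y _; rewrite normrM ler_wpM2r.
Qed.

End bounded_multiplier.

Section unif.
Context {R : realType} {n : nat}.
Implicit Types (K : set 'rV[R]_n) (f : 'rV[R]_n -> R) (r : R).

(** Continuity holds at the points of [K] in the ambient space, so [y] may leave [K]; averages over
    small cubes centred in [K] need exactly this. *)
Lemma compact_unif_continuous K f : compact K ->
  (forall x, K x -> {for x, continuous f}) ->
  forall e, 0 < e -> exists2 d, 0 < d &
    forall x y, K x -> `|y - x| < d -> `|f y - f x| < e.
Proof.
move=> /compact_near_coveringP cK cf e e0.
have /cK : forall x, K x -> \forall x' \near x & h \near nbhs (0 : 'rV[R]_n),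
    `|f (x' + h) - f x'| < e.
  move=> x Kx; have e2 : 0 < e / 2 by rewrite divr_gt0.
  have /cvgrPdist_lt /(_ _ e2)/nbhs_ballP[d /= d0 hd] := cf x Kx.
  exists (ball x (d / 2), ball 0 (d / 2)) => /=.
    by split; apply: nbhsx_ballx; rewrite divr_gt0.
  move=> [y h] /= []; rewrite -!ball_normE /= sub0r normrN => xy hh.
  rewrite -(subrKA (f x)) (le_lt_trans (ler_normD _ _)) // [ltRHS](splitr e).
  rewrite ltrD //; last first.
    by apply: hd; rewrite -ball_normE /= (lt_trans xy) // ltr_pdivrMr // ltr_pMr // ltr1n.
  rewrite distrC; apply: hd; rewrite -ball_normE /= opprD addrA.
  by rewrite (le_lt_trans (ler_normB _ _)) // [ltRHS](splitr d) ltrD.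
move=> /nbhs_ballP[d /= d0 hd]; exists d => // x y Kx xy.
have := hd (y - x); rewrite -ball_normE /= sub0r normrN => /(_ xy x Kx).
by rewrite (_ : x + (y - x) = y) // addrC subrK.
Qed.

Lemma closed_ball_compact (z : 'rV[R]_n) r : compact [set x | `|x - z| <= r].
Proof.
apply: bounded_closed_compact.
  exists (`|z| + r); split; first exact: num_real.
  move=> M hM x /= xz; rewrite -(subrK z x) (le_trans (ler_normD _ _)) // addrC.
  by rewrite (le_trans _ (ltW hM)) // lerD2l.
apply: (@closed_comp _ _ (fun x : 'rV[R]_n => `|x - z|) [set y | y <= r]).
  move=> x _; exact: (cvg_norm (cvgB cvg_id (cvg_cst z))).
exact: closed_le.
Qed.

Lemma continuous_rVP f : (forall x e, 0 < e -> exists2 d, 0 < d &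
    forall z, `|z - x| < d -> `|f z - f x| <= e) -> continuous f.
Proof.
move=> h x; apply/(@cvgrPdist_le _ _ _ (nbhs x)) => e e0.
have [d d0 hd] := h x e e0; apply/nbhs_ballP; exists d => // z.
by rewrite -ball_normE /= distrC => /hd; rewrite distrC.
Qed.

Definition supported f r := forall x, r <= `|x| -> f x = 0.

(** The radius grows by 1 so that [f] vanishes on a whole neighbourhood of the point. *)
Lemma supported_pderiv f r i : supported f r -> supported (pderiv i f) (`|r| + 1).
Proof.
move=> sf y hy; apply: pderivE.
apply: (@near_eq_is_derive _ _ _ (cst 0)).
apply/nbhs_ballP; exists 1; first exact: ltr01.
move=> z; rewrite -ball_normE /= => yz.
rewrite sf // (le_trans (ler_norm r)) // -(lerD2r 1) (le_trans hy) //.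
by rewrite -[y](subrK z) (le_trans (ler_normD _ _)) // addrC lerD2l ltW.
Qed.

Lemma supported_unif_continuous f r : continuous f -> supported f r ->
  forall e, 0 < e -> exists2 d, 0 < d &
    forall x y, `|y - x| < d -> `|f y - f x| < e.
Proof.
move=> cf sf e e0.
have [d d0 hd] := compact_unif_continuous (@closed_ball_compact (0 : 'rV[R]_n) (r + 1))
  (fun x _ => cf x) e0.
exists (Num.min d 1); first by rewrite lt_min d0 ltr01.
move=> x y; rewrite lt_min => /andP[xyd xy1].
have [xr|xr] := leP `|x| (r + 1).
  by apply: hd => //; rewrite /= subr0.
rewrite !sf ?subrr ?normr0 //.
  by rewrite (le_trans _ (ltW xr)) // lerDl ler01.
rewrite -(lerD2r 1) (le_trans (ltW xr)) //.
rewrite -[x](subrK y) (le_trans (ler_normD _ _)) // addrC lerD2l distrC ltW //.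
Qed.

Lemma supported_bounded f r : continuous f -> supported f r ->
  exists2 c, 0 <= c & forall x, `|f x| <= c.
Proof.
move=> cf sf.
have [r0|r0] := ltP r 0.
  by exists 0 => // x; rewrite sf ?normr0 // (le_trans (ltW r0)).
have K0 : [set x : 'rV[R]_n | `|x - 0| <= r] !=set0 by exists 0; rewrite /= subrr normr0.
have [|c Kc hc] := @compact_EVT_max _ R (fun x => `|f x|) _ K0 (@closed_ball_compact (0 : 'rV[R]_n) r).
  by apply: continuous_subspaceT => x; exact: (cvg_norm (cf x)).
exists `|f c| => // x; have [xr|xr] := leP r `|x|; first by rewrite sf // normr0.
by apply: hc; rewrite inE /= subr0 ltW.
Qed.

End unif.

Section convolution.
Context {R : realType} {n : nat}.
Local Notation mu := (@lebesgue_rV R n).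
Local Notation e_ i := (delta_mx ord0 i : 'rV[R]_n).
Implicit Types (k w : 'rV[R]_n -> R).

(* The reflected convolution: for an even kernel this is k * w. *)
Definition refl_conv k w (x : 'rV[R]_n) : R := \int[mu]_y (k (y - x) * w y).

Variable w : 'rV[R]_n -> R.
Hypothesis iw : mu.-integrable setT (EFin \o w).

Lemma continuous_translate k (x : 'rV[R]_n) : continuous k -> continuous (fun y : 'rV[R]_n => k (y - x)).
Proof.
move=> ck y; apply: (@cvg_comp _ _ _ (fun y => y - x) k _ (nbhs (y - x))).
  exact: (cvgB cvg_id (cvg_cst x)).
exact: ck.
Qed.

Lemma measurable_translate k x : continuous k ->
  measurable_fun setT (fun y : 'rV[R]_n => k (y - x)).
Proof. by move=> ck; apply: continuous_measurable_rV; exact: continuous_translate. Qed.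

Lemma conv_integrable k r (x : 'rV[R]_n) : continuous k -> supported k r ->
  mu.-integrable setT (EFin \o (fun y => k (y - x) * w y)).
Proof.
move=> ck sk; have [C C0 hC] := supported_bounded ck sk.
by apply: (integrable_bounded_mul iw (c := C)); [exact: measurable_translate|move=> y; exact: hC].
Qed.

(** One estimate for two purposes: continuity (a = 1, b = 0) and differentiability (a = 1/t, b = -1,
    with [k3] a partial derivative of the kernel). A uniform bound on the combined kernels costs the
    L^1 norm of [w]. *)
Lemma conv_lin k1 k2 k3 r (x1 x2 x3 : 'rV[R]_n) (a b c : R) :
  continuous k1 -> continuous k2 -> continuous k3 ->
  supported k1 r -> supported k2 r -> supported k3 r ->
  (forall y, `|a * (k1 (y - x1) - k2 (y - x2)) - b * k3 (y - x3)| <= c) ->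
  `|a * (refl_conv k1 w x1 - refl_conv k2 w x2) - b * refl_conv k3 w x3| <= c * \int[mu]_y `|w y|.
Proof.
move=> ck1 ck2 ck3 s1 s2 s3 hc.
have I1 := conv_integrable x1 ck1 s1; have I2 := conv_integrable x2 ck2 s2.
have I3 := conv_integrable x3 ck3 s3.
have I12 : mu.-integrable setT (EFin \o (fun y => k1 (y - x1) * w y - k2 (y - x2) * w y)).
  exact: (integrableB measurableT I1 I2).
rewrite /refl_conv -RintegralB // -(RintegralZ a I12) -(RintegralZ b I3).
rewrite -RintegralB //; last 2 first.
- exact: (integrableZl measurableT a I12).
- exact: (integrableZl measurableT b I3).
rewrite (_ : Rintegral _ _ _ = \int[mu]_y
   ((a * (k1 (y - x1) - k2 (y - x2)) - b * k3 (y - x3)) * w y)); last first.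
  by congr Rintegral; apply/funext => y; ring.
apply: (Rintegral_mul_le iw _ hc).
have m1 := measurable_translate x1 ck1; have m2 := measurable_translate x2 ck2.
have m3 := measurable_translate x3 ck3.
exact: (measurable_funB (measurable_funM (measurable_cst a) (measurable_funB m1 m2))
  (measurable_funM (measurable_cst b) m3)).
Qed.

Lemma conv_continuous k r : continuous k -> supported k r -> continuous (refl_conv k w).
Proof.
move=> ck sk; apply: continuous_rVP => x e e0.
set N := \int[mu]_y `|w y|; have N0 : 0 <= N by apply: Rintegral_ge0 => y _.
have eN : 0 < e / (N + 1) by rewrite divr_gt0 // ltr_wpDl.
have [d d0 hd] := supported_unif_continuous ck sk eN.
exists d => // z xz.
have := @conv_lin k k k r z x x 1 0 (e / (N + 1)) ck ck ck sk sk sk.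
rewrite mul1r mul0r subr0 => /(_ _)/le_trans; apply.
  move=> y; rewrite mul1r mul0r subr0 ltW // hd // opprB addrC addrA subrK.
  by rewrite distrC.
rewrite -/N mulrAC ler_pdivrMr ?ltr_wpDl //; nra.
Qed.

(** The minus sign comes from the kernel k (y - x). By the mean value theorem along a coordinate
    axis and the uniform continuity of the partial derivative, the difference quotients of the
    kernel converge uniformly. *)
Lemma conv_derive k r i x : smooth k -> supported k r ->
  is_derive x (e_ i) (refl_conv k w) (- refl_conv (pderiv i k) w x).
Proof.
move=> sk suk.
have ck := smooth_continuous sk.
have sdk := smooth_pderiv i sk; have cdk := smooth_continuous sdk.
have r1 : r <= `|r| + 1 by rewrite (le_trans (ler_norm r)) // lerDl ler01.
have suk1 : supported k (`|r| + 1) by move=> y hy; apply: suk; exact: le_trans hy.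
have sudk : supported (pderiv i k) (`|r| + 1) := supported_pderiv i suk.
suff h : (fun t : R => t^-1 *: ((refl_conv k w \o shift x) (t *: e_ i) - refl_conv k w x)) @ 0^'
    --> - refl_conv (pderiv i k) w x.
  by apply: DeriveDef; [apply/cvg_ex; exists (- refl_conv (pderiv i k) w x)|exact: cvg_lim h].
apply/cvgrPdist_le => e e0.
set N := \int[mu]_y `|w y|; have N0 : 0 <= N by apply: Rintegral_ge0 => y _.
have eN : 0 < e / (N + 1) by rewrite divr_gt0 // ltr_wpDl.
have [d d0 hd] := supported_unif_continuous cdk sudk eN.
apply/nbhs_ballP; exists d => // t; rewrite /ball /= sub0r normrN => td t0.
rewrite distrC opprK /GRing.scale /=.
have := @conv_lin k k (pderiv i k) (`|r| + 1) (t *: e_ i + x) x x t^-1 (-1) (e / (N + 1))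
  ck ck cdk suk1 suk1 sudk.
rewrite mulN1r opprK => /(_ _)/le_trans; apply; last first.
  rewrite -/N mulrAC ler_pdivrMr ?ltr_wpDl //; nra.
move=> y; rewrite mulN1r opprK.
pose g (h : R) := k (h *: e_ i + (y - x)).
have dg (h : R) : is_derive h (1 : R) g (pderiv i k (h *: e_ i + (y - x))).
  by apply: is_derive_along => z; exact: smooth_derive.
have [c hc gc] : exists2 c, `|c| <= `|t| & g (- t) - g 0 = pderiv i k (c *: e_ i + (y - x)) * (- t).
  have cg (I : interval R) : {within [set` I], continuous g}.
    by apply: derivable_within_continuous => h _; have [] := dg h.
  have [tn|tp] := ltP t 0.
    have [|c] := @MVT_segment _ g _ 0 (- t) _ (fun h _ => dg h) (cg _).
      by rewrite oppr_ge0 ltW.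
    rewrite in_itv /= subr0 => /andP[c0 ct] ->; exists c => //.
    by rewrite ger0_norm // ltr0_norm.
  have [|c] := @MVT_segment _ g _ (- t) 0 _ (fun h _ => dg h) (cg _).
    by rewrite oppr_le0.
  rewrite in_itv /= sub0r opprK => /andP[ct c0] E; exists c.
    by rewrite ler0_norm // ger0_norm // lerNl.
  by rewrite -opprB E mulrN.
have -> : k (y - (t *: e_ i + x)) = g (- t) by rewrite /g scaleNr opprD addrA [- _ + _ as X in _ = k X]addrC addrAC.
have -> : k (y - x) = g 0 by rewrite /g scale0r add0r.
rewrite gc mulrN mulrN mulrC mulfK // addrC ltW // distrC hd //.
rewrite addrK normrZ (le_lt_trans _ td) // (le_trans _ hc) // ler_piMr //.
by apply: norm_rV_le => // j; rewrite mxE eqxx /=; case: (_ == _); rewrite ?normr1 ?normr0 ?ler01.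
Qed.

Lemma conv_smooth k r : smooth k -> supported k r -> smooth (refl_conv k w).
Proof.
move=> sk suk.
apply: (@smooth_coind _ _ [set f | exists k, exists r, [/\ smooth k, supported k r & f = refl_conv k w]]); last first.
  by exists k, r.
move=> _ [k1 [r1 [sk1 suk1 ->]]]; split; first exact: (conv_continuous (smooth_continuous sk1) suk1).
move=> i; split; first by move=> x; have [] := conv_derive i x sk1 suk1.
(* The sign is absorbed into the kernel, so the derivative is again a reflected convolution with
   [w]. *)
exists (fun y => -1 * pderiv i k1 y), (`|r1| + 1); split.
- have := smoothM (smooth_cst (-1)) (smooth_pderiv i sk1); exact.
- by move=> y hy; rewrite (supported_pderiv i suk1 hy) mulr0.
- apply/funext => x; rewrite (pderivE (conv_derive i x sk1 suk1)) /refl_conv.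
  rewrite -[LHS]mulN1r -RintegralZ; first by congr Rintegral; apply/funext => y; rewrite mulrA.
  exact: (conv_integrable x (smooth_continuous (smooth_pderiv i sk1)) (supported_pderiv i suk1)).
Qed.

End convolution.

(** * Mollifiers *)

Section integral_facts.
Context d (T : measurableType d) (R : realType).
Variable mu : {measure set T -> \bar R}.

Lemma integral_between (f : T -> R) (A B : set T) (c : R) : 0 <= c ->
  measurable_fun setT f -> measurable A -> measurable B ->
  (forall x, c * \1_A x <= f x) -> (forall x, f x <= \1_B x) ->
  (c%:E * mu A <= \int[mu]_x (f x)%:E <= mu B)%E.
Proof.
move=> c0 mf mA mB Af fB.
have f0 x : 0 <= f x by apply: le_trans (Af x); rewrite indicE mulr_ge0.
apply/andP; split.
  rewrite -(setIT A) -integral_indic // -ge0_integralZl_EFin //; first last.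
  - by apply/measurable_EFinP; exact: measurable_indic.
  apply: ge0_le_integral => //.
  - by move=> x _; rewrite -EFinM lee_fin indicE mulr_ge0.
  - by apply/measurable_EFinP/measurable_funM => //; exact: measurable_indic.
  - exact/measurable_EFinP.
  - by move=> x _; rewrite -EFinM lee_fin.
rewrite -(setIT B) -integral_indic //; apply: ge0_le_integral => //.
- by move=> x _; rewrite lee_fin.
- exact/measurable_EFinP.
- by apply/measurable_EFinP; exact: measurable_indic.
- by move=> x _; rewrite lee_fin.
Qed.

(* Integrating p (b - a)^2 >= 0 with a the p-mean of b. *)
Lemma jensen_sqr (p b : T -> R) : measurable_fun setT p -> (forall y, 0 <= p y) ->
  measurable_fun setT b -> (\int[mu]_y (p y)%:E = 1)%E ->
  mu.-integrable setT (EFin \o (fun y => p y * b y)) ->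
  (((\int[mu]_y (p y * b y)) ^+ 2)%:E <= \int[mu]_y (p y * b y ^+ 2)%:E)%E.
Proof.
move=> mp p0 mb p1 ipb.
set a := (\int[mu]_y (p y * b y))%R.
have mpb2 : measurable_fun setT (fun y => p y * b y ^+ 2).
  by apply: measurable_funM => //; exact: measurable_funX.
have pb0 y : 0 <= p y * b y ^+ 2 by rewrite mulr_ge0 ?sqr_ge0.
have [infty|fin] := eqVneq (\int[mu]_y (p y * b y ^+ 2)%:E)%E +oo%E.
  by rewrite infty leey.
have ipb2 : mu.-integrable setT (EFin \o (fun y => p y * b y ^+ 2)).
  apply/integrableP; split; first exact/measurable_EFinP.
  under eq_integral do rewrite /= ger0_norm //.
  by rewrite ltey.
have ip : mu.-integrable setT (EFin \o p).
  apply/integrableP; split; first exact/measurable_EFinP.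
  under eq_integral do rewrite /= ger0_norm //.
  by rewrite p1 ltry.
have p1' : \int[mu]_y p y = 1 by rewrite /Rintegral p1.
have i1 : mu.-integrable setT (EFin \o (fun y => (2 * a) * (p y * b y))).
  exact: (integrableZl measurableT (2 * a) ipb).
have i2 : mu.-integrable setT (EFin \o (fun y => a ^+ 2 * p y)).
  exact: (integrableZl measurableT (a ^+ 2) ip).
have : \int[mu]_y ((2 * a) * (p y * b y) - a ^+ 2 * p y) <= \int[mu]_y (p y * b y ^+ 2).
  apply: le_Rintegral => //; first exact: (integrableB measurableT i1 i2).
  move=> y _; rewrite -subr_ge0.
  rewrite (_ : _ - _ = p y * (b y - a) ^+ 2); first by rewrite mulr_ge0 ?sqr_ge0.
  by ring.
rewrite RintegralB // (RintegralZ _ ipb) (RintegralZ _ ip) p1' -/a => h.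
have -> : (\int[mu]_y (p y * b y ^+ 2)%:E = (\int[mu]_y (p y * b y ^+ 2))%:E)%E.
  rewrite /Rintegral fineK // ge0_fin_numE ?ltey //.
  by apply: integral_ge0 => y _; rewrite lee_fin.
by rewrite lee_fin; apply: le_trans h; nra.
Qed.

(** On [A], |f| <= 1 + f^2, and [A] has finite measure. *)
Lemma integrable_of_sqr (A : set T) (f : T -> R) : measurable A -> (mu A < +oo)%E ->
  measurable_fun setT f -> (forall x, ~ A x -> f x = 0) ->
  (\int[mu]_x ((f x) ^+ 2)%:E < +oo)%E -> mu.-integrable setT (EFin \o f).
Proof.
move=> mA finA mf fA f2.
have mf2 : measurable_fun setT (EFin \o (fun x => f x ^+ 2)).
  by apply/measurable_EFinP/measurable_funX.
have i2 : mu.-integrable setT (EFin \o (fun x => f x ^+ 2)).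
  apply/integrableP; split => //.
  by under eq_integral do rewrite /= ger0_norm ?sqr_ge0 //.
have i1 : mu.-integrable setT (EFin \o (\1_A : T -> R)).
  apply/integrableP; split; first by apply/measurable_EFinP; exact: measurable_indic.
  under eq_integral do rewrite /= ger0_norm ?indicE //.
  by rewrite -[X in integral _ _ X]/(fun x => (\1_A x)%:E) integral_indic // setIT.
apply: le_integrable (integrableD measurableT i1 i2) => //.
  exact/measurable_EFinP.
move=> x _; rewrite /= lee_fin.
have [Ax|nAx] := pselect (A x); last first.
  by rewrite fA // normr0.
rewrite indicE mem_set //= [leRHS]ger0_norm ?addr_ge0 ?sqr_ge0 //.
rewrite -(real_normK (num_real (f x))).
by have := sqr_ge0 (`|f x| - 1); have := normr_ge0 (f x); nra.
Qed.

End integral_facts.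

Lemma clamp_dist_le (R : realDomainType) (a b : R) :
  `|Num.max 0 (Num.min 1 a) - Num.max 0 (Num.min 1 b)| <= `|a - b|.
Proof.
have h1 := ler_norm (a - b); have h2 := ler_norm (b - a); rewrite (distrC b a) in h2.
have [h3 h4] : 0 <= a - b + `|a - b| /\ 0 <= `|a - b| by split => //; lra.
rewrite ler_norml; apply/andP.
case: (leP 1 a) => ?; case: (leP 1 b) => ?; rewrite ?(max_r ler01) ?subrr.
- split; lra.
- case: (leP 0 b) => ?; split; lra.
- case: (leP 0 a) => ?; split; lra.
- case: (leP 0 a) => ?; case: (leP 0 b) => ?; split; lra.
Qed.

(** Applied to the kernel rho (y - x) and the square of the mollified function. *)
Lemma tonelli_kernel d (T : measurableType d) (R : realType)
    (m : {sigma_finite_measure set T -> \bar R}) (K : T * T -> R) (c : T -> R) :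
  measurable_fun setT K -> (forall z, 0 <= K z) ->
  measurable_fun setT c -> (forall y, 0 <= c y) ->
  (forall y, \int[m]_x (K (x, y))%:E = 1)%E ->
  (\int[m]_x \int[m]_y (K (x, y) * c y)%:E = \int[m]_y (c y)%:E)%E /\
  measurable_fun setT (fun x => \int[m]_y (K (x, y) * c y)%:E)%E.
Proof.
move=> mK K0 mc c0 K1.
pose F (z : T * T) : \bar R := (K z * c z.2)%:E.
have mF : measurable_fun setT F.
  apply/measurable_EFinP/measurable_funM => //.
  exact: (measurableT_comp mc measurable_snd).
have F0 z : (0 <= F z)%E by rewrite lee_fin mulr_ge0.
split; last exact: (measurable_fun_fubini_tonelli_F (m2 := m) F mF F0).
rewrite (fubini_tonelli (m1 := m) (m2 := m) F mF F0).
apply: eq_integral => y _; rewrite /F /=.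
under eq_integral do rewrite mulrC EFinM.
rewrite ge0_integralZl_EFin //.
- by rewrite K1 mule1.
- by move=> x _; rewrite lee_fin.
- by apply/measurable_EFinP; exact: (measurableT_comp mK (measurable_pair2 y)).
Qed.

Section flat_bump.
Context {R : realType}.
Implicit Types x y a : R.

Lemma flat_exp1_ge0 x : 0 <= flat_exp 1 x.
Proof. by rewrite /flat_exp; case: ifP => // _; rewrite hornerC mul1r expR_ge0. Qed.

Lemma flat_exp1_le1 x : flat_exp 1 x <= 1.
Proof.
rewrite /flat_exp; case: ifP => [x0|_]; last exact: ler01.
by rewrite hornerC mul1r -expR0 ler_expR oppr_le0 invr_ge0 ltW.
Qed.

Lemma flat_exp_le0 (P : {poly R}) x : x <= 0 -> flat_exp P x = 0.
Proof. by move=> x0; rewrite /flat_exp ltNge x0. Qed.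

Lemma flat_exp1_ge a x : 0 < a -> a <= x -> expR (- a^-1) <= flat_exp 1 x.
Proof.
move=> a0 ax; have x0 : 0 < x by exact: lt_le_trans ax.
by rewrite /flat_exp x0 hornerC mul1r ler_expR lerN2 lef_pV2.
Qed.

End flat_bump.

Section mollifier.
Context {R : realType} {n : nat}.
Local Notation mu := (@lebesgue_rV R n).

(** A product of one-dimensional bumps exp(-1/(1 - t^2)): the sup norm is not smooth, and the
    product still vanishes off the cube of radius [s]. *)
Definition cube_bump (z : 'rV[R]_n) (s : R) (x : 'rV[R]_n) : R :=
  \prod_(i < n) flat_exp 1 (1 - ((x ord0 i - z ord0 i) / s) ^+ 2).

Lemma cube_bump_smooth z s : smooth (cube_bump z s).
Proof.
apply: smooth_prod => i; apply: smooth_flat_exp.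
have sl : smooth ((fun x : 'rV[R]_n => x ord0 i) \+ cst (- z ord0 i)).
  by apply: smoothD; [exact: smooth_coord|exact: smooth_cst].
have := smoothD (smooth_cst 1) (smoothM (smooth_cst (- (s ^-2))) (smoothM sl sl)).
rewrite (_ : _ \+ _ = (fun x : 'rV[R]_n => 1 - ((x ord0 i - z ord0 i) / s) ^+ 2)) //.
by apply/funext => x /=; rewrite expr_div_n; ring.
Qed.

Lemma cube_bump_ge0 z s x : 0 <= cube_bump z s x.
Proof. by apply: prodr_ge0 => i _; exact: flat_exp1_ge0. Qed.

Lemma cube_bump_le1 z s x : cube_bump z s x <= 1.
Proof. by apply: prodr_ile1 => i _; rewrite flat_exp1_ge0 flat_exp1_le1. Qed.

Lemma cube_bump_eq0 z s x : 0 < s -> s <= `|x - z| -> cube_bump z s x = 0.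
Proof.
move=> s0; rewrite leNgt => /negP h.
have [i hi] : exists i, s <= `|x ord0 i - z ord0 i|.
  apply: contrapT => hn; apply: h; apply/(norm_rV_lt _ s0) => i.
  by rewrite !mxE ltNge; apply/negP => hi; apply: hn; exists i.
rewrite /cube_bump (bigD1 i) //= flat_exp_le0 ?mul0r //.
rewrite subr_le0 -(real_normK (num_real _)) exprn_ege1 // normrM normfV (gtr0_norm s0).
by rewrite ler_pdivlMr // mul1r.
Qed.

Lemma cube_bump_ge z s t x : 0 < s -> 0 <= t < s -> `|x - z| <= t ->
  expR (- (1 - (t / s) ^+ 2)^-1) ^+ n <= cube_bump z s x.
Proof.
move=> s0 /andP[t0 ts] xz.
have ts1 : 0 <= t / s < 1 by rewrite divr_ge0 ?(ltW s0) //= ltr_pdivrMr // mul1r.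
rewrite (_ : expR _ ^+ n = \prod_(i < n) expR (- (1 - (t / s) ^+ 2)^-1)); last first.
  by rewrite prodr_const card_ord.
apply: ler_prod => i _; rewrite expR_ge0 /=; apply: flat_exp1_ge; first by nra.
rewrite lerD2l lerN2 -(real_normK (num_real ((_ - _) / _))).
rewrite ler_sqr ?nnegrE ?divr_ge0 ?(ltW s0) //.
rewrite normrM normfV (gtr0_norm s0) ler_pM2r ?invr_gt0 //.
by apply: le_trans xz; have := coord_le_norm (x - z) i; rewrite !mxE.
Qed.

(** Evenness gives rho (y - x) total mass 1 in either variable, as the L^2 contraction requires. *)
Definition mollifier (rho : 'rV[R]_n -> R) (e : R) :=
  [/\ smooth rho, (forall x, 0 <= rho x), supported rho e,
      (forall x, rho (- x) = rho x) & (\int[mu]_x (rho x)%:E = 1)%E].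

Lemma mollifier_exists e : 0 < e -> exists rho, mollifier rho e.
Proof.
move=> e0.
pose b := cube_bump 0 e; have sb : smooth b := cube_bump_smooth 0 e.
have mb : measurable_fun setT b.
  by apply: continuous_measurable_rV; exact: smooth_continuous sb.
pose c : R := expR (- (1 - ((e / 2) / e) ^+ 2)^-1) ^+ n.
have c0 : 0 < c by rewrite exprn_gt0 // expR_gt0.
have e20 : 0 < e / 2 by rewrite divr_gt0.
have mball z r : measurable (ball z r : set 'rV[R]_n).
  by apply: open_measurable_rV; exact: ball_open.
have /andP[I1 I2] : (c%:E * mu (ball (0%R : 'rV_n) (e / 2)) <= \int[mu]_x (b x)%:E
    <= mu (ball (0%R : 'rV_n) e))%E.
  apply: integral_between; [exact: ltW|exact: mb|exact: mball|exact: mball|move=> x|move=> x].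
    rewrite indicE; case: (boolP (x \in _)) => [|_]; last by rewrite mulr0 cube_bump_ge0.
    rewrite inE -ball_normE /= sub0r normrN mulr1 => xe.
    by apply: cube_bump_ge => //; rewrite ?subr0 ?(ltW xe) // (ltW e20) ltr_pdivrMr // ltr_pMr // ltr1n.
  rewrite indicE; case: (boolP (x \in _)) => [_|]; first exact: cube_bump_le1.
  rewrite notin_setE -ball_normE /= sub0r normrN => /negP; rewrite -leNgt => xe.
  by rewrite /b cube_bump_eq0 // subr0.
have Ifin : (\int[mu]_x (b x)%:E \is a fin_num)%E.
  rewrite ge0_fin_numE; last by apply: integral_ge0 => x _; rewrite lee_fin cube_bump_ge0.
  by apply: le_lt_trans I2 _; rewrite lebesgue_rV_ball // ltry.
pose I := fine (\int[mu]_x (b x)%:E)%E.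
have IE : (\int[mu]_x (b x)%:E = I%:E)%E by rewrite fineK.
have I0 : 0 < I.
  rewrite -lte_fin -IE; apply: lt_le_trans I1; rewrite lebesgue_rV_ball // -EFinM lte_fin.
  by rewrite mulr_gt0 // exprn_gt0 // mulr_gt0.
exists (fun x => I^-1 * b x); split.
- exact: (smoothM (smooth_cst I^-1) sb).
- by move=> x; rewrite mulr_ge0 ?invr_ge0 ?(ltW I0) // cube_bump_ge0.
- by move=> x xe; rewrite /b cube_bump_eq0 ?mulr0 // subr0.
- move=> x; congr (_ * _); rewrite /b /cube_bump; apply: eq_bigr => i _.
  by rewrite !mxE !subr0 mulNr sqrrN.
- under eq_integral do rewrite EFinM.
  rewrite ge0_integralZl_EFin.
  + by rewrite IE -EFinM mulVf // gt_eqF.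
  + exact: measurableT.
  + by move=> x _; rewrite lee_fin cube_bump_ge0.
  + by apply/measurable_EFinP; exact: mb.
  + by rewrite invr_ge0 ltW.
Qed.

End mollifier.

Section mollification.
Context {R : realType} {n : nat}.
Local Notation mu := (@lebesgue_rV R n).
Local Notation ncube r := (ball (0 : 'rV[R]_n) r).

Lemma mollifier_translate (rho : 'rV[R]_n -> R) e (x : 'rV[R]_n) : mollifier rho e ->
  (\int[mu]_y (rho (y - x))%:E = 1)%E.
Proof.
move=> [srho rho0 _ _ <-].
rewrite -(integral_translation (f := fun y => (rho y)%:E) (- x)) //.
by apply/measurable_EFinP; apply: continuous_borel; exact: smooth_continuous.
Qed.

Lemma mollifier_translate_swap (rho : 'rV[R]_n -> R) e (y : 'rV[R]_n) : mollifier rho e ->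
  (\int[mu]_x (rho (y - x))%:E = 1)%E.
Proof.
move=> h; rewrite -(mollifier_translate y h); apply: eq_integral => x _.
by have [_ _ _ even _] := h; rewrite -opprB even.
Qed.

Lemma measurable_sub_rV (d : measure_display) (T : measurableType d)
    (f g : T -> 'rV[R]_n) :
  measurable_fun setT f -> measurable_fun setT g ->
  measurable_fun setT (fun t => f t - g t : borel_rV R n).
Proof.
move=> mf mg; apply: measurable_fun_borel_rV => i.
rewrite (_ : (fun t => _) = (fun t => f t ord0 i - g t ord0 i)).
  apply: measurable_funB.
    exact: (measurableT_comp (measurable_coord i) mf).
  exact: (measurableT_comp (measurable_coord i) mg).
by apply/funext => t; rewrite !mxE.
Qed.

(** Jensen's inequality for the probability density y -> rho (y - x), then Tonelli, using that rho
    (y - x) has mass 1 in x as well. *)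
Lemma conv_L2_le (rho : 'rV[R]_n -> R) e (b : 'rV[R]_n -> R) : mollifier rho e ->
  mu.-integrable setT (EFin \o b) ->
  (\int[mu]_x ((refl_conv rho b x) ^+ 2)%:E <= \int[mu]_y ((b y) ^+ 2)%:E)%E.
Proof.
move=> mrho ib; have [srho rho0 suprho _ _] := mrho.
have crho := smooth_continuous srho.
have mb : measurable_fun setT b by apply/measurable_EFinP; exact: measurable_int ib.
have mb2 : measurable_fun setT (fun y => b y ^+ 2) by exact: measurable_funX.
pose K (z : 'rV[R]_n * 'rV[R]_n) : R := rho (z.2 - z.1).
have mK : measurable_fun setT K.
  apply: (measurableT_comp (continuous_borel crho)).
  exact: (measurable_sub_rV measurable_snd measurable_fst).
have [E M] := tonelli_kernel (m := mu) mK (fun z => rho0 _) mb2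
  (fun y => sqr_ge0 _) (fun y => mollifier_translate_swap y mrho).
rewrite -E; apply: ge0_le_integral.
- exact: measurableT.
- by move=> x _; rewrite lee_fin sqr_ge0.
- apply/measurable_EFinP/measurable_funX; apply: continuous_measurable_rV.
  exact: (conv_continuous ib crho suprho).
- exact: M.
- move=> x _; apply: jensen_sqr.
  + exact: measurable_translate.
  + by move=> y; exact: rho0.
  + exact: mb.
  + exact: (mollifier_translate x mrho).
  + exact: (conv_integrable ib x crho suprho).
Qed.

Lemma conv_near_value (rho : 'rV[R]_n -> R) e (w : 'rV[R]_n -> R) (x : 'rV[R]_n) (c : R) :
  mollifier rho e -> mu.-integrable setT (EFin \o w) ->
  (forall y, `|y - x| < e -> `|w y - w x| <= c) -> `|refl_conv rho w x - w x| <= c.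
Proof.
move=> mrho iw hc; have [srho rho0 suprho _ _] := mrho.
have crho := smooth_continuous srho.
have mr := measurable_translate x crho.
have irho : mu.-integrable setT (EFin \o (fun y => rho (y - x))).
  apply/integrableP; split; first by apply/measurable_EFinP; exact: mr.
  under eq_integral do rewrite /= ger0_norm //.
  by rewrite (mollifier_translate x mrho) ltry.
have rho1 : \int[mu]_y rho (y - x) = 1 by rewrite /Rintegral (mollifier_translate x mrho).
have i1 := conv_integrable iw x crho suprho.
have i2 a : mu.-integrable setT (EFin \o (fun y => a * rho (y - x))).
  exact: (integrableZl measurableT a irho).
have wxE a : \int[mu]_y (a * rho (y - x)) = a by rewrite (RintegralZ _ irho) rho1 mulr1.
have supp y : rho (y - x) != 0 -> `|y - x| < e.
  by move=> h; rewrite ltNge; apply/negP => /suprho; exact/eqP.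
have bnd y : (w x - c) * rho (y - x) <= rho (y - x) * w y <= (w x + c) * rho (y - x).
  have [->|h] := eqVneq (rho (y - x)) 0; first by rewrite !mulr0 mul0r lexx.
  have := hc _ (supp _ h); rewrite ler_norml => /andP[h1 h2].
  have := rho0 (y - x) => h0; rewrite [rho _ * _]mulrC !ler_wpM2r //; lra.
have l1 : w x - c <= refl_conv rho w x.
  rewrite -[leLHS](wxE (w x - c)).
  by apply: (le_Rintegral measurableT (i2 (w x - c)) i1) => y _; have /andP[] := bnd y.
have l2 : refl_conv rho w x <= w x + c.
  rewrite -[leRHS](wxE (w x + c)).
  by apply: (le_Rintegral measurableT i1 (i2 (w x + c))) => y _; have /andP[] := bnd y.
by rewrite ler_norml; lra.
Qed.

(** Split [w] into a continuous compactly supported [hc] and a remainder [b] small in L^2.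
    Mollification contracts [b] and converges uniformly on [hc]; the threshold [e0] serves all
    mollifiers, so finitely many functions can share one. *)
Lemma conv_L2_cvg (w : 'rV[R]_n -> R) : measurable_fun setT w ->
  (forall x, 1 <= `|x| -> w x = 0) ->
  mu.-integrable setT (EFin \o (fun x => w x ^+ 2)) ->
  forall dl, 0 < dl -> exists2 e0, 0 < e0 & forall e rho, e <= e0 -> mollifier rho e ->
    (\int[mu]_x ((refl_conv rho w x - w x) ^+ 2)%:E <= dl%:E)%E.
Proof.
move=> mw w0 iw2 dl dl0.
have mQ r : measurable (ncube r : set 'rV[R]_n) by apply: open_measurable_rV; exact: ball_open.
have Qfin r : 0 < r -> (mu (ncube r) < +oo)%E by move=> r0; rewrite lebesgue_rV_ball // ltry.
have nQ r (x : 'rV[R]_n) : ncube r x = (`|x| < r).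
  by rewrite -ball_normE /= sub0r normrN.
have iw2Q : mu.-integrable (ncube 2) (EFin \o (fun x => w x ^+ 2)).
  exact: (integrableS measurableT (mQ 2) (@subsetT _ _) iw2).
have dl16 : 0 < dl / 16 by rewrite divr_gt0.
have [h ch hw] := L2_dense_continuous (mQ 2) (Qfin 2 ltac:(by [])) mw iw2Q dl16.
(* A cut-off equal to 1 where [w] may be nonzero and to 0 beyond radius 2; multiplying by it does
   not increase the squared distance from [h] to [w]. *)
pose chi (x : 'rV[R]_n) : R := Num.max 0 (Num.min 1 (2 - `|x|)).
have chi1 x : `|x| <= 1 -> chi x = 1.
  by move=> x1; rewrite /chi min_l ?max_r ?ler01 //; lra.
have chi0 x : 2 <= `|x| -> chi x = 0.
  move=> x2; rewrite /chi max_l // ge_min; apply/orP; right; lra.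
have chi01 x : 0 <= chi x <= 1.
  by rewrite /chi le_max lexx /= ge_max ler01 /= ge_min lexx.
have cchi : continuous chi.
  apply: continuous_rVP => x e e0'; exists e => // z zx.
  have : `|chi z - chi x| <= `|z - x|.
    apply: le_trans (clamp_dist_le _ _) _.
    rewrite (_ : 2 - `|z| - (2 - `|x|) = - (`|z| - `|x|)); last by ring.
    by rewrite normrN; exact: ler_dist_dist.
  by move=> /le_trans; apply; exact: ltW.
pose hc x := h x * chi x.
have chc : continuous hc by move=> x; exact: (cvgM (ch x) (cchi x)).
have shc : supported hc 2 by move=> x x2; rewrite /hc chi0 ?mulr0.
have mh := continuous_measurable_rV ch; have mhc := continuous_measurable_rV chc.
pose b x := w x - hc x.
have mb : measurable_fun setT b by exact: (measurable_funB mw mhc).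
have Eb : (\int[mu]_x (b x ^+ 2)%:E <= (dl / 16)%:E)%E.
  apply: le_trans hw; rewrite [leRHS]integral_mkcond; apply: ge0_le_integral.
  - exact: measurableT.
  - by move=> x _; rewrite lee_fin sqr_ge0.
  - exact: (measurable_sqr_EFin mb).
  - apply/(measurable_restrictT _ (mQ 2)); apply: measurable_sqr_EFin.
    exact: (measurable_funTS (measurable_funB mw mh)).
  - move=> x _; rewrite patchE; case: ifPn => [|].
      rewrite inE nQ => x2; rewrite lee_fin /b /hc.
      have [x1|x1] := ltP `|x| 1; first by rewrite (chi1 _ (ltW x1)) mulr1.
      rewrite w0 // !sub0r !sqrrN exprMn; have /andP[c0 c1] := chi01 x.
      by rewrite ler_piMr ?sqr_ge0 // expr_le1.
    rewrite notin_setE nQ => /negP; rewrite -leNgt => x2.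
    by rewrite lee_fin /b w0 ?(le_trans _ x2) ?ler1n // shc // subrr expr0n.
have six0 : 0 < (2 * 3 : R) ^+ n by rewrite exprn_gt0.
(* A uniform error whose square, times the measure of the cube of radius 3, is at most dl / 16. The
   radius is 2 for the support of [hc] plus 1 for the mollifier. *)
pose c : R := Num.min 1 (dl / 16 / (2 * 3) ^+ n).
have c0 : 0 < c by rewrite /c lt_min ltr01 divr_gt0.
have c2 : c ^+ 2 * (2 * 3) ^+ n <= dl / 16.
  rewrite -ler_pdivlMr //; apply: (@le_trans _ _ c); last by rewrite /c ge_min lexx orbT.
  by rewrite expr2 ler_piMl ?(ltW c0) // /c ge_min lexx.
have [d d0 hd] := supported_unif_continuous chc shc c0.
exists (Num.min 1 d); first by rewrite lt_min ltr01.
move=> e rho; rewrite le_min => /andP[e1 ed] mrho.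
have [srho rho0 suprho _ _] := mrho; have crho := smooth_continuous srho.
have ibnd (f : 'rV[R]_n -> R) : measurable_fun setT f -> (forall x, 2 <= `|x| -> f x = 0) ->
    (\int[mu]_x (f x ^+ 2)%:E < +oo)%E -> mu.-integrable setT (EFin \o f).
  move=> mf f0 f2; apply: (integrable_of_sqr (mQ 2) (Qfin 2 ltac:(by [])) mf _ f2).
  by move=> x; rewrite nQ => /negP; rewrite -leNgt; exact: f0.
have ib : mu.-integrable setT (EFin \o b).
  apply: ibnd => //; last by apply: le_lt_trans Eb _; exact: ltry.
  by move=> x x2; rewrite /b shc // w0 ?subrr // (le_trans _ x2) // ler1n.
have iw : mu.-integrable setT (EFin \o w).
  apply: ibnd => //; first by move=> x x2; rewrite w0 // (le_trans _ x2) // ler1n.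
  have /integrableP[_] := iw2; apply: le_lt_trans.
  rewrite le_eqVlt; apply/orP; left; apply/eqP; apply: eq_integral => x _.
  by rewrite /= ger0_norm ?sqr_ge0.
have ihc : mu.-integrable setT (EFin \o hc).
  rewrite (_ : hc = w \- b); first exact: (integrableB measurableT iw ib).
  by apply/funext => x; rewrite /b /= subKr.
have E1 x : refl_conv rho w x = refl_conv rho b x + refl_conv rho hc x.
  rewrite /refl_conv -RintegralD.
  - by congr Rintegral; apply/funext => y; rewrite -mulrDr /b subrK.
  - exact: measurableT.
  - exact: (conv_integrable ib x crho suprho).
  - exact: (conv_integrable ihc x crho suprho).
have mcb : measurable_fun setT (refl_conv rho b).
  by apply: continuous_measurable_rV; exact: (conv_continuous ib crho suprho).
have mch : measurable_fun setT (refl_conv rho hc).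
  by apply: continuous_measurable_rV; exact: (conv_continuous ihc crho suprho).
have Ehc : (\int[mu]_x ((refl_conv rho hc x - hc x) ^+ 2)%:E <= (dl / 16)%:E)%E.
  have near_hc x : `|refl_conv rho hc x - hc x| <= c.
    apply: (conv_near_value mrho ihc) => y yx; apply: ltW; apply: hd.
    exact: lt_le_trans ed.
  have far_hc x : 3 <= `|x| -> refl_conv rho hc x - hc x = 0.
    move=> x3; apply/eqP; rewrite -normr_le0; apply: (conv_near_value mrho ihc) => y yx.
    rewrite !shc ?subrr ?normr0 //; first by rewrite (le_trans _ x3) // ler_nat.
    have yx1 : `|y - x| < 1 by exact: lt_le_trans e1.
    have := ler_normB y (y - x); rewrite subKr; lra.
  apply: (@le_trans _ _ ((c ^+ 2)%:E * mu (ncube 3))%E); last first.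
    by rewrite lebesgue_rV_ball // -EFinM lee_fin.
  rewrite -(setIT (ncube 3)) -integral_indic ?mQ //.
  rewrite -ge0_integralZl_EFin ?sqr_ge0 //; last first.
    by apply/measurable_EFinP; exact: (measurable_indic (mQ 3)).
  apply: ge0_le_integral.
  - exact: measurableT.
  - by move=> x _; rewrite lee_fin sqr_ge0.
  - exact: (measurable_sqr_EFin (measurable_funB mch mhc)).
  - apply/measurable_EFinP; apply: measurable_funM; first exact: measurable_cst.
    exact: (measurable_indic (mQ 3)).
  - move=> x _; rewrite -EFinM lee_fin indicE.
    have [x3|x3] := ltP `|x| 3.
      rewrite mem_set ?nQ // mulr1 -(real_normK (num_real (_ - _))).
      by rewrite ler_sqr ?nnegrE ?(ltW c0).
    by rewrite far_hc // expr0n /= mulr_ge0 ?sqr_ge0.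
have mcbb := measurable_funB mcb mb.
have mchh := measurable_funB mch mhc.
have Ebb : (\int[mu]_x ((refl_conv rho b x - b x) ^+ 2)%:E
    <= (2 * (dl / 16) + 2 * (dl / 16))%:E)%E.
  apply: (le_integral_sqD measurableT mcbb mcb mb _ _ Eb).
  - by move=> x _; have := sqrD_le2 (refl_conv rho b x) (- b x); rewrite sqrrN.
  - exact: le_trans (conv_L2_le mrho ib) Eb.
have mcw : measurable_fun setT (fun x => refl_conv rho w x - w x).
  have mcw := continuous_measurable_rV (conv_continuous iw crho suprho).
  exact: (measurable_funB mcw mw).
apply: le_trans (le_integral_sqD measurableT mcw mcbb mchh _ Ebb Ehc) _.
  move=> x _; apply: le_trans (sqrD_le2 _ _).
  by rewrite le_eqVlt; apply/orP; left; apply/eqP; rewrite /= E1 /b; ring.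
by rewrite lee_fin; lra.
Qed.

End mollification.

(** * Approximation of weak gradients *)

Lemma ge0_integral_sqr_subset d (T : measurableType d) (R : realType)
    (mu : {measure set T -> \bar R}) (A B : set T) (f : T -> R) :
  measurable A -> measurable B -> measurable_fun B f -> A `<=` B ->
  (\int[mu]_(x in A) ((f x) ^+ 2)%:E <= \int[mu]_(x in B) ((f x) ^+ 2)%:E)%E.
Proof.
move=> mA mB mf AB; apply: ge0_subset_integral => //.
- exact: measurable_sqr_EFin.
- by move=> x _; rewrite lee_fin sqr_ge0.
Qed.

(** * Weak L^p functions with p > 1 are integrable on sets of finite measure *)

Section weak_Lp_integrability.
Context d (T : measurableType d) (R : realType).
Variables (mu : {measure set T -> \bar R}) (B : set T) (f : T -> R) (p : R).
Hypotheses (mB : measurable B) (finB : (mu B < +oo)%E) (p1 : 1 < p).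
Hypothesis mf : measurable_fun B f.
Hypothesis weak : (ereal_sup [set t%:E * mu [set x | B x /\ (t < `|f x|)%R] `^ p^-1
             | t in [set t : R | (0 < t)%R]] < +oo)%E.

Let S (k : nat) : set T := [set x | B x /\ 2 ^+ k < `|f x|].

Let mS k : measurable (S k).
Proof.
rewrite (_ : S k = B `&` (fun x => `|f x|) @^-1` `]2 ^+ k, +oo[%classic).
  by apply: measurableT_comp => //.
by apply/seteqP; split => x /= []; rewrite ?in_itv /= ?andbT.
Qed.

Let P : R := 2 `^ p.

Let P2 : 2 < P.
Proof.
have l2 : 0 < ln (2 : R) by rewrite ln_gt0 // ltr1n.
rewrite /P /powR gt_eqF // -[ltLHS]lnK ?posrE // ltr_expR.
by rewrite -[ltLHS]mul1r ltr_pM2r.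
Qed.

Let muS_le : exists2 C : R, 0 <= C & forall k, (mu (S k) <= (C / P ^+ k)%:E)%E.
Proof.
have p0 : 0 < p by exact: lt_trans p1.
have wk := weak; set M := ereal_sup _ in wk.
have M0 : (0 <= M)%E.
  apply: le_trans (ereal_sup_ubound _); last by exists 1; [exact: ltr01|reflexivity].
  by rewrite mul1e poweR_ge0.
have Mfin : M \is a fin_num by rewrite ge0_fin_numE.
pose c := fine M; have c0 : 0 <= c by rewrite fine_ge0.
exists (c `^ p); first exact: powR_ge0.
move=> k; have Sfin : mu (S k) \is a fin_num.
  rewrite ge0_fin_numE //; apply: le_lt_trans finB; apply: le_measure; rewrite ?inE //.
  by move=> x [].
pose m := fine (mu (S k)); have m0 : 0 <= m by rewrite fine_ge0.
rewrite -(fineK Sfin) lee_fin -/m.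
have : ((2 ^+ k)%:E * (mu (S k)) `^ p^-1 <= M)%E.
  by apply: ereal_sup_ubound; exists (2 ^+ k) => //=; rewrite exprn_gt0.
rewrite -(fineK Sfin) -/m poweR_EFin -EFinM -(fineK Mfin) lee_fin -/c => h.
have -> : m = (m `^ p^-1) `^ p by rewrite -powRrM mulVf ?powRr1 // gt_eqF.
have -> : c `^ p / P ^+ k = (c / 2 ^+ k) `^ p.
  rewrite powRM ?invr_ge0 ?exprn_ge0 //; congr (_ * _).
  rewrite -[(2 ^+ k)^-1]powR_inv1 ?exprn_ge0 // -powRrM mulN1r powRN; congr (_^-1).
  rewrite -[P ^+ k](powR_mulrn k (powR_ge0 2 p)) -[2 ^+ k](powR_mulrn k (ler0n R 2)).
  by rewrite /P -!powRrM; congr (_ `^ _); exact: mulrC.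
apply: ge0_ler_powR; rewrite ?nnegrE ?powR_ge0 ?(ltW p0) //.
  by rewrite divr_ge0 ?exprn_ge0.
by rewrite ler_pdivlMr ?exprn_gt0 // mulrC.
Qed.

(** Dyadic decomposition: |f| is at most 1 plus the sum of 2^(k+1) over the level sets |f| > 2^k,
    whose measures are at most C 2^(-kp). The resulting geometric series has ratio 2^(1-p) < 1. *)
Lemma weak_Lp_integrable : mu.-integrable B (EFin \o f).
Proof.
have [C C0 hC] := muS_le.
apply/integrableP; split; first exact/measurable_EFinP.
pose g (k : nat) (x : T) : \bar R := ((2 ^+ k.+1) * \1_(S k) x)%:E.
have g0 k x : (0 <= g k x)%E by rewrite lee_fin indicE mulr_ge0 ?exprn_ge0.
have mg k : measurable_fun B (g k).
  by apply/measurable_EFinP/measurable_funM => //; exact: measurable_indic.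
have msum : measurable_fun B (fun x => \sum_(k <oo) g k x)%E.
  by apply: ge0_emeasurable_sum => // k x _ _; exact: g0.
apply: (@le_lt_trans _ _ (\int[mu]_(x in B) (1 + \sum_(k <oo) g k x))%E).
  apply: ge0_le_integral => //.
  - by apply/measurable_EFinP; exact: measurableT_comp.
  - by apply: emeasurable_funD.
  - move=> x Bx /=; have [f1|f1] := leP `|f x| 1.
      by apply: (@le_trans _ _ 1%E); rewrite ?lee_fin // leeDl //; exact: nneseries_ge0.
    have [k hk] : exists k : nat, 2 ^+ k < `|f x| <= 2 ^+ k.+1.
      have ex : exists k : nat, `|f x| <= 2 ^+ k.
        exists (Num.truncn `|f x|).+1; apply: le_trans (ltW (truncnS_gt _)) _.
        by rewrite -natrX ler_nat ltnW // ltn_expl.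
      have := ex_minnP ex; case: ex_minnP => k hk mink _.
      case: k hk mink => [|k] hk mink; first by move: hk; rewrite expr0 leNgt f1.
      by exists k; rewrite hk andbT ltNge; apply/negP => /mink; rewrite ltnn.
    have /andP[k1 k2] := hk.
    apply: (@le_trans _ _ (g k x)).
      by rewrite lee_fin indicE mem_set ?mulr1.
    rewrite -[leLHS]add0e; apply: leeD; first by rewrite lee_fin.
    rewrite (nneseriesD1 (n := k)) //.
    by rewrite leeDl //; exact: nneseries_ge0.
rewrite ge0_integralD //; last by move=> x _; exact: nneseries_ge0.
rewrite integral_cst // mul1e lte_add_pinfty // integral_nneseries //.
pose q := 2 / P; have P0 : 0 < P by exact: lt_trans P2.
have q01 : 0 < q < 1 by rewrite divr_gt0 //= ltr_pdivrMr // mul1r.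
apply: (@le_lt_trans _ _ (2 * C / (1 - q))%:E); last exact: ltry.
apply: lime_le; first by apply: is_cvg_nneseries => k _ _; apply: integral_ge0.
apply: nearW => N /=.
apply: (@le_trans _ _ (\sum_(0 <= k < N) (2 * C * q ^+ k)%:E)%E).
  apply: lee_sum => k _; rewrite /g.
  under eq_integral do rewrite EFinM.
  rewrite ge0_integralZl_EFin ?exprn_ge0 //; last first.
    by apply/measurable_EFinP; exact: measurable_indic.
  rewrite integral_indic // setIidl; last by move=> x [].
  apply: le_trans (lee_wpmul2l _ (hC k)) _; first by rewrite lee_fin exprn_ge0.
  rewrite -EFinM lee_fin le_eqVlt; apply/orP; left; apply/eqP.
  by rewrite /q exprMn exprVn exprS; ring.
rewrite sumEFin lee_fin -mulr_sumr; apply: ler_wpM2l; first by rewrite mulr_ge0.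
have /andP[q0 q1] := q01.
rewrite -[leRHS]mul1r ler_pdivlMr ?subr_gt0 //.
have -> : (\sum_(0 <= k < N) q ^+ k) * (1 - q) = 1 - q ^+ N.
  elim: N => [|N IH]; first by rewrite big_nil mul0r expr0 subrr.
  by rewrite big_nat_recr //= mulrDl IH exprS; ring.
by rewrite gerBl exprn_ge0 // ltW.
Qed.

End weak_Lp_integrability.

(** * Euclidean balls in the sup-norm topology *)

Section euclidean_geometry.
Context {R : realType} {n : nat}.
Implicit Types (x y z : 'rV[R]_n) (r : R).

Lemma dot_ge0 x : 0 <= dot x x.
Proof. by apply: sumr_ge0 => i _; rewrite -expr2 sqr_ge0. Qed.

Lemma enorm_sqr x : enorm x ^+ 2 = dot x x.
Proof. by rewrite sqr_sqrtr ?dot_ge0. Qed.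

Lemma enorm_ge0 x : 0 <= enorm x. Proof. exact: sqrtr_ge0. Qed.

Lemma norm_le_enorm x : `|x| <= enorm x.
Proof.
apply: norm_rV_le => [|i]; first exact: enorm_ge0.
rewrite -sqrtr_sqr ler_wsqrtr // /dot (bigD1 i) //= -expr2 lerDl.
by apply: sumr_ge0 => j _; rewrite -expr2 sqr_ge0.
Qed.

Lemma enorm_le_norm x : enorm x <= n%:R * `|x|.
Proof.
rewrite -[leRHS]ger0_norm ?mulr_ge0 // -sqrtr_sqr ler_wsqrtr //.
apply: (@le_trans _ _ (\sum_(i < n) `|x| ^+ 2)).
  apply: ler_sum => i _; rewrite -expr2 -(real_normK (num_real (x ord0 i))).
  by rewrite ler_sqr ?nnegrE // coord_le_norm.
rewrite sumr_const card_ord exprMn -[leLHS]mulr_natl ler_wpM2r ?sqr_ge0 //.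
by rewrite -natrX ler_nat; case: (n) => // m; rewrite expnS expn1 leq_pmull.
Qed.

Lemma continuous_enorm (z : 'rV[R]_n) : continuous (fun x : 'rV[R]_n => enorm (x - z)).
Proof.
have cd : continuous (fun x : 'rV[R]_n => dot (x - z) (x - z)).
  rewrite /dot; elim: (index_enum _) => [|i s IH].
    rewrite (_ : (fun x => _) = fun=> 0); first exact: continuous_constr.
    by apply/funext => y; rewrite big_nil.
  rewrite (_ : (fun x => _) = (fun y : 'rV[R]_n => (y - z) ord0 i * (y - z) ord0 i) \+
    (fun y : 'rV[R]_n => \sum_(i <- s) (y - z) ord0 i * (y - z) ord0 i)); last first.
    by apply/funext => y; rewrite big_cons.
  have cc : continuous (fun y : 'rV[R]_n => (y - z) ord0 i).
    exact: (@continuous_translate _ _ (fun y : 'rV[R]_n => y ord0 i) z (@coord_continuous _ _ _ _ _)).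
  by move=> x; exact: (cvgD (cvgM (cc x) (cc x)) (IH x)).
move=> x; apply: (@cvg_comp _ _ _ _ Num.sqrt _ (nbhs (dot (x - z) (x - z)))).
  exact: cd.
exact: sqrt_continuous.
Qed.

Lemma eball_open z r : open (eball z r).
Proof.
apply: (@open_comp _ _ (fun x : 'rV[R]_n => enorm (x - z)) [set y | y < r]).
  by move=> x _; exact: continuous_enorm.
exact: open_lt.
Qed.

Lemma closure_eball z r : closure (eball z r) `<=` [set x | enorm (x - z) <= r].
Proof.
have cl : closed [set x : 'rV[R]_n | enorm (x - z) <= r].
  apply: (@closed_comp _ _ (fun x : 'rV[R]_n => enorm (x - z)) [set y | y <= r]).
    by move=> x _; exact: continuous_enorm.
  exact: closed_le.
move=> x h; apply: cl; move: x h; apply: closureS => x /=; exact: ltW.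
Qed.

Lemma closure_eball_compact z r : compact (closure (eball z r)).
Proof.
apply: (@subclosed_compact _ (closure (eball z r)) [set x | `|x - z| <= r]).
- exact: closed_closure.
- exact: closed_ball_compact.
- by move=> x /closure_eball /=; apply: le_trans; exact: norm_le_enorm.
Qed.

Lemma compact_in_open (K O : set 'rV[R]_n) : compact K -> open O -> K `<=` O ->
  exists2 d, 0 < d & forall x y, K x -> `|y - x| < d -> O y.
Proof.
move=> /compact_near_coveringP cK oO KO.
have /cK : forall x, K x -> \forall x' \near x & h \near nbhs (0 : 'rV[R]_n), O (x' + h).
  move=> x Kx; have /nbhs_ballP[d /= d0 hd] : nbhs x O by exact: open_nbhs_nbhs (conj oO (KO _ Kx)).
  exists (ball x (d / 2), ball 0 (d / 2)) => /=.
    by split; apply: nbhsx_ballx; rewrite divr_gt0.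
  move=> [y h] /= []; rewrite -!ball_normE /= sub0r normrN => xy hh.
  apply: hd; rewrite -ball_normE /= opprD addrA.
  by rewrite (le_lt_trans (ler_normB _ _)) // [ltRHS](splitr d) ltrD.
move=> /nbhs_ballP[d /= d0 hd]; exists d => // x y Kx xy.
have := hd (y - x); rewrite -ball_normE /= sub0r normrN => /(_ xy x Kx).
by rewrite (_ : x + (y - x) = y) // addrC subrK.
Qed.

End euclidean_geometry.

Section weak_gradient_approximation.
Context {R : realType} {n : nat}.
Local Notation mu := (@lebesgue_rV R n).
Local Notation B1 := (@eball R n 0 1).

Lemma eball_measurable (z : 'rV[R]_n) r : measurable (eball z r).
Proof. by apply: open_measurable_rV; exact: eball_open. Qed.

Lemma eball_finite (z : 'rV[R]_n) r : (mu (eball z r) < +oo)%E.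
Proof.
have r1 : 0 < `|r| + 1 by rewrite ltr_wpDl.
apply: (@le_lt_trans _ _ (mu (ball z (`|r| + 1)))); last by rewrite lebesgue_rV_ball // ltry.
apply: le_measure; rewrite ?inE.
- exact: eball_measurable.
- by apply: open_measurable_rV; exact: ball_open.
move=> x /= xr; rewrite -ball_normE /= distrC (le_lt_trans (norm_le_enorm _)) //.
by rewrite (lt_trans xr) // (le_lt_trans (ler_norm r)) // ltrDl.
Qed.

Lemma within_eball_continuous u x : {within B1, continuous u} -> B1 x ->
  {for x, continuous (u : 'rV[R]_n -> R)}.
Proof.
rewrite (continuous_open_subspace _ (@eball_open R n 0 1)) => cu Bx.
by apply: cu; rewrite inE.
Qed.

Lemma L2_restrictP (f : 'rV[R]_n -> R) : L2 B1 f ->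
  [/\ measurable_fun setT (f \_ B1),
      mu.-integrable setT (EFin \o (fun x => (f \_ B1) x ^+ 2)) &
      mu.-integrable setT (EFin \o (f \_ B1))].
Proof.
move=> L; have i2 := Lfun2_integrable_sqr L.
have mf : measurable_fun setT (f \_ B1).
  by move: L; rewrite /L2 inE => /andP[+ _]; rewrite inE.
split => //; apply: (integrable_of_sqr (eball_measurable 0 1) (eball_finite 0 1) mf).
  by move=> x Bx; rewrite patchE memNset.
have /integrableP[_] := i2; apply: le_lt_trans.
rewrite le_eqVlt; apply/orP; left; apply/eqP; apply: eq_integral => x _.
by rewrite /= ger0_norm ?sqr_ge0.
Qed.

Lemma common_threshold (m : nat) (P : 'I_m -> R -> Prop) :
  (forall i, exists2 e0, 0 < e0 & forall e, e <= e0 -> P i e) ->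
  exists2 e0, 0 < e0 & forall e, e <= e0 -> forall i, P i e.
Proof.
move=> h; have /choice[f hf] : forall i, exists e0, 0 < e0 /\ forall e, e <= e0 -> P i e.
  by move=> i; have [e0 h1 h2] := h i; exists e0.
exists (\big[Num.min/1]_i f i).
  by apply: lt_bigmin => // i _; exact: (hf i).1.
move=> e he i; apply: (hf i).2; apply: le_trans he _; exact: bigmin_le.
Qed.

Lemma refl_conv_restrict (k f : 'rV[R]_n -> R) x :
  refl_conv k (f \_ B1) x = \int[mu]_(y in B1) (f y * k (y - x)).
Proof.
rewrite [RHS]Rintegral_mkcond; congr Rintegral; apply/funext => y.
by rewrite !patchE; case: ifP => _; rewrite ?mulr0 // mulrC.
Qed.

(** Mollify the extension of [u] by 0. On [K], at scales below the distance to the boundary of B_1,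
    the gradient of the mollification is the mollification of [Du]. Closeness to [u] has to be
    uniform, so that truncating the approximation still localizes to {u > 0}. *)
Lemma weak_gradient_approx (u : 'rV[R]_n -> R) (Du : 'rV[R]_n -> 'rV[R]_n) K :
  H1_with_gradient B1 u Du -> {within B1, continuous u} ->
  compact K -> K `<=` B1 ->
  forall tau, 0 < tau -> exists w, [/\ smooth w,
    (forall x, K x -> `|w x - u x| <= tau) &
    forall i, (\int[mu]_(x in K) ((pderiv i w x - Du x ord0 i) ^+ 2)%:E <= tau%:E)%E].
Proof.
move=> [L2u L2D wg] cu cK KB tau tau0.
have [mu_ _ iu] := L2_restrictP L2u.
have [d d0 hd] := compact_in_open cK (@eball_open R n 0 1) KB.
have [d' d'0 hd'] := compact_unif_continuous cK
  (fun x Kx => within_eball_continuous cu (KB _ Kx)) tau0.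
have [e0 e00 he0] : exists2 e0, 0 < e0 & forall e, e <= e0 -> forall i : 'I_n,
    forall rho, mollifier rho e ->
    (\int[mu]_x ((refl_conv rho ((fun x => Du x ord0 i) \_ B1) x
       - ((fun x => Du x ord0 i) \_ B1) x) ^+ 2)%:E <= tau%:E)%E.
  apply: common_threshold => i.
  have [mD iD2 _] := L2_restrictP (L2D i).
  have [|e0 e00 h] := conv_L2_cvg mD _ iD2 tau0.
    move=> x x1; rewrite patchE memNset //= => Bx; move: x1; rewrite leNgt => /negP; apply.
    by apply: le_lt_trans Bx; rewrite subr0 norm_le_enorm.
  by exists e0 => // e ee0 rho; exact: h.
(* Below d / 2 the kernel stays inside B_1, below d' it sees [u] vary by less than [tau], and below
   e0 all mollified components of [Du] are close in L^2. *)
pose e := Num.min (d / 2) (Num.min d' e0).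
have e_gt0 : 0 < e by rewrite !lt_min divr_gt0 // d'0 e00.
have ed : e < d.
  by apply: (@le_lt_trans _ _ (d / 2)); rewrite ?ge_min ?lexx // ltr_pdivrMr // ltr_pMr // ltr1n.
have [rho mrho] := @mollifier_exists R n e e_gt0.
have [srho rho0 suprho even _] := mrho; have crho := smooth_continuous srho.
exists (refl_conv rho (u \_ B1)); split.
- exact: (conv_smooth iu srho suprho).
- move=> x Kx.
  have ux : (u \_ B1) x = u x by rewrite patchE mem_set //; exact: KB.
  rewrite -ux; apply: (conv_near_value mrho iu) => y yx.
  have By : B1 y by apply: (hd x y Kx); exact: lt_trans ed.
  rewrite ux patchE mem_set // ltW // hd' //.
  by apply: lt_le_trans yx _; rewrite /e ge_min ge_min lexx orbT.
- move=> i.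
  have dE x : K x -> pderiv i (refl_conv rho (u \_ B1)) x =
      refl_conv rho ((fun x => Du x ord0 i) \_ B1) x.
    move=> Kx; rewrite (pderivE (conv_derive iu i x srho suprho)).
    (* The translated kernel is itself a test function on B_1, so the definition of the weak
       gradient moves the derivative from the kernel to [u]. *)
    pose phi (y : 'rV[R]_n) := rho (y - x).
    have tphi : test_function B1 phi.
      have supp : closure [set y | phi y != 0] `<=` [set y | `|y - x| <= e].
        have cl : closed [set y : 'rV[R]_n | `|y - x| <= e].
          apply: compact_closed; first exact: norm_hausdorff.
          exact: closed_ball_compact.
        move=> y h; apply: cl; move: y h; apply: closureS => y /= hy.
        by rewrite leNgt; apply/negP => /ltW /suprho; exact/eqP.
      split.
      + exact: smooth_translate.
      + apply: (@subclosed_compact _ _ [set y : 'rV[R]_n | `|y - x| <= e]) => //.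
          exact: closed_closure.
        exact: closed_ball_compact.
      + move=> y /supp /= yx; apply: (hd x y Kx); exact: le_lt_trans ed.
    have := wg phi tphi i.
    rewrite !refl_conv_restrict => E; apply: oppr_inj; rewrite opprK.
    apply: etrans E; congr Rintegral.
    apply/funext => y; congr (_ * _); apply/esym/pderivE.
    by apply: (@is_derive_translate _ _ rho (- x)); exact: smooth_derive.
  have mK : measurable K.
    by apply: closed_measurable_rV; apply: compact_closed => //; exact: norm_hausdorff.
  have [mD _ iD] := L2_restrictP (L2D i).
  have mdiff : measurable_fun setT (fun x =>
      refl_conv rho ((fun x => Du x ord0 i) \_ B1) x - ((fun x => Du x ord0 i) \_ B1) x).
    have mc := continuous_measurable_rV (conv_continuous iD crho suprho).
    exact: (measurable_funB mc mD).
  apply: le_trans (he0 e _ i rho mrho); last first.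
    by rewrite /e !ge_min lexx !orbT.
  apply: (@le_trans _ _ (\int[mu]_(x in K) ((refl_conv rho ((fun x => Du x ord0 i) \_ B1) x
       - ((fun x => Du x ord0 i) \_ B1) x) ^+ 2)%:E)%E).
    rewrite le_eqVlt; apply/orP; left; apply/eqP; apply: eq_integral => x /[!inE] Kx.
    by rewrite dE // [in RHS]patchE mem_set //; exact: KB.
  exact: (ge0_integral_sqr_subset mu mK measurableT mdiff (@subsetT _ K)).
Qed.

End weak_gradient_approximation.

(** * A smooth substitute for the positive part *)

(* ramp l t is a smooth convex substitute for s |-> max(s - l, 0): it is
   sandwiched between max(s - l - t, 0) and max(s - l, 0). *)
Section ramp.
Context {R : realType}.
Variables (l t : R).
Hypothesis t0 : 0 < t.
Implicit Types s : R.

Definition ramp s : R := (s - l) * flat_exp 1 ((s - l) / t).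
Definition ramp1 s : R :=
  flat_exp 1 ((s - l) / t) + (s - l) / t * flat_exp 'X^2 ((s - l) / t).
Definition ramp2 s : R :=
  2 / t * flat_exp 'X^2 ((s - l) / t) +
  (s - l) / t ^+ 2 * flat_exp (flat_deriv 'X^2) ((s - l) / t).

Let flat_deriv1 : flat_deriv 1 = 'X^2 :> {poly R}.
Proof. by rewrite /flat_deriv -polyC1 derivC subr0 polyC1 mulr1. Qed.

Let daff s : is_derive s 1 (fun s => (s - l) / t) t^-1.
Proof.
rewrite (_ : (fun s => _) = (fun s => t^-1 * s + (- l / t))); last first.
  by apply/funext => x; ring.
apply: is_derive_eq (is_deriveD (is_deriveZ t^-1 (is_derive_id _ _)) (is_derive_cst _ _ _)) _.
by rewrite addr0 /GRing.scale /= mulr1.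
Qed.

Let dsub s : is_derive s 1 (fun s => s - l) 1.
Proof. exact: is_derive_shift. Qed.

Let dflat (P : {poly R}) s : is_derive s 1 (fun s => flat_exp P ((s - l) / t))
  (flat_exp (flat_deriv P) ((s - l) / t) * t^-1).
Proof.
by apply: (@is_derive1_comp _ (flat_exp P) (fun s => (s - l) / t)); [exact: is_derive_flat_exp|exact: daff].
Qed.

Lemma is_derive_ramp s : is_derive s 1 ramp (ramp1 s).
Proof.
apply: is_derive_eq (is_deriveM (dsub s) (dflat 1 s)) _.
by rewrite flat_deriv1 /ramp1 /GRing.scale /=; ring.
Qed.

Lemma is_derive_ramp1 s : is_derive s 1 ramp1 (ramp2 s).
Proof.
apply: is_derive_eq (is_deriveD (dflat 1 s) (is_deriveM (daff s) (dflat 'X^2 s))) _.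
rewrite flat_deriv1 /ramp2 /GRing.scale /=; field.
by rewrite gt_eqF.
Qed.

Let y_gt0 s : (0 < (s - l) / t) = (l < s).
Proof. by rewrite pmulr_lgt0 ?invr_gt0 // subr_gt0. Qed.

Lemma ramp_le0 s : s <= l -> ramp s = 0.
Proof.
move=> sl; rewrite /ramp flat_exp_le0 ?mulr0 //.
by rewrite leNgt y_gt0 -leNgt.
Qed.

Lemma ramp1_le0 s : s <= l -> ramp1 s = 0.
Proof. by move=> sl; rewrite /ramp1 !flat_exp_le0 ?mulr0 ?addr0 // leNgt y_gt0 -leNgt. Qed.

Lemma ramp_ge0 s : 0 <= ramp s.
Proof.
have [sl|sl] := leP s l; first by rewrite ramp_le0.
by rewrite mulr_ge0 ?flat_exp1_ge0 // subr_ge0 ltW.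
Qed.

Lemma ramp_le s : ramp s <= Num.max (s - l) 0.
Proof.
have [sl|sl] := leP s l; first by rewrite ramp_le0 // le_max lexx orbT.
rewrite le_max; apply/orP; left; rewrite /ramp ler_piMr ?flat_exp1_le1 //.
by rewrite subr_ge0 ltW.
Qed.

(** For s > l, exp(-t/(s - l)) >= 1 - t/(s - l); multiply by s - l. *)
Lemma ramp_ge s : s - l - t <= ramp s.
Proof.
have t0' := t0; have [sl|sl] := leP s l.
  by rewrite ramp_le0 //; lra.
have y0 : 0 < (s - l) / t by rewrite y_gt0.
rewrite /ramp /flat_exp y0 hornerC mul1r.
have sl0 : 0 < s - l by rewrite subr_gt0.
have := ler_wpM2l (ltW sl0) (expR_ge1Dx (- ((s - l) / t)^-1)).
apply: le_trans; rewrite invf_div mulrDr mulr1 mulrN.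
by rewrite [(s - l) * (t / _)]mulrC divfK ?gt_eqF.
Qed.

(** With y = (s - l)/t > 0, the derivative is (1 + 1/y) exp(-1/y), and 1 + x <= exp x. *)
Lemma ramp1_01 s : 0 <= ramp1 s <= 1.
Proof.
have [sl|sl] := leP s l; first by rewrite ramp1_le0 // lexx ler01.
have y0 : 0 < (s - l) / t by rewrite y_gt0.
rewrite /ramp1 /flat_exp y0 hornerC mul1r hornerXn; set y := (s - l) / t.
have yn : y != 0 by rewrite gt_eqF.
have -> : expR (- y^-1) + y * (y^-1 ^+ 2 * expR (- y^-1)) = (1 + y^-1) * expR (- y^-1).
  by field.
have yV : 0 < y^-1 by rewrite invr_gt0.
rewrite mulr_ge0 ?expR_ge0 ?addr_ge0 ?(ltW yV) //=.
by rewrite expRN ler_pdivrMr ?expR_gt0 // mul1r expR_ge1Dx.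
Qed.

(** With y = (s - l)/t > 0, the two summands add up to exp(-1/y) / (t y^3). *)
Lemma ramp2_ge0 s : 0 <= ramp2 s.
Proof.
have [sl|sl] := leP s l.
  by rewrite /ramp2 !flat_exp_le0 ?mulr0 ?addr0 // leNgt y_gt0 -leNgt.
have y0 : 0 < (s - l) / t by rewrite y_gt0.
have E z : (flat_deriv 'X^2).[z] = z ^+ 2 * (z ^+ 2 - z *+ 2) :> R.
  by rewrite /flat_deriv hornerM hornerD hornerN derivXn hornerMn !hornerXn expr1.
rewrite /ramp2 /flat_exp y0 E hornerXn.
have -> : (s - l) / t ^+ 2 = (s - l) / t / t by field; rewrite gt_eqF.
set y := (s - l) / t; have yn : y != 0 by rewrite gt_eqF.
rewrite (_ : _ + _ = t^-1 * (y^-1 ^+ 3) * expR (- y^-1)).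
  by rewrite !mulr_ge0 ?expR_ge0 ?exprn_ge0 ?invr_ge0 ?(ltW t0) ?(ltW y0).
by field; rewrite gt_eqF //= gt_eqF.
Qed.

(** The tangent inequality for a convex function vanishing at l. It bounds the square of the ramp by
    the zero-order integrand [ramp * ramp1]. *)
Lemma ramp_le_ramp1 s : ramp s <= (s - l) * ramp1 s.
Proof.
have [sl|sl] := leP s l; first by rewrite ramp_le0 // ramp1_le0 // mulr0.
have sl0 : 0 <= s - l by rewrite subr_ge0 ltW.
rewrite /ramp ler_wpM2l // /ramp1 lerDl mulr_ge0 ?divr_ge0 ?(ltW t0) //.
have y0 : 0 < (s - l) / t by rewrite y_gt0.
by rewrite /flat_exp y0 hornerXn mulr_ge0 ?expR_ge0 ?exprn_ge0 ?invr_ge0 ?(ltW y0).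
Qed.

Lemma ramp2_bounded (M : R) : exists2 C, 0 <= C & forall s, 0 <= s <= M -> ramp2 s <= C.
Proof.
have [C1 C10 h1] := @flat_exp_le_sqr R 'X^2.
have [C2 C20 h2] := @flat_exp_le_sqr R (flat_deriv 'X^2).
pose N := (`|M| + `|l|) / t; have N0 : 0 <= N by rewrite divr_ge0 ?addr_ge0 ?(ltW t0).
exists (2 / t * (C1 * N ^+ 2) + N / t * (C2 * N ^+ 2)).
  by rewrite addr_ge0 // !mulr_ge0 ?invr_ge0 ?sqr_ge0 ?(ltW t0).
move=> s /andP[s0 sM].
have yN : `|(s - l) / t| <= N.
  rewrite normrM normfV (gtr0_norm t0) ler_pM2r ?invr_gt0 //.
  rewrite (le_trans (ler_normB _ _)) // lerD2r ger0_norm // (le_trans sM) //.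
  exact: ler_norm.
have y2 : ((s - l) / t) ^+ 2 <= N ^+ 2.
  by rewrite -(real_normK (num_real ((s - l) / t))) ler_sqr ?nnegrE.
have bnd P C : 0 <= C -> (forall x, `|flat_exp P x| <= C * x ^+ 2) ->
    `|flat_exp P ((s - l) / t)| <= C * N ^+ 2.
  by move=> C0 h; apply: le_trans (h _) _; rewrite ler_wpM2l.
rewrite /ramp2 lerD //.
  rewrite ler_wpM2l ?divr_ge0 ?(ltW t0) //; apply: le_trans (bnd _ _ C10 h1).
  exact: ler_norm.
have -> : (s - l) / t ^+ 2 = (s - l) / t / t by field; rewrite gt_eqF.
apply: le_trans (ler_norm _) _; rewrite normrM ler_pM // ?(bnd _ _ C20 h2) //.
by rewrite normrM normfV (gtr0_norm t0) ler_pM2r ?invr_gt0.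
Qed.

End ramp.

Section smooth_ramp.
Context {R : realType} {n : nat}.

Lemma smooth_affine (w : 'rV[R]_n -> R) (a b : R) : smooth w -> smooth (fun x => (w x - a) * b).
Proof.
move=> sw.
exact: (smoothM (smoothD sw (smooth_cst (- a))) (smooth_cst b)).
Qed.

Lemma smooth_ramp (w : 'rV[R]_n -> R) l t : smooth w -> smooth (fun x => ramp l t (w x)).
Proof.
move=> sw.
have := smoothM (smooth_affine l 1 sw) (smooth_flat_exp 1 (smooth_affine l t^-1 sw)).
by rewrite (_ : _ \* _ = (fun x => ramp l t (w x))) //; apply/funext => x; rewrite /= mulr1.
Qed.

Lemma smooth_ramp1 (w : 'rV[R]_n -> R) l t : smooth w -> smooth (fun x => ramp1 l t (w x)).
Proof.
move=> sw; have sa := smooth_affine l t^-1 sw.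
exact: (smoothD (smooth_flat_exp 1 sa) (smoothM sa (smooth_flat_exp 'X^2 sa))).
Qed.

End smooth_ramp.

(** * The energy inequality *)

Section quadratic_form.
Context {R : realType} {n : nat}.
Implicit Types (A : 'M[R]_n) (x y z : 'rV[R]_n) (k : R).

Lemma dotC x y : dot x y = dot y x.
Proof. by apply: eq_bigr => i _; rewrite mulrC. Qed.

Lemma dotDl x y z : dot (x + y) z = dot x z + dot y z.
Proof. by rewrite -big_split; apply: eq_bigr => i _; rewrite /= mxE mulrDl. Qed.

Lemma dotZl k x y : dot (k *: x) y = k * dot x y.
Proof. by rewrite mulr_sumr; apply: eq_bigr => i _; rewrite mxE mulrA. Qed.

Lemma mxactD A x y : mxact A (x + y) = mxact A x + mxact A y.
Proof. by rewrite /mxact !linearD. Qed.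

Lemma mxactZ A k x : mxact A (k *: x) = k *: mxact A x.
Proof. by rewrite /mxact !linearZ. Qed.

Lemma mxactE A x i : mxact A x ord0 i = \sum_j A i j * x ord0 j.
Proof. by rewrite !mxE; apply: eq_bigr => j _; rewrite mxE. Qed.

Lemma dot_mxact_sym A x y : A^T = A -> dot (mxact A x) y = dot (mxact A y) x.
Proof.
move=> As; rewrite /dot.
under eq_bigr do rewrite mxactE mulr_suml.
under [RHS]eq_bigr do rewrite mxactE mulr_suml.
rewrite exchange_big; apply: eq_bigr => i _; apply: eq_bigr => j _.
by rewrite -[in LHS]As mxE mulrAC.
Qed.

Lemma dot_sqrD_le x y : dot (x + y) (x + y) <= 2 * dot x x + 2 * dot y y.
Proof.
rewrite !mulr_sumr -big_split; apply: ler_sum => i _ /=.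
by rewrite mxE -!expr2 sqrD_le2.
Qed.

Variables (A : 'M[R]_n) (lam Lam : R).
Hypothesis As : A^T = A.
Hypothesis ell : forall xi, lam * enorm xi ^+ 2 <= dot (mxact A xi) xi <= Lam * enorm xi ^+ 2.
Hypothesis lam0 : 0 < lam.
Hypothesis lamLam : lam <= Lam.

Local Notation b x y := (dot (mxact A x) y).

Lemma form_ge x : lam * dot x x <= b x x.
Proof. by have /andP[] := ell x; rewrite enorm_sqr. Qed.

Lemma form_le x : b x x <= Lam * dot x x.
Proof. by have /andP[] := ell x; rewrite enorm_sqr. Qed.

Lemma formDl x y z : b (x + y) z = b x z + b y z.
Proof. by rewrite mxactD dotDl. Qed.

Lemma formZl k x z : b (k *: x) z = k * b x z.
Proof. by rewrite mxactZ dotZl. Qed.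

Lemma formDr x y z : b x (y + z) = b x y + b x z.
Proof. by rewrite dotC dotDl ![dot _ (mxact _ _)]dotC. Qed.

Lemma formZr k x z : b x (k *: z) = k * b x z.
Proof. by rewrite dotC dotZl dotC. Qed.

(** Expand the form at k x + y and k x - y; both values are nonnegative by ellipticity, and symmetry
    merges the cross terms. *)
Lemma form_am_gm k x y : 0 < k -> 2 * `|b x y| <= Lam * (k * dot x x + dot y y / k).
Proof.
move=> k0; have kn : k != 0 by rewrite gt_eqF.
have pos u v : 0 <= b u u + 2 * b u v + b v v.
  have := form_ge (u + v); rewrite formDl !formDr [b v u]dot_mxact_sym //.
  have := mulr_ge0 (ltW lam0) (dot_ge0 (u + v)); lra.
have key u : 2 * b x u <= Lam * (k * dot x x + dot u u / k) /\
    - (2 * b x u) <= Lam * (k * dot x x + dot u u / k).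
  have h1 := pos (k *: x) u; have h2 := pos (k *: x) ((-1) *: u).
  rewrite !(formZl, formZr) in h1 h2.
  have hx := ler_wpM2l (ltW k0) (form_le x).
  have ki : 0 <= k^-1 by rewrite invr_ge0 ltW.
  have hu := ler_wpM2r ki (form_le u).
  have h1' := mulr_ge0 h1 ki; have h2' := mulr_ge0 h2 ki.
  have e1 : (k * (k * b x x) + 2 * (k * b x u) + b u u) / k = k * b x x + 2 * b x u + b u u / k.
    by field.
  have e2 : (k * (k * b x x) + 2 * (k * (-1 * b x u)) + -1 * (-1 * b u u)) / k
     = k * b x x - 2 * b x u + b u u / k by field.
  rewrite e1 in h1'; rewrite e2 in h2'.
  have -> : Lam * (k * dot x x + dot u u / k) = k * (Lam * dot x x) + Lam * dot u u / k by ring.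
  by split; lra.
have [k1 k2] := key y.
have := ler_norml (2 * b x y) (Lam * (k * dot x x + dot y y / k)).
rewrite normrM (ger0_norm (ler0n _ 2)) => ->.
by apply/andP; split; lra.
Qed.

Lemma form_bound x y : `|b x y| <= Lam * (dot x x + dot y y).
Proof.
have := form_am_gm x y ltr01; rewrite mul1r divr1.
have : 0 <= `|b x y| by []. lra.
Qed.

(* the gradient of ramp(w) ramp'(w) h^2, where p and e are the gradients of w and h, and
   g, g1, g2 the values at w of ramp and its derivatives *)
Definition energy_grad (g g1 g2 h : R) (p e : 'rV[R]_n) :=
  ((g1 ^+ 2 + g * g2) * h ^+ 2) *: p + (2 * g * g1 * h) *: e.

(** Here [D] is the weak gradient of u and [p] the gradient of its approximation. The part of the
    form in [D - p] is an error, estimated by Young's inequality with weight [s]. In the part with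
    [p], the nonnegative term in g g2 is dropped and the cross term with [e] is absorbed. *)
Lemma energy_pointwise (g g1 g2 h s : R) (D p e : 'rV[R]_n) :
  0 <= g -> 0 <= g2 -> 0 < s ->
  lam / 2 * (g1 ^+ 2 * dot p p * h ^+ 2) - 2 * Lam ^+ 2 / lam * (g ^+ 2 * dot e e)
   - Lam / 2 * (dot (D - p) (D - p) / s
     + s * dot (energy_grad g g1 g2 h p e) (energy_grad g g1 g2 h p e))
  <= b D (energy_grad g g1 g2 h p e).
Proof.
move=> g0 g20 s0; set G := energy_grad _ _ _ _ _ _.
have -> : b D G = b (D - p) G + b p G by rewrite -formDl subrK.
have Lam0 : 0 < Lam by apply: lt_le_trans lamLam.
have sV : 0 < s^-1 by rewrite invr_gt0.
have h1 := form_am_gm (D - p) G sV; rewrite invrK in h1.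
have h1' : - (Lam / 2 * (dot (D - p) (D - p) / s + s * dot G G)) <= b (D - p) G.
  have := ler_norm (- b (D - p) G); rewrite normrN.
  have e1 : Lam * (s^-1 * dot (D - p) (D - p) + dot G G * s) =
    Lam * (dot (D - p) (D - p) / s + s * dot G G) by ring.
  rewrite e1 in h1; lra.
(* This weight in Young's inequality makes the cross term cost exactly half of the main gradient
   term. *)
have k0 : 0 < lam / (2 * Lam) by rewrite divr_gt0 // mulr_gt0.
have h2 := form_am_gm ((g1 * h) *: p) (g *: e) k0.
have ee k x : dot (k *: x) (k *: x) = k ^+ 2 * dot x x.
  by rewrite dotZl dotC dotZl mulrA expr2.
rewrite !ee formZl formZr in h2.
have e2 : Lam * (lam / (2 * Lam) * ((g1 * h) ^+ 2 * dot p p) + g ^+ 2 * dot e e / (lam / (2 * Lam)))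
  = lam / 2 * (g1 ^+ 2 * dot p p * h ^+ 2) + 2 * Lam ^+ 2 / lam * (g ^+ 2 * dot e e).
  by field; rewrite !gt_eqF.
rewrite e2 in h2.
have h3 : - (lam / 2 * (g1 ^+ 2 * dot p p * h ^+ 2) + 2 * Lam ^+ 2 / lam * (g ^+ 2 * dot e e))
   <= 2 * (g1 * h * (g * b p e)).
  have := ler_norm (- (g1 * h * (g * b p e))); rewrite normrN; lra.
have h4 : lam * (g1 ^+ 2 * dot p p * h ^+ 2) <= (g1 ^+ 2 + g * g2) * h ^+ 2 * b p p.
  have -> : lam * (g1 ^+ 2 * dot p p * h ^+ 2) = (g1 ^+ 2 * h ^+ 2) * (lam * dot p p) by ring.
  have hb := form_ge p.
  have c0 : 0 <= g1 ^+ 2 * h ^+ 2 by rewrite mulr_ge0 ?sqr_ge0.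
  apply: le_trans (ler_wpM2l c0 hb) _.
  apply: ler_wpM2r; first by apply: le_trans hb; rewrite mulr_ge0 ?dot_ge0 ?(ltW lam0).
  by rewrite ler_wpM2r ?sqr_ge0 // lerDl mulr_ge0.
have -> : b p G = (g1 ^+ 2 + g * g2) * h ^+ 2 * b p p + 2 * g * g1 * h * b p e.
  by rewrite /G /energy_grad formDr !formZr.
have e3 : 2 * g * g1 * h * b p e = 2 * (g1 * h * (g * b p e)) by ring.
rewrite e3; lra.
Qed.

Lemma energy_grad_le (g g1 g2 h C : R) (p e : 'rV[R]_n) : 0 <= C ->
  `|(g1 ^+ 2 + g * g2) * h ^+ 2| <= C -> (2 * g * g1 * h) ^+ 2 * dot e e <= C ^+ 2 ->
  dot (energy_grad g g1 g2 h p e) (energy_grad g g1 g2 h p e) <= 2 * C ^+ 2 * (dot p p + 1).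
Proof.
move=> C0 c1 c2; apply: le_trans (dot_sqrD_le _ _) _.
have ee k x : dot (k *: x) (k *: x) = k ^+ 2 * dot x x.
  by rewrite dotZl dotC dotZl mulrA expr2.
have c1' : ((g1 ^+ 2 + g * g2) * h ^+ 2) ^+ 2 <= C ^+ 2.
  by rewrite -(real_normK (num_real ((g1 ^+ 2 + g * g2) * h ^+ 2))) ler_sqr ?nnegrE.
have := ler_wpM2r (dot_ge0 p) c1'; rewrite !ee; lra.
Qed.

End quadratic_form.

Section ae_comparison.
Context d (T : measurableType d) (R : realType) (mu : {measure set T -> \bar R}).
Variables (D : set T).
Hypothesis mD : measurable D.
Implicit Types f g : T -> R.

Lemma ae_le_integrable f g : measurable_fun D f -> mu.-integrable D (EFin \o g) ->
  {ae mu, forall x, D x -> `|f x| <= g x} -> mu.-integrable D (EFin \o f).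
Proof.
move=> mf ig fg; have mg := measurable_int mu ig.
apply/integrableP; split; first exact/measurable_EFinP.
have /integrableP[_] := ig; apply: le_lt_trans.
apply: ae_ge0_le_integral => //.
- exact/measurableT_comp/measurable_EFinP.
- exact/measurableT_comp.
- apply: filterS fg => x h Dx; rewrite /= lee_fin.
  exact: le_trans (h Dx) (ler_norm _).
Qed.

(** Replacing [g] by the maximum of [f] and [g] alters it on a null set only and makes the
    inequality hold everywhere. *)
Lemma ae_le_Rintegral f g : mu.-integrable D (EFin \o f) -> mu.-integrable D (EFin \o g) ->
  {ae mu, forall x, D x -> f x <= g x} -> \int[mu]_(x in D) f x <= \int[mu]_(x in D) g x.
Proof.
move=> jf ig fg.
pose h x := Num.max (f x) (g x).
have mf : measurable_fun D f by apply/measurable_EFinP; exact: measurable_int jf.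
have mg : measurable_fun D g by apply/measurable_EFinP; exact: measurable_int ig.
have mh : measurable_fun D h by exact: measurable_maxr.
have fgh : {ae mu, forall x, D x -> g x = h x}.
  by apply: filterS fg => x fg Dx; rewrite /h max_r // fg.
have ih : mu.-integrable D (EFin \o h).
  apply: ae_le_integrable mh (integrable_norm ig) _.
  by apply: filterS fgh => x h' Dx; rewrite -h'.
have -> : \int[mu]_(x in D) g x = \int[mu]_(x in D) h x.
  rewrite /Rintegral; congr fine; apply: ae_eq_integral => //.
  - exact/measurable_EFinP.
  - exact/measurable_EFinP.
  - by apply: filterS fgh => x h' Dx /=; rewrite -h'.
by apply: le_Rintegral => // x _; rewrite /h le_max lexx.
Qed.

Lemma bounded_integrable f c : (mu D < +oo)%E -> measurable_fun D f ->
  (forall x, D x -> `|f x| <= c) -> mu.-integrable D (EFin \o f).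
Proof.
move=> finD mf fc.
have ic : mu.-integrable D (EFin \o cst c).
  apply: measurable_bounded_integrable => //.
  exists `|c|; split; first exact: num_real.
  by move=> M cM x _ /=; rewrite ltW.
apply: ae_le_integrable mf ic _.
by apply: aeW => x Dx; exact: fc.
Qed.

Lemma energy_from_pointwise (F phi X Y E : T -> R) (c tau : R) :
  mu.-integrable D (EFin \o F) -> mu.-integrable D (EFin \o X) ->
  mu.-integrable D (EFin \o Y) -> mu.-integrable D (EFin \o E) ->
  \int[mu]_(x in D) E x <= tau ->
  \int[mu]_(x in D) F x + c * \int[mu]_(x in D) phi x <= 0 ->
  {ae mu, forall x, D x -> X x - Y x - E x <= F x} ->
  \int[mu]_(x in D) X x + c * \int[mu]_(x in D) phi x <= \int[mu]_(x in D) Y x + tau.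
Proof.
move=> iF iX iY iE Etau Fphi ae.
have iXY := integrableB mD iX iY.
have iXYE := integrableB mD iXY iE.
have := ae_le_Rintegral iXYE iF ae.
rewrite (RintegralB mD iXY iE) (RintegralB mD iX iY); lra.
Qed.

Lemma integrable_sum_fun (m : nat) (q : 'I_m -> T -> R) :
  (forall i, mu.-integrable D (EFin \o q i)) ->
  mu.-integrable D (EFin \o (fun x => \sum_i q i x)).
Proof.
elim: m q => [|m IH] q iq.
  have -> : (fun x => \sum_(i < 0) q i x) = cst 0 by apply/funext => x; rewrite big_ord0.
  exact: integrable0.
have -> : (fun x => \sum_i q i x) = (fun x => q ord0 x + \sum_i q (lift ord0 i) x).
  by apply/funext => x; rewrite big_ord_recl.
exact: (integrableD mD (iq ord0) (IH _ (fun i => iq _))).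
Qed.

Lemma Rintegral_sum_le (m : nat) (q : 'I_m -> T -> R) (Q : R) :
  (forall i, mu.-integrable D (EFin \o q i)) ->
  (forall i, \int[mu]_(x in D) q i x <= Q) ->
  \int[mu]_(x in D) (\sum_i q i x) <= m%:R * Q.
Proof.
elim: m q => [|m IH] q iq qQ.
  have -> : (fun x => \sum_(i < 0) q i x) = cst 0 by apply/funext => x; rewrite big_ord0.
  by rewrite mul0r /Rintegral /= integral0.
have i1 := integrable_sum_fun (fun i => iq (lift ord0 i)).
have -> : (fun x => \sum_i q i x) = (fun x => q ord0 x + \sum_i q (lift ord0 i) x).
  by apply/funext => x; rewrite big_ord_recl.
rewrite (RintegralD mD (iq ord0) i1) -natr1 mulrDl mul1r addrC.
by apply: lerD => //; exact: IH.
Qed.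

Lemma sqr_integral_le (q : T -> R) (c : R) : measurable_fun D q ->
  (\int[mu]_(x in D) ((q x) ^+ 2)%:E <= c%:E)%E ->
  mu.-integrable D (EFin \o (fun x => q x ^+ 2)) /\ \int[mu]_(x in D) (q x ^+ 2) <= c.
Proof.
move=> mq qc.
have iq : mu.-integrable D (EFin \o (fun x => q x ^+ 2)).
  apply/integrableP; split; first exact: measurable_sqr_EFin.
  under eq_integral do rewrite /= ger0_norm ?sqr_ge0 //.
  exact: le_lt_trans qc (ltry _).
split => //; rewrite /Rintegral -lee_fin fineK //.
exact: (integrable_fin_num mD iq).
Qed.

Lemma error_integral_le (m : nat) (q Du : 'I_m -> T -> R) (Q P a b : R) :
  (mu D < +oo)%E -> 0 <= a -> 0 <= b ->
  (forall i, measurable_fun D (q i)) -> (forall i, measurable_fun D (Du i)) ->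
  (forall i, (\int[mu]_(x in D) ((q i x) ^+ 2)%:E <= Q%:E)%E) ->
  (forall i, (\int[mu]_(x in D) ((Du i x) ^+ 2)%:E <= P%:E)%E) ->
  let E := fun x => a * (\sum_i q i x ^+ 2) + b * (\sum_i Du i x ^+ 2 + 1) in
  mu.-integrable D (EFin \o E) /\
  \int[mu]_(x in D) E x <= a * (m%:R * Q) + b * (m%:R * P + fine (mu D)).
Proof.
move=> finD a0 b0 mq mDu hq hDu E.
have iq := integrable_sum_fun (fun i => (sqr_integral_le (mq i) (hq i)).1).
have qQ := Rintegral_sum_le (fun i => (sqr_integral_le (mq i) (hq i)).1)
  (fun i => (sqr_integral_le (mq i) (hq i)).2).
have iD := integrable_sum_fun (fun i => (sqr_integral_le (mDu i) (hDu i)).1).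
have DP := Rintegral_sum_le (fun i => (sqr_integral_le (mDu i) (hDu i)).1)
  (fun i => (sqr_integral_le (mDu i) (hDu i)).2).
have i1 : mu.-integrable D (EFin \o cst (1 : R)).
  by apply: (@bounded_integrable _ 1 finD) => // x _; rewrite normr1.
have iD1 := integrableD mD iD i1.
have jq := integrableZl mD a iq; have jD1 := integrableZl mD b iD1.
split; first exact: (integrableD mD jq jD1).
rewrite (RintegralD mD jq jD1) (RintegralZl a mD iq) (RintegralZl b mD iD1) (RintegralD mD iD i1).
apply: lerD; apply: ler_wpM2l => //.
by apply: lerD => //; rewrite /Rintegral /= integral_cst // mul1e.
Qed.

(** As gamma - 1 < 0, the upper bound [M] on u bounds u^(gamma - 1) from below. The lower bound [m]
    keeps u^(gamma - 1) bounded on the support of [phi], which makes the right-hand integrand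
    integrable. *)
Lemma weak_rhs_ge (f u phi : T -> R) (gamma C0 m M c : R) :
  (mu D < +oo)%E -> 0 < gamma < 1 -> 0 < C0 -> 0 < m ->
  measurable_fun D u -> measurable_fun D phi ->
  mu.-integrable D (EFin \o f) ->
  (forall x, D x -> 0 <= phi x <= c) ->
  (forall x, D x -> phi x != 0 -> m <= u x <= M) ->
  {ae mu, forall x, D x -> C0 <= f x} ->
  gamma * C0 * M `^ (gamma - 1) * \int[mu]_(x in D) phi x <=
  \int[mu]_(x in D) (gamma * f x * u x `^ (gamma - 1) * phi x).
Proof.
move=> finD /andP[g0 g1] C00 m0 mu_ mphi jf phic umM fC0.
have g1' : gamma - 1 < 0 by lra.
have mf : measurable_fun D f by apply/measurable_EFinP; exact: measurable_int jf.
have iphi : mu.-integrable D (EFin \o phi).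
  by apply: (@bounded_integrable _ c finD) => // x Dx; have /andP[? ?] := phic x Dx; rewrite ger0_norm.
have pow_anti (a b : R) : 0 < a -> a <= b -> b `^ (gamma - 1) <= a `^ (gamma - 1).
  move=> a0 ab; have -> : gamma - 1 = - (1 - gamma) by ring.
  rewrite !powRN lef_pV2 ?posrE ?powR_gt0 //; last exact: lt_le_trans ab.
  by rewrite ge0_ler_powR ?nnegrE //; [lra|exact: ltW|exact: le_trans (ltW a0) ab].
rewrite -(RintegralZl _ mD iphi); apply: ae_le_Rintegral.
- exact: (integrableZl mD _ iphi).
- apply: (@ae_le_integrable _ (fun x => gamma * m `^ (gamma - 1) * c * `|f x|)).
  + apply: measurable_funM => //; apply: measurable_funM.
      by apply: measurable_funM => //; exact: measurable_cst.
    exact: (measurableT_comp (measurable_powR (gamma - 1)) mu_).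
  + exact: (integrableZl mD _ (integrable_norm jf)).
  + apply: aeW => x Dx; have /andP[p0 pc] := phic x Dx.
    have [->|pn] := eqVneq (phi x) 0.
      rewrite mulr0 normr0 !mulr_ge0 ?powR_ge0 ?(ltW g0) //; exact: le_trans pc.
    have /andP[mu' _] := umM x Dx pn.
    rewrite !normrM (ger0_norm p0) (gtr0_norm g0) (ger0_norm (powR_ge0 _ _)).
    have -> : gamma * m `^ (gamma - 1) * c * `|f x| = gamma * `|f x| * (m `^ (gamma - 1) * c) by ring.
    rewrite -!mulrA !ler_wpM2l ?(ltW g0) // ler_pM ?powR_ge0 //.
    exact: pow_anti.
- apply: filterS fC0 => x fC Dx; have /andP[p0 pc] := phic x Dx.
  have [->|pn] := eqVneq (phi x) 0; first by rewrite !mulr0.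
  have /andP[mu' uM] := umM x Dx pn.
  rewrite ler_wpM2r // ler_pM ?powR_ge0 ?mulr_ge0 ?(ltW g0) ?(ltW C00) //.
    by rewrite ler_wpM2l ?(ltW g0) // fC.
  exact: pow_anti (lt_le_trans m0 mu') uM.
Qed.

End ae_comparison.

Section compact_support.
Context {R : realType} {n : nat}.
Local Notation mu := (@lebesgue_rV R n).
Local Notation B1 := (@eball R n 0 1).
Implicit Types (K : set 'rV[R]_n) (f g : 'rV[R]_n -> R).

Lemma compact_bounded_fun K f : compact K -> {within K, continuous f} ->
  exists2 c, 0 <= c & forall x, K x -> `|f x| <= c.
Proof.
move=> cK cf; have [->|/set0P K0] := eqVneq K set0; first by exists 0.
have [|c Kc hc] := @compact_EVT_max _ R (fun x => `|f x|) _ K0 cK.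
  by move=> x; exact: (cvg_norm (cf x)).
by exists `|f c| => // x Kx; apply: hc; rewrite inE.
Qed.

Lemma pderiv_near_cst f i x (c : R) : (\forall y \near x, f y = c) -> pderiv i f x = 0.
Proof.
move=> fc; apply: pderivE; apply: (@near_eq_is_derive _ _ _ (cst c)).
by near=> y; rewrite (near fc y).
Unshelve. all: by end_near. Qed.

Lemma pderiv_off_closed K f i x : closed K -> (forall y, ~ K y -> f y = 0) ->
  ~ K x -> pderiv i f x = 0.
Proof.
move=> cK f0 Kx; apply: (@pderiv_near_cst _ _ _ 0).
have : open (~` K) by exact: closed_openC.
rewrite openE => /(_ x Kx); rewrite /interior /=; exact: filterS.
Qed.

Lemma compact_closed_rV K : compact K -> closed K.
Proof. by move=> cK; apply: compact_closed => //; exact: norm_hausdorff. Qed.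

Lemma Rintegral_support (A B : set 'rV[R]_n) f : (forall x, f x != 0 -> A x /\ B x) ->
  \int[mu]_(x in A) f x = \int[mu]_(x in B) f x.
Proof.
move=> fAB; rewrite Rintegral_mkcond [RHS]Rintegral_mkcond; congr Rintegral.
apply/funext => x; rewrite !patchE.
have [->|/fAB[Ax Bx]] := eqVneq (f x) 0; first by rewrite !if_same.
by rewrite !mem_set.
Qed.

Lemma measurable_grad_form K (A : 'rV[R]_n -> 'M[R]_n) (v w : 'rV[R]_n -> 'rV[R]_n) :
  (forall i j, measurable_fun K (fun x => A x i j)) ->
  (forall i, measurable_fun K (fun x => v x ord0 i)) ->
  (forall i, measurable_fun K (fun x => w x ord0 i)) ->
  measurable_fun K (fun x => dot (mxact (A x) (v x)) (w x)).
Proof.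
move=> mA mv mw.
have -> : (fun x => dot (mxact (A x) (v x)) (w x)) =
    (fun x => \sum_i (\sum_j A x i j * v x ord0 j) * w x ord0 i).
  by apply/funext => x; apply: eq_bigr => i _; rewrite mxactE.
apply: measurable_sum => i; apply: measurable_funM; last exact: mw.
by apply: measurable_sum => j; apply: measurable_funM; [exact: mA|exact: mv].
Qed.

Lemma compact_finite K : compact K -> (mu K < +oo)%E.
Proof.
move=> cK; have mK := closed_measurable_rV (compact_closed_rV cK).
have [r r0 Kr] : exists2 r, 0 < r & K `<=` ball (0 : 'rV[R]_n) r.
  have [c c0 hc] : exists2 c, 0 <= c & forall x, K x -> `|(`|x| : R)| <= c.
    apply: (@compact_bounded_fun K (fun x => `|x|)) cK _.
    by apply: continuous_subspaceT => x; exact: norm_continuous.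
  exists (c + 1); first by rewrite ltr_wpDl.
  move=> x /hc; rewrite normr_id -ball_normE /= sub0r normrN => h.
  by rewrite (le_lt_trans h) // ltrDl.
apply: (@le_lt_trans _ _ (mu (ball (0 : 'rV[R]_n) r))).
  by apply: le_measure; rewrite ?inE //; exact/open_measurable_rV/ball_open.
by rewrite lebesgue_rV_ball // ltry.
Qed.

Lemma compact_integrable_rV K f : compact K -> continuous f ->
  mu.-integrable K (EFin \o f).
Proof.
move=> cK cf; have mK := closed_measurable_rV (compact_closed_rV cK).
have [c _ hc] := compact_bounded_fun cK (continuous_subspaceT cf).
apply: (bounded_integrable mK (compact_finite cK) _ hc).
exact/measurable_funTS/continuous_measurable_rV.
Qed.

End compact_support.

(** The error has to be controlled before the approximation w is chosen. So |p|^2 is traded for 2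
    |D|^2 + 2 |D - p|^2, which leaves the fixed weak gradient [D] and the distance [D - p]; [C]
    bounds both coefficients in [energy_grad]. *)
Lemma energy_pointwise_error (R : realType) (n : nat) (lam Lam : R) (B : 'M[R]_n)
    (g g1 g2 h s M C2 He c C : R) (D p e : 'rV[R]_n) :
  0 < lam -> lam <= Lam -> B^T = B ->
  (forall xi, lam * enorm xi ^+ 2 <= dot (mxact B xi) xi <= Lam * enorm xi ^+ 2) ->
  0 <= g <= M -> 0 <= g1 <= 1 -> 0 <= g2 <= C2 -> 0 <= h <= He -> 0 < s ->
  dot e e <= c -> C = (1 + M * C2) * He ^+ 2 + 2 * M * He * (c + 1) ->
  lam / 2 * (g1 ^+ 2 * dot p p * h ^+ 2) - 2 * Lam ^+ 2 / lam * (g ^+ 2 * dot e e)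
  - (Lam / 2 * (s^-1 + 4 * C ^+ 2 * s) * \sum_i (p ord0 i - D ord0 i) ^+ 2
     + Lam / 2 * (4 * C ^+ 2 * s) * (\sum_i D ord0 i ^+ 2 + 1))
  <= dot (mxact B D) (energy_grad g g1 g2 h p e).
Proof.
move=> lam0 lamLam Bs ell /andP[g0 gM] /andP[g10 g11] /andP[g20 g2C] /andP[h0 hH] s0 ec CE.
have M0 : 0 <= M by exact: le_trans gM.
have C20 : 0 <= C2 by exact: le_trans g2C.
have He0 : 0 <= He by exact: le_trans hH.
have c0 : 0 <= c by apply: le_trans ec; exact: dot_ge0.
have c10 : 0 <= c + 1 by rewrite addr_ge0.
have MH : 0 <= 2 * M * He by rewrite mulr_ge0 // mulr_ge0.
have Ca : 0 <= (1 + M * C2) * He ^+ 2 by rewrite mulr_ge0 ?sqr_ge0 // addr_ge0 // mulr_ge0.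
have Cb : 0 <= 2 * M * He * (c + 1) by exact: mulr_ge0.
have C_ge0 : 0 <= C by rewrite CE addr_ge0.
have h2H : h ^+ 2 <= He ^+ 2 by rewrite ler_sqr ?nnegrE.
have GG : dot (energy_grad g g1 g2 h p e) (energy_grad g g1 g2 h p e) <= 2 * C ^+ 2 * (dot p p + 1).
  apply: energy_grad_le => //.
    have gg2 : 0 <= g1 ^+ 2 + g * g2 by rewrite addr_ge0 ?sqr_ge0 ?mulr_ge0.
    rewrite ger0_norm ?mulr_ge0 ?sqr_ge0 //.
    apply: (@le_trans _ _ ((1 + M * C2) * He ^+ 2)); last by rewrite CE lerDl.
    apply: ler_pM; rewrite ?sqr_ge0 //.
    by apply: lerD; [rewrite expr_le1|rewrite ler_pM].
  apply: (@le_trans _ _ ((2 * M * He) ^+ 2 * c)).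
    apply: ler_pM; rewrite ?sqr_ge0 ?dot_ge0 //.
    have l0 : 0 <= 2 * g * g1 * h by rewrite !mulr_ge0.
    rewrite ler_sqr ?nnegrE //.
    apply: ler_pM => //; rewrite ?mulr_ge0 //.
    by rewrite -[leRHS]mulr1 ler_pM ?mulr_ge0 // ler_wpM2l.
  (* Using c <= (c + 1)^2 avoids a square root in the definition of [C]. *)
  apply: (@le_trans _ _ ((2 * M * He * (c + 1)) ^+ 2)).
    rewrite [leRHS]exprMn ler_wpM2l ?sqr_ge0 //; clear -c0; nra.
  by rewrite ler_sqr ?nnegrE // CE lerDr.
apply: le_trans (@energy_pointwise R n B lam Lam Bs ell lam0 lamLam g g1 g2 h s D p e g0 g20 s0).
rewrite lerD2l lerN2.
have -> : \sum_i (p ord0 i - D ord0 i) ^+ 2 = dot (D - p) (D - p).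
  by apply: eq_bigr => i _; rewrite !mxE; ring.
have -> : \sum_i D ord0 i ^+ 2 = dot D D by apply: eq_bigr => i _; rewrite expr2.
have pE : dot p p <= 2 * dot D D + 2 * dot (D - p) (D - p).
  have E : p = D + (-1) *: (D - p) by rewrite scaleN1r opprB addrC subrK.
  rewrite {1 2}E; apply: le_trans (dot_sqrD_le _ _) _.
  by rewrite (dotZl (-1)) dotC (dotZl (-1)) !mulN1r opprK.
move: GG pE (dot_ge0 (D - p)) (dot_ge0 D) (sqr_ge0 C).
move: (dot (D - p) (D - p)) (dot D D) (dot p p) (dot (energy_grad _ _ _ _ _ _) _) (C ^+ 2).
move=> q DD pp G CC GG pE q0 D0 CC0.
have h1 : s * G <= s * (4 * CC * (q + DD + 1)).
  rewrite ler_pM2l //; apply: (le_trans GG).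
  have -> : 4 * CC * (q + DD + 1) = 2 * CC * (2 * q + 2 * DD + 2) by ring.
  rewrite ler_wpM2l ?mulr_ge0 //; clear -pE q0; lra.
have -> : Lam / 2 * (s^-1 + 4 * CC * s) * q + Lam / 2 * (4 * CC * s) * (DD + 1) =
  Lam / 2 * (q / s + s * (4 * CC * (q + DD + 1))) by ring.
rewrite ler_pM2l ?lerD2l // divr_gt0 //; exact: lt_le_trans lamLam.
Qed.

Section solution.
Context {R : realType} {n : nat}.
Local Notation mu := (@lebesgue_rV R n).
Local Notation B1 := (@eball R n 0 1).
Variables (lam Lam gamma C0 : R) (A : 'rV[R]_n -> 'M[R]_n) (f u : 'rV[R]_n -> R)
  (Du : 'rV[R]_n -> 'rV[R]_n).
Hypotheses (lam0 : 0 < lam) (lamLam : lam <= Lam) (g01 : 0 < gamma < 1) (C00 : 0 < C0).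
Hypothesis ellA : elliptic lam Lam A.
Hypothesis jf : mu.-integrable B1 (EFin \o f).
Hypothesis fC0 : {ae mu, forall x, B1 x -> C0 <= f x}.
Hypothesis cu : {within B1, continuous u}.
Hypothesis H1u : H1_with_gradient B1 u Du.
Hypothesis eqn : forall phi, test_function (positivity_set u) phi ->
  \int[mu]_(x in positivity_set u) dot (mxact (A x) (Du x)) (grad phi x)
  + \int[mu]_(x in positivity_set u) (gamma * f x * u x `^ (gamma - 1) * phi x) = 0.

Local Notation U := (positivity_set u).

Lemma positivity_open : open U.
Proof.
rewrite openE => x [Bx ux]; rewrite /interior.
have cx := within_eball_continuous cu Bx.
have : nbhs x B1 by apply: open_nbhs_nbhs; split => //; exact: eball_open.
have : \forall y \near x, 0 < u y.
  exact: (cvgr_gt _ cx).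
by move=> h1 h2; near=> y; split; [near: y|near: y].
Unshelve. all: by end_near. Qed.

Lemma solution_measurable : measurable_fun B1 u.
Proof.
have [/L2_restrictP[mu_ _ _] _ _] := H1u.
exact/(measurable_restrictT _ (eball_measurable 0 1)).
Qed.

Lemma gradient_measurable i : measurable_fun B1 (fun x => Du x ord0 i).
Proof.
have [_ /(_ i)/L2_restrictP[mD _ _] _] := H1u.
exact/(measurable_restrictT _ (eball_measurable 0 1)).
Qed.

Lemma gradient_sqr_integrable i (K : set 'rV[R]_n) : measurable K -> K `<=` B1 ->
  mu.-integrable K (EFin \o (fun x => Du x ord0 i ^+ 2)).
Proof.
move=> mK KB; have [_ /(_ i)/L2_restrictP[_ iD _] _] := H1u.
apply: (integrableS (eball_measurable 0 1)) => //.
apply/(integrable_mkcond _ (eball_measurable 0 1)).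
rewrite (_ : _ \_ _ = EFin \o (fun x => ((fun x => Du x ord0 i) \_ B1) x ^+ 2)) //.
apply/funext => x; rewrite /= !patchE; case: ifP => // _.
by rewrite expr0n.
Qed.

(** The zero-order term is bounded below by [weak_rhs_ge]. Integration moves from {u > 0} to the
    compact [K] because [phi] and its gradient vanish off [K] and off the support of [phi]. *)
Lemma weak_inequality (phi : 'rV[R]_n -> R) (K : set 'rV[R]_n) (M : R) :
  test_function U phi -> (forall x, 0 <= phi x) ->
  compact K -> K `<=` B1 -> (forall x, phi x != 0 -> K x /\ u x <= M) ->
  mu.-integrable K (EFin \o (fun x => dot (mxact (A x) (Du x)) (grad phi x))) /\
  \int[mu]_(x in K) dot (mxact (A x) (Du x)) (grad phi x)
  + gamma * C0 * M `^ (gamma - 1) * \int[mu]_(x in K) phi x <= 0.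
Proof.
move=> tphi phi0 cK KB phiK; have [sphi cS SU] := tphi.
set S := closure _ in cS SU.
have clS : closed S by exact: closed_closure.
have clK := compact_closed_rV cK.
have mK : measurable K by exact: closed_measurable_rV.
have phiS x : ~ S x -> phi x = 0.
  by move=> Sx; apply/eqP/negPn/negP => h; apply: Sx; exact: subset_closure.
have phiK' x : ~ K x -> phi x = 0.
  by move=> Kx; apply/eqP/negPn/negP => /phiK[].
have gradS x : ~ S x -> grad phi x = 0.
  by move=> Sx; apply/rowP => i; rewrite !mxE (pderiv_off_closed _ clS phiS Sx).
have gradK x : ~ K x -> grad phi x = 0.
  by move=> Kx; apply/rowP => i; rewrite !mxE (pderiv_off_closed _ clK phiK' Kx).
have finU : (mu U < +oo)%E.
  apply: le_lt_trans (eball_finite 0 1); apply: le_measure; rewrite ?inE.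
  - exact/open_measurable_rV/positivity_open.
  - exact: eball_measurable.
  - by move=> x [].
have mU : measurable U by exact/open_measurable_rV/positivity_open.
have UB : U `<=` B1 by move=> x [].
have [Aent Asym Aell] := ellA.
set F := fun x => dot (mxact (A x) (Du x)) (grad phi x).
have mdphi i : measurable_fun K (fun x => grad phi x ord0 i).
  rewrite (_ : (fun x => _) = pderiv i phi); last by apply/funext => x; rewrite mxE.
  apply: measurable_funTS.
  exact/continuous_measurable_rV/smooth_continuous/smooth_pderiv.
have mF : measurable_fun K F.
  apply: (measurable_grad_form _ _ mdphi) => [i j|i].
    exact: (measurable_funS (eball_measurable 0 1) KB (Aent i j)).
  exact: (measurable_funS (eball_measurable 0 1) KB (gradient_measurable i)).
have Fae : {ae mu, forall x, K x -> `|F x| <= Lam * (dot (Du x) (Du x) + dot (grad phi x) (grad phi x))}.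
  apply: filterS Aell => x ell Kx.
  by apply: (form_bound (Asym x (KB x Kx)) (ell (KB x Kx)) lam0).
have jF : mu.-integrable K (EFin \o F).
  have iD : mu.-integrable K (EFin \o (fun x => dot (Du x) (Du x))).
    exact: (integrable_sum_fun mK (fun i => gradient_sqr_integrable i mK KB)).
  have ip : mu.-integrable K (EFin \o (fun x => dot (grad phi x) (grad phi x))).
    apply: (integrable_sum_fun mK) => i; apply: (compact_integrable_rV cK).
    have cp : continuous (fun x => grad phi x ord0 i).
      rewrite (_ : (fun x => _) = pderiv i phi); last by apply/funext => x; rewrite mxE.
      exact/smooth_continuous/smooth_pderiv.
    by move=> x; exact: (cvgM (cp x) (cp x)).
  exact: (ae_le_integrable mK mF (integrableZl mK Lam (integrableD mK iD ip)) Fae).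
split => //.
have F0 x : grad phi x = 0 -> F x = 0.
  by move=> h; rewrite /F h dotC -(scale0r 0) dotZl mul0r.
have -> : \int[mu]_(x in K) F x = \int[mu]_(x in U) F x.
  apply: Rintegral_support => x Fx; split.
    by apply: contrapT => h; move/eqP: Fx; apply; exact/F0/gradK.
  by apply: SU; apply: contrapT => h; move/eqP: Fx; apply; exact/F0/gradS.
have -> : \int[mu]_(x in K) phi x = \int[mu]_(x in U) phi x.
  apply: Rintegral_support => x px; split; first by have [] := phiK x px.
  exact/SU/subset_closure.
have := eqn tphi; rewrite -/F => <-; rewrite lerD2l.
have [c c0 hc] : exists2 c, 0 <= c & forall x, K x -> `|phi x| <= c.
  by apply: compact_bounded_fun cK _; apply: continuous_subspaceT; exact: smooth_continuous.
(* [u] is continuous and positive on the compact support of [phi], hence bounded away from 0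
   there. *)
have [m m0 hm] : exists2 m, 0 < m & forall x, S x -> m <= u x.
  have [->|/set0P S0] := eqVneq S set0; first by exists 1.
  have [|y Sy hy] := @compact_EVT_min _ R u _ S0 cS.
    by apply: continuous_subspaceW cu => x /SU[].
  rewrite inE in Sy; exists (u y); first by have [] := SU _ Sy.
  by move=> x Sx; apply: hy; rewrite inE.
apply: (@weak_rhs_ge _ _ _ mu U mU f u phi gamma C0 m M c) => //.
- exact: (measurable_funS (eball_measurable 0 1) UB solution_measurable).
- apply: measurable_funTS; exact/continuous_measurable_rV/smooth_continuous.
- exact: (integrableS (eball_measurable 0 1)).
- move=> x Ux; rewrite phi0 /=; have [->//|/phiK[Kx _]] := eqVneq (phi x) 0.
  exact: le_trans (ler_norm _) (hc x Kx).
- move=> x Ux px; have [_ ->] := phiK x px; rewrite andbT; apply: hm.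
  exact: subset_closure.
- by apply: filterS fC0 => x h /UB.
Qed.

Local Notation e_ i := (delta_mx ord0 i : 'rV[R]_n).

Lemma pderiv_ramp (w : 'rV[R]_n -> R) l t i x : 0 < t -> smooth w ->
  is_derive x (e_ i) (fun y => ramp l t (w y)) (ramp1 l t (w x) * pderiv i w x).
Proof.
move=> t0 sw; apply: is_derive_comp_line; first exact: is_derive_ramp.
exact: smooth_derive.
Qed.

Lemma grad_energy_test (w eta : 'rV[R]_n -> R) l t x : 0 < t -> smooth w -> smooth eta ->
  grad (fun y => ramp l t (w y) * ramp1 l t (w y) * eta y ^+ 2) x =
  energy_grad (ramp l t (w x)) (ramp1 l t (w x)) (ramp2 l t (w x)) (eta x) (grad w x) (grad eta x).
Proof.
move=> t0 sw se; apply/rowP => i; rewrite !mxE.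
have d1 := pderiv_ramp l i x t0 sw.
have d2 : is_derive x (e_ i) (fun y => ramp1 l t (w y)) (ramp2 l t (w x) * pderiv i w x).
  by apply: is_derive_comp_line; [exact: is_derive_ramp1|exact: smooth_derive].
have d3 := smooth_derive i x se.
apply: pderivE.
apply: is_derive_eq (is_deriveM (is_deriveM d1 d2) (is_deriveM d3 d3)) _.
set p := pderiv i w x; set e := pderiv i eta x.
set g := ramp l t (w x); set g1 := ramp1 l t (w x); set g2 := ramp2 l t (w x).
transitivity (g * g1 * (eta x * e + eta x * e) + eta x * eta x * (g * (g2 * p) + g1 * (g1 * p))) => //.
ring.
Qed.

Lemma continuous_dot_grad (w eta : 'rV[R]_n -> R) : smooth w -> smooth eta ->
  continuous (fun x => dot (grad w x) (grad eta x)).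
Proof.
move=> sw se; rewrite (_ : (fun x => _) = (fun x => \sum_i (pderiv i w x * pderiv i eta x))).
  apply: continuous_big => //; first exact: add_continuous.
  by move=> i _; exact: smooth_continuous (smoothM (smooth_pderiv i sw) (smooth_pderiv i se)).
by apply/funext => x; apply: eq_bigr => i _; rewrite !mxE.
Qed.

(** The test function uses w instead of u, hence is smooth; it is supported where w >= l, and there
    u >= l - tau >= l/2. Two parameters are chosen in order: Young's weight [s] makes the error
    carried by [Du] at most tau/2, and then w makes the error in grad w - Du at most tau/2, whose
    coefficient contains 1/s. *)
Lemma energy_inequality (K : set 'rV[R]_n) (eta : 'rV[R]_n -> R) (M l t : R) :
  compact K -> K `<=` B1 -> smooth eta -> (forall x, 0 <= eta x) ->
  (forall x, ~ K x -> eta x = 0) -> 0 < M -> (forall x, K x -> u x <= M) ->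
  0 < l -> 0 < t ->
  forall tau, 0 < tau <= l / 2 -> exists w : 'rV[R]_n -> R, [/\ smooth w,
    (forall x, K x -> `|w x - u x| <= tau) &
    lam / 2 * \int[mu]_(x in K) (ramp1 l t (w x) ^+ 2 * dot (grad w x) (grad w x) * eta x ^+ 2)
    + gamma * C0 * M `^ (gamma - 1) * \int[mu]_(x in K) (ramp l t (w x) * ramp1 l t (w x) * eta x ^+ 2)
    <= 2 * Lam ^+ 2 / lam * \int[mu]_(x in K) (ramp l t (w x) ^+ 2 * dot (grad eta x) (grad eta x)) + tau].
Proof.
move=> cK KB seta eta0 etaK M0 uM l0 t0 tau /andP[tau0 taul].
have clK := compact_closed_rV cK.
have mK : measurable K by exact: closed_measurable_rV.
have finK := compact_finite cK.
have ceta := smooth_continuous seta.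
have Lam0 : 0 < Lam by exact: lt_le_trans lamLam.
have [C2 C20 hC2] := ramp2_bounded l t0 (M + l).
have [He He0 hHe] := compact_bounded_fun cK (continuous_subspaceT ceta).
have [c c0 hc] := compact_bounded_fun cK (continuous_subspaceT (continuous_dot_grad seta seta)).
pose C : R := (1 + M * C2) * He ^+ 2 + 2 * M * He * (c + 1).
have Ca : 0 <= (1 + M * C2) * He ^+ 2 by rewrite mulr_ge0 ?sqr_ge0 // addr_ge0 // mulr_ge0 // ltW.
have Cb : 0 <= 2 * M * He * (c + 1) by rewrite !mulr_ge0 ?(ltW M0) // addr_ge0.
have C_ge0 : 0 <= C by rewrite addr_ge0.
pose P : R := \sum_i fine (\int[mu]_(x in K) ((Du x ord0 i) ^+ 2)%:E)%E.
have DP i : (\int[mu]_(x in K) ((Du x ord0 i) ^+ 2)%:E <= P%:E)%E.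
  rewrite -[leLHS]fineK; last exact: (integrable_fin_num mK (gradient_sqr_integrable i mK KB)).
  rewrite lee_fin /P (bigD1 i) //= lerDl; apply: sumr_ge0 => j _.
  by apply: fine_ge0; apply: integral_ge0 => x _; rewrite lee_fin sqr_ge0.
have P0 : 0 <= P.
  by apply: sumr_ge0 => j _; apply: fine_ge0; apply: integral_ge0 => x _; rewrite lee_fin sqr_ge0.
pose X : R := Lam / 2 * (4 * C ^+ 2) * (n%:R * P + fine (mu K)).
have X0 : 0 <= X.
  rewrite /X mulr_ge0 ?mulr_ge0 ?divr_ge0 ?sqr_ge0 ?(ltW Lam0) // addr_ge0 ?mulr_ge0 //.
  exact: fine_ge0.
(* Chosen so that X s <= tau/2, where [X] bounds the part of the error that survives even if grad w
   = Du. *)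
pose s : R := tau / (2 * (X + 1)).
have s0 : 0 < s by rewrite divr_gt0 // mulr_gt0 // ltr_wpDl.
pose a : R := Lam / 2 * (s^-1 + 4 * C ^+ 2 * s).
have Cq : 0 <= 4 * C ^+ 2 by rewrite mulr_ge0 ?sqr_ge0.
have L2 : 0 <= Lam / 2 by rewrite divr_ge0 // ltW.
have a0 : 0 <= a.
  rewrite /a mulr_ge0 ?divr_ge0 ?(ltW Lam0) // addr_ge0 ?invr_ge0 ?(ltW s0) //.
  exact: mulr_ge0 Cq (ltW s0).
pose b : R := Lam / 2 * (4 * C ^+ 2 * s).
have b0 : 0 <= b by exact: mulr_ge0 L2 (mulr_ge0 Cq (ltW s0)).
(* Accuracy of the approximation: each of the n components of grad w - Du contributes at most a
   tau1, in total at most tau/2. *)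
pose tau1 : R := Num.min tau (tau / (2 * (a * n%:R + 1))).
have an0 : 0 <= a * n%:R by rewrite mulr_ge0.
have tau10 : 0 < tau1 by rewrite lt_min tau0 /= divr_gt0 // mulr_gt0 // ltr_wpDl.
have [w [sw wu wD]] := weak_gradient_approx H1u cu cK KB tau10.
have cw := smooth_continuous sw.
have wu' x : K x -> `|w x - u x| <= tau.
  by move=> Kx; apply: le_trans (wu x Kx) _; rewrite ge_min lexx.
exists w; split => //.
pose phi (x : 'rV[R]_n) : R := ramp l t (w x) * ramp1 l t (w x) * eta x ^+ 2.
have sphi : smooth phi.
  exact: (smoothM (smoothM (smooth_ramp l t sw) (smooth_ramp1 l t sw)) (smoothM seta seta)).
have phi0 x : 0 <= phi x.
  rewrite mulr_ge0 ?sqr_ge0 // mulr_ge0 ?ramp_ge0 //.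
  by have /andP[] := ramp1_01 l t0 (w x).
have phiK x : phi x != 0 -> K x /\ l <= w x.
  move=> px; split.
    by apply: contrapT => /etaK h; move/eqP: px; rewrite /phi h expr0n mulr0.
  by rewrite leNgt; apply/negP => wl; move/eqP: px; rewrite /phi ramp_le0 ?(ltW wl) // !mul0r.
have KU x : K x -> l <= w x -> positivity_set u x.
  move=> Kx lw; split; first exact: KB.
  by have := wu' x Kx; rewrite ler_distlC => /andP[]; move: taul l0 lw; lra.
have tphi : test_function (positivity_set u) phi.
  have cl : closed (K `&` [set x | l <= w x]).
    apply: closedI => //; apply: (@closed_comp _ _ w [set y | l <= y]) => //.
  have sub : closure [set x | phi x != 0] `<=` K `&` [set x | l <= w x].
    by rewrite ((closure_id _).1 cl); apply: closureS => x /phiK.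
  split => //; last by move=> x /sub[Kx lw]; exact: KU.
  apply: (subclosed_compact _ cK); first exact: closed_closure.
  by move=> x /sub[].
have [jF hF] := weak_inequality tphi phi0 cK KB (fun x px => conj (phiK x px).1 (uM x (phiK x px).1)).
have mdw i : measurable_fun K (pderiv i w).
  exact/measurable_funTS/continuous_measurable_rV/smooth_continuous/smooth_pderiv.
have mDu i := measurable_funS (eball_measurable 0 1) KB (gradient_measurable i).
have wD' i : (\int[mu]_(x in K) ((pderiv i w x - Du x ord0 i) ^+ 2)%:E <= tau1%:E)%E := wD i.
have [iE EE] := error_integral_le mK finK a0 b0 (fun i => measurable_funB (mdw i) (mDu i)) mDu wD' DP.
have Etau : a * (n%:R * tau1) + b * (n%:R * P + fine (mu K)) <= tau.
  have -> : b * (n%:R * P + fine (mu K)) = X * s by rewrite /b /X; ring.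
  have half z : 0 <= z -> z * (tau / (2 * (z + 1))) <= tau / 2.
    move=> z0; rewrite mulrA ler_pdivrMr ?mulr_gt0 // ?ltr_wpDl //.
    have -> : tau / 2 * (2 * (z + 1)) = z * tau + tau by field.
    by rewrite lerDl ltW.
  have h1 : X * s <= tau / 2 := half X X0.
  have h2 : a * (n%:R * tau1) <= tau / 2.
    rewrite mulrA; apply: le_trans (half _ an0).
    by rewrite ler_wpM2l // ge_min lexx orbT.
  lra.
have cX : continuous (fun x => ramp1 l t (w x) ^+ 2 * dot (grad w x) (grad w x) * eta x ^+ 2).
  have c1 := smooth_continuous (smooth_ramp1 l t sw); have c2 := continuous_dot_grad sw sw.
  move=> x; exact: (cvgM (cvgM (cvgM (c1 x) (c1 x)) (c2 x)) (cvgM (ceta x) (ceta x))).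
have cY : continuous (fun x => ramp l t (w x) ^+ 2 * dot (grad eta x) (grad eta x)).
  have c1 := smooth_continuous (smooth_ramp l t sw); have c2 := continuous_dot_grad seta seta.
  move=> x; exact: (cvgM (cvgM (c1 x) (c1 x)) (c2 x)).
have iX := compact_integrable_rV cK cX.
have iY := compact_integrable_rV cK cY.
rewrite -(RintegralZl _ mK iX) -(RintegralZl _ mK iY).
apply: (energy_from_pointwise mK jF (integrableZl mK _ iX) (integrableZl mK _ iY) iE _ hF).
  exact: le_trans EE Etau.
have [_ Asym Aell] := ellA.
apply: filterS Aell => x ell Kx; have Bx := KB x Kx.
rewrite (grad_energy_test l x t0 sw seta).
have eH : eta x <= He by apply: le_trans (ler_norm _) (hHe x Kx).
have cc : dot (grad eta x) (grad eta x) <= c by apply: le_trans (ler_norm _) (hc x Kx).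
have wM : w x <= M + l.
  have := wu' x Kx; rewrite ler_distl => /andP[_] /le_trans; apply; apply: lerD; first exact: uM.
  by apply: (le_trans taul); rewrite ler_piMr ?(ltW l0) // invf_le1 // ler1n.
have gM : 0 <= ramp l t (w x) <= M.
  rewrite ramp_ge0 //= (le_trans (ramp_le l t0 (w x))) // ge_max (ltW M0) andbT.
  by rewrite lerBlDr.
have g2C : 0 <= ramp2 l t (w x) <= C2.
  rewrite ramp2_ge0 //=.
  have [w0|w0] := leP 0 (w x); first by apply: hC2; rewrite w0.
  have wl : w x <= l by rewrite (le_trans (ltW w0)) // ltW.
  have wlt : (w x - l) / t <= 0 by rewrite pmulr_lle0 ?invr_gt0 // subr_le0.
  by rewrite /ramp2 !flat_exp_le0 ?mulr0 ?addr0.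
have := @energy_pointwise_error R n lam Lam (A x) _ _ _ (eta x) s M C2 He c C (Du x) (grad w x) (grad eta x)
  lam0 lamLam (Asym x Bx) (ell Bx) gM (ramp1_01 l t0 (w x)) g2C _ s0 cc erefl.
rewrite eta0 eH => /(_ isT); apply: le_trans.
rewrite lerD2l lerN2 le_eqVlt; apply/orP; left; apply/eqP.
by congr (_ * _ + _); apply: eq_bigr => i _; rewrite /= mxE.
Qed.

End solution.

(** * The maximum principle *)

Section plateau.
Context {R : realType} {n : nat}.
Local Notation mu := (@lebesgue_rV R n).
Local Notation e_ i := (delta_mx ord0 i : 'rV[R]_n).
Implicit Types (x y z : 'rV[R]_n).

Lemma smooth_sum (I : Type) (s : seq I) (F : I -> 'rV[R]_n -> R) :
  (forall i, smooth (F i)) -> smooth (fun x => \sum_(i <- s) F i x).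
Proof.
move=> sF; elim: s => [|i s IH].
  by rewrite (_ : (fun x => _) = cst 0); [exact: smooth_cst|apply/funext => x; rewrite big_nil].
rewrite (_ : (fun x => _) = F i \+ (fun x => \sum_(j <- s) F j x)); first exact: smoothD.
by apply/funext => x; rewrite big_cons.
Qed.

Lemma smooth_sqr_dist (y : 'rV[R]_n) : smooth (fun x => dot (x - y) (x - y)).
Proof.
have sc i := smoothD (@smooth_coord R n i) (smooth_cst (- y ord0 i)).
have := smooth_sum (index_enum 'I_n) (fun i => smoothM (sc i) (sc i)).
rewrite (_ : (fun x => _) = (fun x => dot (x - y) (x - y))) //.
by apply/funext => x; apply: eq_bigr => i _; rewrite !mxE.
Qed.

Variables (y : 'rV[R]_n) (a b : R).
Hypothesis ab : a < b.

Let rho x : R := ramp a ((b - a) / 2) (dot (x - y) (x - y)).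

(** A radial cut-off around [y], where [a] and [b] are squared radii: the constant exp(-1) up to
    [a], zero from [b] on. The ramp has width (b - a)/2, so by [ramp_ge] it reaches (b - a)/2 at
    [b]. *)
Definition plateau x : R := flat_exp 1 (1 - 2 / (b - a) * rho x).

Let t0 : 0 < (b - a) / 2. Proof. by rewrite divr_gt0 // subr_gt0. Qed.

Let sarg : smooth (fun x => 1 - 2 / (b - a) * rho x).
Proof.
have := smoothD (smooth_cst 1) (smoothM (smooth_cst (- (2 / (b - a))))
  (smooth_ramp a ((b - a) / 2) (smooth_sqr_dist y))).
rewrite (_ : _ \+ _ = (fun x => 1 - 2 / (b - a) * rho x)) //.
by apply/funext => x; rewrite /= mulNr.
Qed.

Lemma plateau_smooth : smooth plateau.
Proof. exact: smooth_flat_exp sarg. Qed.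

Lemma plateau_ge0 x : 0 <= plateau x.
Proof. exact: flat_exp1_ge0. Qed.

Lemma plateau_eq0 x : b <= dot (x - y) (x - y) -> plateau x = 0.
Proof.
move=> bx; apply: flat_exp_le0; rewrite subr_le0.
have ba : 0 < b - a by rewrite subr_gt0.
have -> : 2 / (b - a) = ((b - a) / 2)^-1 by rewrite invf_div.
rewrite ler_pdivlMl // mulr1; apply: le_trans (ramp_ge a t0 _).
have -> : dot (x - y) (x - y) - a - (b - a) / 2 = (b - a) / 2 + (dot (x - y) (x - y) - b) by field.
by rewrite lerDl subr_ge0.
Qed.

Lemma plateau_cst x : dot (x - y) (x - y) <= a -> plateau x = expR (- 1).
Proof.
move=> xa; rewrite /plateau /rho ramp_le0 // mulr0 subr0.
by rewrite /flat_exp ltr01 hornerC mul1r invr1.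
Qed.

Lemma plateau_grad0 x : dot (x - y) (x - y) <= a -> grad plateau x = 0.
Proof.
move=> xa; apply/rowP => i; rewrite !mxE; apply: pderivE.
have d1 : is_derive x (e_ i) rho 0.
  have := pderiv_ramp a i x t0 (smooth_sqr_dist y).
  by rewrite ramp1_le0 // mul0r.
have d2 : is_derive x (e_ i) (fun x => 1 - 2 / (b - a) * rho x) 0.
  have := is_deriveB (is_derive_cst (1 : R) x (e_ i)) (is_deriveZ (2 / (b - a)) d1).
  by rewrite scaler0 subr0.
have := @is_derive_comp_line _ _ (flat_exp 1) (fun x => 1 - 2 / (b - a) * rho x) x (e_ i) _ _
  (is_derive_flat_exp 1 _) d2.
by rewrite mulr0.
Qed.

End plateau.

Section integral_lower_bound.
Context {R : realType} {n : nat}.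
Local Notation mu := (@lebesgue_rV R n).

Lemma Rintegral_ge_ball (K : set 'rV[R]_n) (h : 'rV[R]_n -> R) (z : 'rV[R]_n) (d a : R) :
  compact K -> continuous h -> 0 < d -> ball z d `<=` K ->
  (forall x, K x -> 0 <= h x) -> (forall x, ball z d x -> a <= h x) ->
  a * (2 * d) ^+ n <= \int[mu]_(x in K) h x.
Proof.
move=> cK ch d0 zK h0 ha.
have mK : measurable K by exact: closed_measurable_rV (compact_closed_rV cK).
have mb : measurable (ball z d) by exact/open_measurable_rV/ball_open.
have iK := compact_integrable_rV cK ch.
have ib := integrableS mK mb zK iK.
have finb : (mu (ball z d) < +oo)%E by rewrite lebesgue_rV_ball // ltry.
have ia : mu.-integrable (ball z d) (EFin \o cst a).
  by apply: (bounded_integrable mb finb (measurable_cst a) (c := `|a|)).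
have -> : a * (2 * d) ^+ n = \int[mu]_(x in ball z d) cst a x.
  rewrite /Rintegral /= integral_cst // -[RHS]/(fine (a%:E * mu (ball z d))%E).
  by rewrite lebesgue_rV_ball.
apply: le_trans (le_Rintegral mb ia ib ha) _.
rewrite /Rintegral fine_le //; [exact: (integrable_fin_num mb ib)|exact: (integrable_fin_num mK iK)|].
apply: (@ge0_subset_integral _ _ _ mu _ _ mb mK _ (measurable_int mu iK) _ zK).
by move=> x Kx; rewrite /= lee_fin h0.
Qed.

End integral_lower_bound.

(** Here [a] is a value of u within [t] of its maximum [M] and [b] the corresponding value of w. The
    two bounds give ramp >= t, and then ramp1 >= 1/8 by [ramp_le_ramp1]. *)
Lemma level_gap (R : realFieldType) (t M l tau a b : R) : 4 * t = M - l -> tau <= t ->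
  M - t <= a -> a <= M -> a - tau <= b -> b <= a + tau -> t <= b - l - t /\ b - l <= 8 * t.
Proof. by move=> *; split; lra. Qed.

Section maximum_principle.
Context {R : realType} {n : nat}.
Local Notation mu := (@lebesgue_rV R n).
Local Notation B1 := (@eball R n 0 1).
Variables (lam Lam gamma C0 : R) (A : 'rV[R]_n -> 'M[R]_n) (f u : 'rV[R]_n -> R)
  (Du : 'rV[R]_n -> 'rV[R]_n).
Hypotheses (lam0 : 0 < lam) (lamLam : lam <= Lam) (g01 : 0 < gamma < 1) (C00 : 0 < C0).
Hypothesis ellA : elliptic lam Lam A.
Hypothesis jf : mu.-integrable B1 (EFin \o f).
Hypothesis fC0 : {ae mu, forall x, B1 x -> C0 <= f x}.
Hypothesis cu : {within B1, continuous u}.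
Hypothesis H1u : H1_with_gradient B1 u Du.
Hypothesis eqn : forall phi, test_function (positivity_set u) phi ->
  \int[mu]_(x in positivity_set u) dot (mxact (A x) (Du x)) (grad phi x)
  + \int[mu]_(x in positivity_set u) (gamma * f x * u x `^ (gamma - 1) * phi x) = 0.

(** If the maximum exceeded [S], one could truncate just below it with a cut-off whose gradient
    vanishes wherever the truncation is nonzero. The right-hand side of the energy inequality would
    then be tau alone, while the zero-order term on the left has a positive lower bound independent
    of tau. *)
Lemma max_principle (y : 'rV[R]_n) (r S : R) : 0 < S ->
  closure (eball y r) `<=` B1 -> (forall x, boundary (eball y r) x -> u x <= S) ->
  forall x, closure (eball y r) x -> u x <= S.
Proof.
move=> S0 VB ubd x0 Vx0; rewrite leNgt; apply/negP => ux0.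
have cV := @closure_eball_compact R n y r.
set V := closure (eball y r) in VB cV Vx0 *.
have cuV : {within V, continuous u} by exact: continuous_subspaceW VB cu.
have [z Vz zmax] : exists2 z, V z & forall x, V x -> u x <= u z.
  have [|z Vz hz] := @compact_EVT_max _ R u V _ cV cuV; first by exists x0.
  by rewrite inE in Vz; exists z => // x Vx; apply: hz; rewrite inE.
have zS : S < u z by exact: lt_le_trans ux0 (zmax x0 Vx0).
set M := u z in zmax zS.
(* Levels S < S1 < l < M: truncation takes place at [l], the gap l - S1 absorbs the distance from w
   to u, and t = (M - l)/4 leaves room for the ramp near the maximum point. *)
pose l : R := (S + M) / 2; pose t : R := (M - l) / 4.
have [Sl lM] : S < l /\ l < M by rewrite /l; split; lra.
have t0 : 0 < t by rewrite divr_gt0 // subr_gt0.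
have tE : 4 * t = M - l by rewrite /t; field.
have inV x : V x -> S < u x -> eball y r x.
  move=> Vx Sx; apply: contrapT => nx.
  have : boundary (eball y r) x by split => // /interior_subset.
  by move/ubd; rewrite leNgt Sx.
pose S1 : R := (S + l) / 2.
have [SS1 S1l] : S < S1 /\ S1 < l by rewrite /S1; split; lra.
(* Since u <= S < S1 on the boundary, this compact set lies in the open ball. Its largest distance
   r1 from [y] is below r, so a cut-off can be constant on it and vanish from r2 < r on. *)
pose G := V `&` [set x | S1 <= u x].
have cG : compact G.
  apply: (subclosed_compact _ cV) => [|x []//].
  rewrite -openC openE => x Gx; rewrite /interior.
  have [Vx|Vx] := pselect (V x).
    have ux : u x < S1 by rewrite ltNge; apply/negP => h; exact: Gx.
    have h : \forall w \near x, u w < S1.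
      by apply: (cvgr_lt _ (within_eball_continuous cu (VB x Vx))).
    by apply: filterS h => w uw [_ /=]; rewrite leNgt uw.
  have : open (~` V) by exact/closed_openC/closed_closure.
  by rewrite openE => /(_ x Vx); apply: filterS => w Vw [].
have Gz : G z by split => //; exact: ltW (lt_trans S1l lM).
have [c Gc hc] := @compact_EVT_max _ R (fun x : 'rV[R]_n => enorm (x - y)) G (ex_intro _ z Gz) cG
  (continuous_subspaceT (@continuous_enorm R n y)).
rewrite inE in Gc.
have cr : enorm (c - y) < r by apply: inV; [case: Gc|case: Gc => _ /=; lra].
set r1 := enorm (c - y) in hc cr.
have r10 : 0 <= r1 by exact: enorm_ge0.
pose r2 : R := (r1 + r) / 2.
have [r12 r2r] : r1 < r2 /\ r2 < r by rewrite /r2; split; lra.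
have ab : r1 ^+ 2 < r2 ^+ 2 by rewrite ltr_sqr ?nnegrE //; lra.
have nsq (x : 'rV[R]_n) s : 0 <= s -> (s ^+ 2 <= dot (x - y) (x - y)) = (s <= enorm (x - y)).
  by move=> s0; rewrite -enorm_sqr ler_sqr ?nnegrE // enorm_ge0.
have nsq' (x : 'rV[R]_n) s : 0 <= s -> (dot (x - y) (x - y) <= s ^+ 2) = (enorm (x - y) <= s).
  by move=> s0; rewrite -enorm_sqr ler_sqr ?nnegrE // enorm_ge0.
pose eta := plateau y (r1 ^+ 2) (r2 ^+ 2).
pose K := closure (eball y r2).
have K2 x : K x -> enorm (x - y) <= r2 by exact: closure_eball.
have KV : K `<=` eball y r by move=> x /K2 h; rewrite /eball /=; lra.
have KV' : K `<=` V by move=> x /KV; exact: subset_closure.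
have KB : K `<=` B1 by move=> x /KV' /VB.
have cK : compact K by exact: closure_eball_compact.
have etaK x : ~ K x -> eta x = 0.
  move=> Kx; apply: plateau_eq0 => //; rewrite nsq; last lra.
  by rewrite leNgt; apply/negP => h; apply: Kx; apply: subset_closure.
have [d d0 hd] : exists2 d, 0 < d & forall x, ball z d x -> K x /\ M - t <= u x.
  have Bz : B1 z by exact: VB.
  have cz := within_eball_continuous cu Bz.
  have h1 : \forall x \near z, M - t < u x by apply: (cvgr_gt _ cz); rewrite gtrBl.
  have h2 : nbhs z (eball y r2).
    apply: open_nbhs_nbhs; split; first exact: eball_open.
    rewrite /eball /=; apply: le_lt_trans r12; apply: hc; rewrite inE.
    exact: Gz.
  have /nbhs_ballP[d /= d0 hd] : \forall x \near z, M - t < u x /\ eball y r2 x.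
    by near=> x; split; near: x.
  exists d => // x /hd[h3 h4]; split; [exact: subset_closure|exact: ltW].
have Gz1 x : ball z d x -> enorm (x - y) <= r1.
  move=> /hd[Kx ux]; apply: hc; rewrite inE; split; first exact: KV'.
  by rewrite /= (le_trans _ ux) //; rewrite /t; lra.
(* Lower bound for the zero-order integral near [z]: ramp >= t, ramp1 >= 1/8, eta = exp(-1), on a
   cube of measure (2 d)^n. *)
pose q : R := t * (1 / 8) * expR (- 1) ^+ 2 * (2 * d) ^+ n.
have q0 : 0 < q.
  have e0 : 0 < expR (- 1) ^+ 2 :> R by rewrite exprn_gt0 // expR_gt0.
  have d2 : 0 < (2 * d) ^+ n by rewrite exprn_gt0 // mulr_gt0.
  have t8 : 0 < t * (1 / 8) by rewrite mulr_gt0 // divr_gt0.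
  exact: mulr_gt0 (mulr_gt0 t8 e0) d2.
pose c0 : R := gamma * C0 * M `^ (gamma - 1).
have M0 : 0 < M by lra.
have c00 : 0 < c0.
  by case/andP: g01 => g0 _; rewrite /c0 !mulr_gt0 // powR_gt0.
(* The four entries serve, in order, [level_gap], the hypothesis of [energy_inequality], the
   vanishing of the ramp of w off [G], and the final contradiction with c0 q. *)
pose tau : R := Num.min (Num.min t (l / 2)) (Num.min (l - S1) (c0 * q / 2)).
have l0 : 0 < l by lra.
have tau0 : 0 < tau.
  have a1 : 0 < l / 2 by rewrite divr_gt0.
  have a2 : 0 < l - S1 by rewrite subr_gt0.
  have a3 : 0 < c0 * q / 2 by rewrite divr_gt0 // mulr_gt0.
  by rewrite !lt_min t0 a1 a2 a3.
have [ta tb tc td] : [/\ tau <= t, tau <= l / 2, tau <= l - S1 & tau <= c0 * q / 2].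
  have h : tau <= tau by []. 
  by move: h; rewrite {2}/tau !le_min => /andP[/andP[-> ->] /andP[-> ->]].
have tau0l : 0 < tau <= l / 2 by rewrite tau0.
have [w [sw wu]] := @energy_inequality R n lam Lam gamma C0 A f u Du lam0 lamLam g01 C00 ellA jf fC0 cu H1u
  eqn K eta M l t cK KB (plateau_smooth y (r1 ^+ 2) (r2 ^+ 2)) (plateau_ge0 y _ _) etaK M0
  (fun x Kx => zmax x (KV' x Kx)) l0 t0
  tau tau0l.
(* Within distance r1 of [y] the gradient of eta is zero; beyond it u < S1, hence w <= l and the
   ramp is zero. *)
have -> : \int[mu]_(x in K) (ramp l t (w x) ^+ 2 * dot (grad eta x) (grad eta x)) = 0.
  rewrite (_ : 0 = \int[mu]_(x in K) cst 0 x); last by rewrite /Rintegral /= integral0.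
  apply: eq_Rintegral => x; rewrite inE => Kx /=.
  have [xr|xr] := leP (enorm (x - y)) r1.
    rewrite (_ : grad eta x = 0); last by rewrite /eta plateau_grad0 // nsq'.
    by rewrite [X in _ * X]big1 ?mulr0 // => i _; rewrite mxE mulr0.
  rewrite ramp_le0 ?expr0n ?mul0r //.
  have uS1 : u x < S1.
    rewrite ltNge; apply/negP => h; move: xr; rewrite ltNge; apply/negP/negPn/hc.
    by rewrite inE; split => //; exact: KV'.
  have := wu x Kx; rewrite ler_distl => /andP[_]; lra.
rewrite mulr0 add0r => main.
have X0 : 0 <= \int[mu]_(x in K) (ramp1 l t (w x) ^+ 2 * dot (grad w x) (grad w x) * eta x ^+ 2).
  apply: Rintegral_ge0 => x _.
  exact: mulr_ge0 (mulr_ge0 (sqr_ge0 _) (dot_ge0 _)) (sqr_ge0 _).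
have Y0 : q <= \int[mu]_(x in K) (ramp l t (w x) * ramp1 l t (w x) * eta x ^+ 2).
  apply: (Rintegral_ge_ball cK _ d0) => [||x Kx|x bx].
  - have c1 := smooth_continuous (smooth_ramp l t sw).
    have c2 := smooth_continuous (smooth_ramp1 l t sw).
    have c3 := smooth_continuous (plateau_smooth y (r1 ^+ 2) (r2 ^+ 2)).
    by move=> x; exact: (cvgM (cvgM (c1 x) (c2 x)) (cvgM (c3 x) (c3 x))).
  - by move=> x /hd[].
  - rewrite mulr_ge0 ?sqr_ge0 // mulr_ge0 ?ramp_ge0 //.
    by have /andP[] := ramp1_01 l t0 (w x).
  - have [Kx ux] := hd x bx.
    rewrite (_ : eta x = expR (- 1)); last by rewrite /eta plateau_cst // nsq' // Gz1.
    rewrite ler_wpM2r ?sqr_ge0 //.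
    have := wu x Kx; rewrite ler_distl => /andP[w1 w2].
    have [rt wl] := level_gap tE ta ux (zmax x (KV' x Kx)) w1 w2.
    have {}rt : t <= ramp l t (w x) by exact: le_trans rt (ramp_ge l t0 (w x)).
    apply: ler_pM => //; first exact: ltW.
    have h := ramp_le_ramp1 l t0 (w x).
    have /andP[r0 _] := ramp1_01 l t0 (w x).
    have {h} := le_trans rt (le_trans h (ler_wpM2r r0 wl)).
    rewrite [8 * t]mulrC -mulrA -{1}[t]mulr1 ler_pM2l // => h.
    by rewrite mul1r -[8^-1]mulr1 ler_pdivrMl.
have h1 : 0 <= lam / 2 * \int[mu]_(x in K) (ramp1 l t (w x) ^+ 2 * dot (grad w x) (grad w x) * eta x ^+ 2).
  by rewrite mulr_ge0 // divr_ge0 // ltW.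
have h2 := ler_wpM2l (ltW c00) Y0.
have h3 : 0 < c0 * q by rewrite mulr_gt0.
have : c0 * q <= tau by apply: le_trans h2 (le_trans _ main); rewrite lerDr.
by move/le_trans => /(_ _ td); rewrite leNgt ltr_pdivrMr // ltr_pMr // ltr1n.
Unshelve. all: by end_near. Qed.

End maximum_principle.

(** * Averages of increments *)

Lemma sqr_sum_le (R : realFieldType) (N : nat) (a : 'I_N -> R) :
  (\sum_k a k) ^+ 2 <= N%:R * \sum_k a k ^+ 2.
Proof.
elim: N a => [|N IH] a; first by rewrite !big_ord0 expr0n mul0r.
rewrite !big_ord_recl -natr1; have := IH (fun k => a (lift ord0 k)).
have : 0 <= \sum_(k < N) a (lift ord0 k) ^+ 2 by apply: sumr_ge0 => k _; exact: sqr_ge0.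
move: (a ord0) (\sum_(k < N) a (lift ord0 k)) (\sum_(k < N) _ ^+ 2) => b S T T0 ST.
clear IH a; case: N ST => [|N] ST.
  have S0 : S = 0 by apply/eqP; rewrite -sqrf_eq0 eq_le sqr_ge0 andbT; move: ST; rewrite mul0r.
  by rewrite S0 addr0 add0r mul1r lerDl.
have N0 : 0 < N.+1%:R :> R by rewrite ltr0n.
have h : 2 * (b * S) <= N.+1%:R * b ^+ 2 + T.
  rewrite -(ler_pM2l N0); have := sqr_ge0 (N.+1%:R * b - S).
  have -> : N.+1%:R * (2 * (b * S)) = (N.+1%:R * b) ^+ 2 + S ^+ 2 - (N.+1%:R * b - S) ^+ 2 by ring.
  have -> : N.+1%:R * (N.+1%:R * b ^+ 2 + T) = (N.+1%:R * b) ^+ 2 + N.+1%:R * T by ring.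
  lra.
have -> : (b + S) ^+ 2 = b ^+ 2 + 2 * (b * S) + S ^+ 2 by ring.
lra.
Qed.

Section increments.
Context {R : realType} {n : nat}.
Local Notation mu := (@lebesgue_rV R n).
Local Notation e_ i := (delta_mx ord0 i : 'rV[R]_n).
Implicit Types (x y z h : 'rV[R]_n) (v : 'rV[R]_n -> R).

Definition ccube z (s : R) : set 'rV[R]_n := [set x | `|x - z| <= s].

Lemma ccube_compact z s : compact (ccube z s).
Proof. exact: closed_ball_compact. Qed.

Lemma ccube_measurable z s : measurable (ccube z s).
Proof. exact: closed_measurable_rV (compact_closed_rV (@ccube_compact z s)). Qed.

(** Crude factor: the closed cube lies in the open cube of twice the radius, whose measure is
    known. *)
Lemma ccube_measure_le z s : 0 < s -> (mu (ccube z s) <= ((4 * s) ^+ n)%:E)%E.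
Proof.
move=> s0; have -> : 4 * s = 2 * (2 * s) by ring.
rewrite -(@lebesgue_rV_ball R n z) ?mulr_gt0 //; apply: le_measure; rewrite ?inE.
- exact: ccube_measurable.
- exact/open_measurable_rV/ball_open.
- move=> x; rewrite /ccube /= -ball_normE /= distrC => h.
  by rewrite (le_lt_trans h) // mulrDl mul1r ltrDl.
Qed.

Lemma ccubeS z a b : a <= b -> ccube z a `<=` ccube z b.
Proof. by move=> ab x h; exact: le_trans h ab. Qed.

Lemma line_mvt v i x (k e : R) : smooth v ->
  (forall t, `|t| <= `|k| -> `|pderiv i v (t *: e_ i + x)| <= e) ->
  `|v (k *: e_ i + x) - v x| <= `|k| * e.
Proof.
move=> sv hv.
have dl t := is_derive_along x t (fun y => smooth_derive i y sv).
have cl : continuous (fun t : R => v (t *: e_ i + x)).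
  move=> t; apply/differentiable_continuous/derivable1_diffP.
  by have [] := dl t.
have [k0|k0] := leP 0 k.
  have [c /andP[c0 ck] E] := @MVT_segment _ _ _ 0 k k0 (fun t _ => dl t) (continuous_subspaceT cl).
  rewrite scale0r add0r subr0 in E; rewrite E normrM mulrC ler_wpM2l // hv //.
  by rewrite !ger0_norm.
have [c /andP[kc c0] E] := @MVT_segment _ _ _ k 0 (ltW k0) (fun t _ => dl t) (continuous_subspaceT cl).
rewrite scale0r add0r sub0r in E; rewrite distrC E normrM mulrC normrN ler_wpM2l // hv //.
by rewrite !ler0_norm ?lerN2 // ltW.
Qed.

(** Go from x to x + k along the coordinate axes. By uniform continuity each partial derivative met
    on the way is within [e] of its value at x. *)
Lemma partial_increment v z a e : smooth v -> 0 < e ->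
  exists2 d, 0 < d & forall x k, ccube z a x -> `|k| < d ->
    `|v (x + k) - v x| <= `|k| * \sum_i (`|pderiv i v x| + e).
Proof.
move=> sv e0.
have [d d0 hd] : exists2 d, 0 < d & forall i x y, ccube z a x -> `|y - x| < d ->
    `|pderiv i v y - pderiv i v x| < e.
  have [i|d d0 hd] := @common_threshold R n (fun i d => forall x y, ccube z a x -> `|y - x| < d ->
      `|pderiv i v y - pderiv i v x| < e).
    have [d d0 hd] := compact_unif_continuous (@ccube_compact z a)
      (fun x _ => @smooth_continuous R n _ (smooth_pderiv i sv) x) e0.
    by exists d => // d' dd' x y Qx yx; apply: hd => //; exact: lt_le_trans yx dd'.
  by exists d => // i; exact: (hd d (lexx d)).
exists d => // x k Qx kd.
(* The point reached once the first [j] coordinates have been moved. *)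
pose p (j : nat) : 'rV[R]_n := x + \row_i (if (i < j)%N then k ord0 i else 0).
have pS (j : 'I_n) : p j.+1 = k ord0 j *: e_ j + p j.
  apply/rowP => i; rewrite !mxE eqxx /= [i == j]eq_sym -val_eqE /= ltnS leq_eqVlt.
  rewrite [(j : nat) == i]eq_sym; have [ij|ij] := eqVneq (i : nat) j.
    by rewrite (val_inj ij) ltnn /= addr0 mulr1 addrC.
  by rewrite /= mulr0 add0r.
have p0 : p 0%N = x by apply/rowP => i; rewrite !mxE /= addr0.
have pn : p n = x + k by apply/rowP => i; rewrite !mxE ltn_ord.
have pnorm j : `|p j - x| <= `|k|.
  rewrite addrC addKr; apply: norm_rV_le => // i; rewrite mxE; case: ifP => _.
    exact: coord_le_norm.
  by rewrite normr0.
have -> : v (x + k) - v x = \sum_(i < n) (v (p i.+1) - v (p i)).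
  rewrite -(big_mkord xpredT (fun j => v (p j.+1) - v (p j))).
  by rewrite (telescope_sumr (fun j => v (p j)) (leq0n n)) pn p0.
apply: le_trans (ler_norm_sum _ _ _) _; rewrite mulr_sumr; apply: ler_sum => i _.
rewrite pS; apply: (@le_trans _ _ (`|k ord0 i| * (`|pderiv i v x| + e))).
  apply: line_mvt => // t tk.
  have : `|pderiv i v (t *: e_ i + p i) - pderiv i v x| < e.
    apply: hd => //; apply: le_lt_trans kd; apply: norm_rV_le => // j.
    rewrite !mxE eqxx /=; have [ji|ji] := eqVneq j i.
      rewrite ji ltnn addr0 mulr1 addrK; apply: le_trans tk _; exact: coord_le_norm.
    rewrite mulr0 add0r addrC addKr; case: ifP => _; first exact: coord_le_norm.
    by rewrite normr0.
  move=> h; have := ler_normD (pderiv i v (t *: e_ i + p i) - pderiv i v x) (pderiv i v x).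
  by rewrite subrK => /le_trans; apply; rewrite addrC lerD2l ltW.
by rewrite ler_wpM2r ?coord_le_norm // addr_ge0 // ltW.
Qed.

Lemma ge0_integral_translate_le (G : 'rV[R]_n -> R) (Q Q' : set 'rV[R]_n) h :
  continuous G -> (forall x, 0 <= G x) -> closed Q -> closed Q' ->
  (forall x, Q x -> Q' (x + h)) ->
  (\int[mu]_(x in Q) (G (x + h))%:E <= \int[mu]_(x in Q') (G x)%:E)%E.
Proof.
move=> cG G0 cQ cQ' QQ'.
have mQ := closed_measurable_rV cQ.
have mQ' : measurable (Q' : set (borel_rV R n)).
  rewrite -[X in measurable X]setCK; apply: measurableC.
  by apply: open_borel; exact: closed_openC.
pose F : borel_rV R n -> \bar R := fun x => ((G x) * \1_Q' x)%:E.
have mF : measurable_fun setT F.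
  apply/measurable_EFinP/measurable_funM; first exact: continuous_borel.
  exact: measurable_indic.
have F0 x : (0 <= F x)%E by rewrite lee_fin mulr_ge0.
rewrite [leRHS]integral_mkcond.
have -> : (\int[mu]_x ((fun x0 => (G x0)%:E) \_ Q') x = \int[mu]_x F x)%E.
  apply: eq_integral => x _; rewrite patchE /F indicE; case: ifP => _; first by rewrite mulr1.
  by rewrite mulr0.
rewrite -(integral_translation h mF F0) integral_mkcond.
have cGh : continuous (fun y : 'rV[R]_n => G (y + h)).
  move=> x; apply: (@cvg_comp _ _ _ (fun y => y + h) G _ (nbhs (x + h))); last exact: cG.
  exact: (cvgD cvg_id (cvg_cst h)).
have mGh : measurable_fun setT ((fun y : 'rV[R]_n => (G (y + h))%:E) \_ Q).
  apply/(measurable_restrictT _ mQ)/measurable_EFinP/measurable_funTS.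
  exact: continuous_measurable_rV.
have mFh : measurable_fun setT (fun x : 'rV[R]_n => F (x + h)).
  exact: (measurableT_comp (measurableT_comp mF (measurable_translation_borel h)) measurable_to_borel).
apply: (ge0_le_integral mu measurableT _ mGh mFh).
  by move=> x _; rewrite patchE; case: ifP => _; rewrite // lee_fin.
move=> x _; rewrite patchE; case: ifPn => [Qx|_]; last exact: F0.
by rewrite inE in Qx; rewrite /F indicE mem_set ?mulr1 //; exact: QQ'.
Qed.

Lemma continuous_shift_rV (G : 'rV[R]_n -> R) h : continuous G -> continuous (fun x => G (x + h)).
Proof.
move=> cG x; apply: (@cvg_comp _ _ _ (fun y => y + h) G _ (nbhs (x + h))); last exact: cG.
exact: (cvgD cvg_id (cvg_cst h)).
Qed.

Lemma continuous_sqr_diff (f g : 'rV[R]_n -> R) : continuous f -> continuous g ->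
  continuous (fun x => (f x - g x) ^+ 2).
Proof.
move=> cf cg; have c : continuous (fun x => f x - g x) by move=> x; exact: (cvgB (cf x) (cg x)).
by move=> x; exact: (cvgM (c x) (c x)).
Qed.

Lemma Rintegral_translate_le (G : 'rV[R]_n -> R) (Q Q' : set 'rV[R]_n) h :
  continuous G -> (forall x, 0 <= G x) -> compact Q -> compact Q' ->
  (forall x, Q x -> Q' (x + h)) ->
  \int[mu]_(x in Q) G (x + h) <= \int[mu]_(x in Q') G x.
Proof.
move=> cG G0 cQ cQ' QQ'.
have clQ := compact_closed_rV cQ; have clQ' := compact_closed_rV cQ'.
have i1 := compact_integrable_rV cQ (@continuous_shift_rV G h cG).
have i2 := compact_integrable_rV cQ' cG.
apply: fine_le; [exact: (integrable_fin_num (closed_measurable_rV clQ) i1)|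
  exact: (integrable_fin_num (closed_measurable_rV clQ') i2)|].
exact: ge0_integral_translate_le.
Qed.

(** Cut the shift into N steps k = h/N so short that [partial_increment] applies. Cauchy-Schwarz
    costs a factor N and the number of steps another one; translation brings every step to the
    larger cube, and N^2 |k|^2 = |h|^2 <= sg^2. *)
Lemma translate_increment_slack v z a sg h e : smooth v -> 0 < sg -> `|h| <= sg -> 0 < e ->
  \int[mu]_(x in ccube z a) ((v (x + h) - v x) ^+ 2) <=
  2 * n%:R * sg ^+ 2 * (\int[mu]_(x in ccube z (a + sg)) dot (grad v x) (grad v x)
    + n%:R * e ^+ 2 * fine (mu (ccube z (a + sg)))).
Proof.
move=> sv sg0 hsg e0.
set Q := ccube z a; set Q' := ccube z (a + sg).
have cQ : compact Q by exact: ccube_compact.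
have cQ' : compact Q' by exact: ccube_compact.
have mQ : measurable Q by exact: ccube_measurable.
have mQ' : measurable Q' by exact: ccube_measurable.
have cv := smooth_continuous sv.
have [d d0 hd] := partial_increment z (a + sg) sv e0.
pose N := (Num.truncn (sg / d)).+1.
have N0 : 0 < N%:R :> R by rewrite ltr0n.
have sN : sg / N%:R < d by rewrite ltr_pdivrMr // mulrC -ltr_pdivrMr // truncnS_gt.
pose k : 'rV[R]_n := N%:R^-1 *: h.
have kE : `|k| = `|h| / N%:R by rewrite normrZ gtr0_norm ?invr_gt0 // mulrC.
have kd : `|k| < d by apply: le_lt_trans sN; rewrite kE ler_pM2r // invr_gt0.
have hk : h = N%:R *: k by rewrite scalerA mulfV ?scale1r // gt_eqF.
pose G (y : 'rV[R]_n) : R := (v (y + k) - v y) ^+ 2.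
have cG : continuous G.
  exact: continuous_sqr_diff (@continuous_shift_rV v k cv) cv.
have G0 y : 0 <= G y by exact: sqr_ge0.
have iGk (j : 'I_N) : mu.-integrable Q (EFin \o (fun x => G (x + j%:R *: k))).
  exact: compact_integrable_rV cQ (@continuous_shift_rV G _ cG).
have hG (j : 'I_N) : \int[mu]_(x in Q) G (x + j%:R *: k) <= \int[mu]_(x in Q') G x.
  apply: Rintegral_translate_le => // x Qx; rewrite /Q' /ccube /= addrAC.
  apply: le_trans (ler_normD _ _) (lerD Qx _); apply: le_trans hsg.
  rewrite normrZ ger0_norm // kE mulrCA ler_piMr // ler_pdivrMr // mul1r ler_nat ltnW //.
have cF : continuous (fun x => (v (x + h) - v x) ^+ 2).
  exact: continuous_sqr_diff (@continuous_shift_rV v h cv) cv.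
have step1 : \int[mu]_(x in Q) ((v (x + h) - v x) ^+ 2) <=
    N%:R * (N%:R * \int[mu]_(x in Q') G x).
  have iS := integrable_sum_fun mQ iGk.
  apply: (@le_trans _ _ (\int[mu]_(x in Q) (N%:R * \sum_(j < N) G (x + j%:R *: k)))).
    apply: le_Rintegral => //; first exact: compact_integrable_rV cF.
      exact: (integrableZl mQ N%:R iS).
    move=> x _; apply: le_trans (sqr_sum_le (fun j : 'I_N => v (x + j%:R *: k + k) - v (x + j%:R *: k))).
    rewrite (_ : \sum_(j < N) _ = v (x + h) - v x) //.
    rewrite -[in RHS](addr0 x) -[in X in _ - v (_ + X)](scale0r k) hk addr0.
    rewrite -(telescope_sumr (fun j => v (x + j%:R *: k)) (leq0n N)) big_mkord.
    by apply: eq_bigr => j _; rewrite -addrA -natr1 scalerDl scale1r.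
  rewrite (RintegralZl _ mQ iS) ler_wpM2l //; exact: Rintegral_sum_le.
apply: (le_trans step1).
have iG := compact_integrable_rV cQ' cG.
have iD := compact_integrable_rV cQ' (continuous_dot_grad sv sv).
have i1 : mu.-integrable Q' (EFin \o cst (n%:R * e ^+ 2)).
  by apply: compact_integrable_rV cQ' _; exact: continuous_constr.
have iDe := integrableD mQ' iD i1.
have -> : n%:R * e ^+ 2 * fine (mu Q') = \int[mu]_(x in Q') cst (n%:R * e ^+ 2) x.
  by rewrite /Rintegral /= integral_cst // fineM // ge0_fin_numE // compact_finite.
rewrite -(RintegralD mQ' iD i1) -(RintegralZl _ mQ' iDe) -(RintegralZl _ mQ' iG).
rewrite -(RintegralZl _ mQ' (integrableZl mQ' N%:R iG)).
apply: le_Rintegral => //; [exact: (integrableZl mQ' _ (integrableZl mQ' N%:R iG))|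
  exact: (integrableZl mQ' _ iDe)|].
move=> x Qx; have := hd x k Qx kd; set S := \sum_i _ => hS.
have S0 : 0 <= S by apply: sumr_ge0 => i _; rewrite addr_ge0 // ltW.
have NG : N%:R * (N%:R * G x) <= (sg * S) ^+ 2.
  rewrite /G mulrA -expr2 -exprMn -[leLHS]real_normK ?num_real // ler_sqr ?nnegrE ?mulr_ge0 ?(ltW sg0) //.
  rewrite normrM (gtr0_norm N0) -ler_pdivlMl // (le_trans hS) // kE.
  by rewrite [leRHS]mulrA ler_wpM2r // mulrC ler_pM2l ?invr_gt0.
apply: (le_trans NG); rewrite exprMn.
have -> : 2 * n%:R * sg ^+ 2 * (dot (grad v x) (grad v x) + cst (n%:R * e ^+ 2) x) =
  sg ^+ 2 * (n%:R * (2 * (dot (grad v x) (grad v x) + n%:R * e ^+ 2))) by rewrite /=; ring.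
rewrite ler_wpM2l ?sqr_ge0 //; apply: (le_trans (sqr_sum_le _)); rewrite ler_wpM2l //.
have -> : n%:R * e ^+ 2 = \sum_(i < n) e ^+ 2 by rewrite sumr_const card_ord mulr_natl.
rewrite mulrDr !mulr_sumr -big_split.
apply: ler_sum => i _ /=; apply: le_trans (sqrD_le2 _ _) _.
by rewrite real_normK ?num_real // mxE -expr2.
Qed.

Lemma translate_increment v z a sg h : smooth v -> 0 < sg -> `|h| <= sg ->
  \int[mu]_(x in ccube z a) ((v (x + h) - v x) ^+ 2) <=
  2 * n%:R * sg ^+ 2 * \int[mu]_(x in ccube z (a + sg)) dot (grad v x) (grad v x).
Proof.
move=> sv sg0 hsg; apply/ler_addgt0Pr => e e0.
pose c : R := 2 * n%:R * sg ^+ 2; pose m := fine (mu (ccube z (a + sg))).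
have c0 : 0 <= c by rewrite /c mulr_ge0 ?sqr_ge0 // mulr_ge0.
have m0 : 0 <= m by exact: fine_ge0.
pose e' : R := Num.min 1 (e / (c * (n%:R * m) + 1)).
have D0 : 0 < c * (n%:R * m) + 1 by rewrite ltr_wpDl // mulr_ge0 // mulr_ge0.
have e'0 : 0 < e' by rewrite lt_min ltr01 divr_gt0.
apply: le_trans (translate_increment_slack z a sv sg0 hsg e'0) _.
rewrite mulrDr lerD2l -/c -/m.
have e'1 : e' <= 1 by rewrite ge_min lexx.
have e'e : e' * (c * (n%:R * m) + 1) <= e by rewrite -ler_pdivlMr // ge_min lexx orbT.
have e2 : e' ^+ 2 <= e' by rewrite expr2 ler_piMl // ltW.
apply: le_trans e'e.
have -> : c * (n%:R * e' ^+ 2 * m) = e' ^+ 2 * (c * (n%:R * m)) by ring.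
have X0 : 0 <= c * (n%:R * m) by rewrite mulr_ge0 // mulr_ge0.
by apply: ler_pM; [exact: sqr_ge0|exact: X0|exact: e2|rewrite lerDl].
Qed.

End increments.

Lemma tonelli_average d (T : measurableType d) (R : realType)
    (m : {sigma_finite_measure set T -> \bar R}) (F : T * T -> R) (c : T -> R)
    (X H : set T) (B : R) :
  measurable X -> measurable H ->
  measurable_fun setT F -> (forall z, 0 <= F z) ->
  measurable_fun setT c -> (forall x, 0 <= c x) ->
  (forall x, X x -> ((c x)%:E <= \int[m]_(h in H) (F (x, h))%:E)%E) ->
  (forall h, H h -> (\int[m]_(x in X) (F (x, h))%:E <= B%:E)%E) ->
  (\int[m]_(x in X) (c x)%:E <= B%:E * m H)%E.
Proof.
move=> mX mH mF F0 mc c0 hc hB.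
pose G (z : T * T) : \bar R := (\1_X z.1 * \1_H z.2 * F z)%:E.
have G0 z : (0 <= G z)%E by rewrite lee_fin !mulr_ge0.
have m1 : measurable_fun setT (fun z : T * T => \1_X z.1 : R).
  exact: (measurableT_comp (measurable_indic mX) measurable_fst).
have m2 : measurable_fun setT (fun z : T * T => \1_H z.2 : R).
  exact: (measurableT_comp (measurable_indic mH) measurable_snd).
have mG : measurable_fun setT G by apply/measurable_EFinP; exact: measurable_funM (measurable_funM m1 m2) mF.
have Gx x : X x -> (\int[m]_(h in H) (F (x, h))%:E = \int[m]_h G (x, h))%E.
  move=> Xx; rewrite integral_mkcond; apply: eq_integral => h _.
  rewrite patchE /G /= [\1_X x]indicE (mem_set Xx) mul1r indicE; case: ifP => _; rewrite ?mul1r ?mul0r //.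
have Gh h : H h -> (\int[m]_(x in X) (F (x, h))%:E = \int[m]_x G (x, h))%E.
  move=> Hh; rewrite integral_mkcond; apply: eq_integral => x _.
  rewrite patchE /G /= [\1_H h]indicE (mem_set Hh) mulr1 indicE; case: ifP => _; rewrite ?mul1r ?mul0r //.
apply: (@le_trans _ _ (\int[m]_x \int[m]_h G (x, h))%E).
  rewrite integral_mkcond; apply: ge0_le_integral.
  - exact: measurableT.
  - by move=> x _; rewrite patchE; case: ifP => _; rewrite // lee_fin.
  - exact/(measurable_restrictT _ mX)/measurable_EFinP/measurable_funTS.
  - exact: (measurable_fun_fubini_tonelli_F (m2 := m) G mG G0).
  - move=> x _; rewrite patchE; case: ifPn => [|_].
      by rewrite inE => Xx; rewrite -Gx //; exact: hc.
    exact: integral_ge0.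
rewrite (fubini_tonelli (m1 := m) (m2 := m) G mG G0).
apply: (@le_trans _ _ (\int[m]_h (B * \1_H h)%:E)%E).
  apply: ge0_le_integral.
  - exact: measurableT.
  - by move=> h _; exact: integral_ge0.
  - exact: (measurable_fun_fubini_tonelli_G (m1 := m) G mG G0).
  - apply/measurable_EFinP/measurable_funM; first exact: measurable_cst.
    exact: measurable_indic.
  - move=> h _; have [Hh|Hh] := pselect (H h).
      by rewrite -Gh // indicE mem_set // mulr1; exact: hB.
    rewrite indicE memNset // mulr0 (_ : (fun x => _) = cst 0%E) ?integral0 //.
    by apply/funext => x; rewrite /G /= [\1_H h]indicE memNset // mulr0 mul0r.
have [HH|HH] := pselect (exists h, H h); last first.
  have -> : H = set0 by apply/seteqP; split => // h Hh; apply: HH; exists h.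
  rewrite measure0 mule0 (_ : (fun h => _) = cst 0%E) ?integral0 //.
  by apply/funext => h; rewrite indic0 mulr0.
have B0 : 0 <= B.
  have [h Hh] := HH; rewrite -lee_fin; apply: le_trans (hB h Hh).
  by apply: integral_ge0 => x _; rewrite lee_fin.
under eq_integral do rewrite EFinM.
rewrite ge0_integralZl_EFin //; last by apply/measurable_EFinP; exact: measurable_indic.
by rewrite integral_indic // setIT.
Qed.

(* Used with c = v(x)^2, F h = (v(x + h) - v(x))^2 and S the indicator function of the
   shifts h with v(x + h) != 0. *)
Lemma half_vanishing_average d (T : measurableType d) (R : realType)
    (m : {measure set T -> \bar R}) (H : set T) (F S : T -> R) (c D : R) :
  measurable H -> measurable_fun setT F -> (forall h, 0 <= F h) ->
  measurable_fun setT S -> (forall h, 0 <= S h) -> 0 <= c ->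
  m H = D%:E -> (\int[m]_h (S h)%:E <= (D / 2)%:E)%E ->
  (forall h, H h -> c <= F h + c * S h) ->
  ((c * (D / 2))%:E <= \int[m]_(h in H) (F h)%:E)%E.
Proof.
move=> mH mF F0 mS S0 c0 mHD SD hc.
have D0 : 0 <= D by rewrite -lee_fin -mHD measure_ge0.
have h1 : ((c * D)%:E <= \int[m]_(h in H) (F h)%:E + (c * (D / 2))%:E)%E.
  apply: (@le_trans _ _ (\int[m]_(h in H) ((F h)%:E + (c * S h)%:E))%E).
    rewrite EFinM -mHD -integral_cst //; apply: ge0_le_integral => //.
    - apply: emeasurable_funD; apply/measurable_EFinP; first exact: measurable_funTS.
      by apply: measurable_funM => //; exact: measurable_funTS.
  rewrite ge0_integralD //; first last.
  - by apply/measurable_EFinP/measurable_funM => //; exact: measurable_funTS.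
  - by move=> h _; rewrite lee_fin mulr_ge0.
  - by apply/measurable_EFinP; exact: measurable_funTS.
  - by move=> h _; rewrite lee_fin.
  rewrite leeD2l //.
  under eq_integral do rewrite EFinM.
  rewrite ge0_integralZl_EFin //; last first.
  - by apply/measurable_EFinP; exact: measurable_funTS.
  - by move=> h _; rewrite lee_fin.
  rewrite EFinM lee_wpmul2l ?lee_fin //; apply: le_trans SD.
  apply: ge0_subset_integral => //; first exact/measurable_EFinP.
  by move=> h _; rewrite lee_fin.
have E : c * D = c * (D / 2) + c * (D / 2) by field.
by rewrite E EFinD leeD2rE in h1.
Qed.

Section vanishing_average.
Context {R : realType} {n : nat}.
Local Notation mu := (@lebesgue_rV R n).

Lemma measurable_add_rV (d : measure_display) (T : measurableType d)
    (f g : T -> 'rV[R]_n) :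
  measurable_fun setT f -> measurable_fun setT g ->
  measurable_fun setT (fun t => f t + g t : borel_rV R n).
Proof.
move=> mf mg; apply: measurable_fun_borel_rV => i.
rewrite (_ : (fun t => _) = (fun t => f t ord0 i + g t ord0 i)).
  apply: measurable_funD.
    exact: (measurableT_comp (measurable_coord i) mf).
  exact: (measurableT_comp (measurable_coord i) mg).
by apply/funext => t; rewrite !mxE.
Qed.

(** For x in the inner cube all points x + h with |h| < sg stay in the larger one, where v is
    nonzero on at most half the measure of the cube of shifts. So for at least half of the shifts
    v(x)^2 is the squared increment itself, and averaging over all shifts loses a factor 2. *)
Lemma vanishing_average (v : 'rV[R]_n -> R) (z : 'rV[R]_n) (a sg B : R) :
  continuous v -> 0 < sg ->
  (mu (ccube z (a + sg) `&` [set y | (v y != 0)%R]) <= ((2 * sg) ^+ n / 2)%:E)%E ->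
  (forall h, `|h| <= sg -> \int[mu]_(x in ccube z a) ((v (x + h) - v x) ^+ 2) <= B) ->
  \int[mu]_(x in ccube z a) (v x ^+ 2) <= 2 * B.
Proof.
move=> cv sg0 small hB.
pose H := ball (0 : 'rV[R]_n) sg.
have mH : measurable H by exact/open_measurable_rV/ball_open.
have muH : mu H = ((2 * sg) ^+ n)%:E by exact: lebesgue_rV_ball.
have s0 : 0 < (2 * sg) ^+ n by rewrite exprn_gt0 // mulr_gt0.
set s := (2 * sg) ^+ n in small muH s0.
pose S := ccube z (a + sg) `&` [set y | v y != 0].
have mvb : measurable_fun [set: borel_rV R n] v by exact: continuous_borel.
have mSb : measurable (S : set (borel_rV R n)).
  apply: measurableI.
    rewrite -[X in measurable X]setCK; apply: measurableC; apply: open_borel.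
    exact: closed_openC (compact_closed_rV (@ccube_compact _ _ z (a + sg))).
  apply: open_borel; rewrite (_ : [set y | _] = v @^-1` [set t | t != 0]) //.
  by apply: open_comp => [y _|]; [exact: cv|exact: open_neq].
have mF : measurable_fun setT (fun p : 'rV[R]_n * 'rV[R]_n => (v (p.1 + p.2) - v p.1) ^+ 2).
  apply/measurable_funX/measurable_funB.
    exact: (measurableT_comp mvb (measurable_add_rV measurable_fst measurable_snd)).
  exact: (measurableT_comp (continuous_measurable_rV cv) measurable_fst).
have cF h : continuous (fun x : 'rV[R]_n => (v (x + h) - v x) ^+ 2).
  exact: continuous_sqr_diff (@continuous_shift_rV _ _ v h cv) cv.
have cv2 : continuous (fun x : 'rV[R]_n => v x ^+ 2) by move=> x; exact: (cvgM (cv x) (cv x)).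
have mS1 : measurable_fun [set: borel_rV R n] (fun y => (\1_S y : R)%:E).
  by apply/measurable_EFinP; exact: measurable_indic.
have main : (\int[mu]_(x in ccube z a) (v x ^+ 2 * (s / 2))%:E <= B%:E * mu H)%E.
  have mc : measurable_fun setT (fun x : 'rV[R]_n => v x ^+ 2 * (s / 2)).
    by apply: measurable_funM; [exact: continuous_measurable_rV|exact: measurable_cst].
  apply: (@tonelli_average _ _ R mu _ _ _ _ B (ccube_measurable z a) mH mF _ mc).
  - by move=> p; exact: sqr_ge0.
  - by move=> x; rewrite mulr_ge0 ?sqr_ge0 // divr_ge0 // ltW.
  - move=> x Qx.
    have mFx : measurable_fun setT (fun h : 'rV[R]_n => (v (x + h) - v x) ^+ 2).
      exact: (measurableT_comp mF (measurable_pair1 x)).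
    have mSx : measurable_fun setT (fun h : 'rV[R]_n => \1_S (h + x) : R).
      have := measurableT_comp (measurableT_comp mS1 (measurable_translation_borel x)) measurable_to_borel.
      by move/measurable_EFinP.
    have intS : (\int[mu]_h (\1_S (h + x) : R)%:E <= (s / 2)%:E)%E.
      rewrite (integral_translation x mS1) => [|y]; last by rewrite lee_fin.
      rewrite (@integral_indic _ _ _ mu setT measurableT S (borel_caratheodory mSb)) setIT.
      exact: small.
    apply: (@half_vanishing_average _ _ _ mu H _ _ _ _ mH mFx (fun h => sqr_ge0 _) mSx _
      (sqr_ge0 _) muH intS).
      by move=> h; rewrite indicE.
    move=> h; rewrite /H -ball_normE /= sub0r normrN => hs.
    have [->|vn] := eqVneq (v (x + h)) 0; first by rewrite sub0r sqrrN lerDl mulr_ge0 ?sqr_ge0.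
    rewrite indicE mem_set ?mulr1 ?lerDr ?sqr_ge0 //; split; last by rewrite /= addrC.
    by rewrite /ccube /= -addrA addrC; apply: le_trans (ler_normD _ _) (lerD Qx (ltW hs)).
  - move=> h; rewrite /H -ball_normE /= sub0r normrN => hs.
    have := hB h (ltW hs); rewrite /Rintegral -lee_fin fineK //.
    apply: (integrable_fin_num (ccube_measurable z a)).
    exact: compact_integrable_rV (@ccube_compact _ _ z a) (cF h).
have iv := compact_integrable_rV (@ccube_compact _ _ z a) cv2.
have E : (\int[mu]_(x in ccube z a) (v x ^+ 2 * (s / 2))%:E =
    (\int[mu]_(x in ccube z a) (v x ^+ 2) * (s / 2))%:E)%E.
  rewrite /Rintegral EFinM fineK; last exact: (integrable_fin_num (ccube_measurable z a) iv).
  by rewrite muleC -(integralZl (ccube_measurable z a) iv); apply: eq_integral => x _; rewrite mulrC EFinM.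
move: main; rewrite E muH -EFinM lee_fin.
by rewrite mulrA ler_pdivrMr // mulrAC [_ * s]mulrC [B * 2 * s]mulrC ler_pM2l // mulrC.
Qed.

End vanishing_average.

(** * Decay of the excess over shrinking cubes *)

Section cube_bump_gradient.
Context {R : realType} {n : nat}.
Local Notation e_ i := (delta_mx ord0 i : 'rV[R]_n).

(** In one partial derivative the other factors are at most 1, and the differentiated one is nonzero
    only for |y| <= 1, where it is at most 2 C1 / s. The added 1 makes the constant positive. *)
Lemma cube_bump_grad : exists2 C : R, 0 < C & forall (z : 'rV[R]_n) (s : R) (x : 'rV[R]_n),
  0 < s -> dot (grad (cube_bump z s) x) (grad (cube_bump z s) x) <= C / s ^+ 2.
Proof.
have [C1 C10 h1] := @flat_exp_le_sqr R 'X^2.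
exists (n%:R * (2 * C1) ^+ 2 + 1); first by rewrite ltr_wpDl // mulr_ge0 ?sqr_ge0.
move=> z s x s0.
have bnd i : `|pderiv i (cube_bump z s) x| <= 2 * C1 / s.
  pose P := \prod_(j < n | j != i) flat_exp 1 (1 - ((x ord0 j - z ord0 j) / s) ^+ 2).
  have P01 : 0 <= P <= 1.
    rewrite prodr_ge0 /=; last by move=> j _; exact: flat_exp1_ge0.
    by apply: prodr_ile1 => j _; rewrite flat_exp1_ge0 flat_exp1_le1.
  pose q (h : R) : R := (h + (x ord0 i - z ord0 i)) / s.
  have dq (h : R) : is_derive h 1 (fun h => 1 - q h ^+ 2) (- (2 * q h / s)).
    have d1 : is_derive h 1 q s^-1.
      rewrite (_ : q = (fun h => s^-1 * h + ((x ord0 i - z ord0 i) / s))); last first.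
        by apply/funext => k; rewrite /q; ring.
      apply: is_derive_eq (is_deriveD (is_deriveZ s^-1 (is_derive_id _ _)) (is_derive_cst _ _ _)) _.
      by rewrite addr0 /GRing.scale /= mulr1.
    rewrite (_ : (fun h => _) = cst 1 \- (q * q)); last first.
      by apply/funext => k; rewrite /= expr2.
    apply: is_derive_eq (is_deriveB (is_derive_cst _ _ _) (is_deriveM d1 d1)) _.
    by rewrite sub0r /GRing.scale /=; congr (- _); ring.
  set y := q 0.
  have dl : is_derive x (e_ i) (cube_bump z s) (P * (flat_exp 'X^2 (1 - y ^+ 2) * (- (2 * y / s)))).
    apply/is_derive_line.
    have -> : (fun h : R => cube_bump z s (h *: e_ i + x)) = (fun h => P * flat_exp 1 (1 - q h ^+ 2)).
      apply/funext => h; rewrite /cube_bump (bigD1 i) //= mulrC; congr (_ * _).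
        by apply: eq_bigr => j ji; rewrite !mxE eqxx /= (negPf ji) mulr0 add0r.
      by rewrite !mxE !eqxx mulr1 /q addrA.
    have f1 : flat_deriv 1 = 'X^2 :> {poly R}.
      by rewrite /flat_deriv -polyC1 derivC subr0 polyC1 mulr1.
    have d2 : is_derive (0 : R) 1 (fun h => flat_exp 1 (1 - q h ^+ 2))
        (flat_exp 'X^2 (1 - y ^+ 2) * (- (2 * y / s))).
      rewrite -f1; apply: (@is_derive1_comp _ (flat_exp 1) (fun h => 1 - q h ^+ 2)).
        exact: is_derive_flat_exp.
    exact: (is_deriveZ P d2).
  clearbody y; rewrite (pderivE dl) normrM (ger0_norm (andP P01).1).
  apply: (@le_trans _ _ `|flat_exp 'X^2 (1 - y ^+ 2) * - (2 * y / s)|).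
    by rewrite ler_piMl // (andP P01).2.
  have [y1|y1] := leP 1 (y ^+ 2).
    by rewrite flat_exp_le0 ?subr_le0 // mul0r normr0 divr_ge0 ?mulr_ge0 // ltW.
  have yn : `|y| <= 1.
    rewrite leNgt; apply/negP => h; move: y1; rewrite ltNge -(real_normK (num_real y)).
    by rewrite exprn_ege1 // ltW.
  rewrite normrM normrN !normrM normfV (gtr0_norm s0) (ger0_norm (ler0n _ 2)) !mulrA.
  rewrite ler_pM2r ?invr_gt0 // [2 * C1]mulrC.
  have h2 : `|flat_exp 'X^2 (1 - y ^+ 2)| <= C1.
    apply: le_trans (h1 _) _; rewrite ler_piMr // expr_le1 //.
      by rewrite gerBl sqr_ge0.
    by rewrite subr_ge0 ltW.
  by rewrite -[leRHS]mulr1 ler_pM ?mulr_ge0 // ler_pM2r.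
have -> : (n%:R * (2 * C1) ^+ 2 + 1) / s ^+ 2 = n%:R * (2 * C1 / s) ^+ 2 + (s ^+ 2)^-1.
  by field; rewrite gt_eqF.
apply: ler_wpDr; first by rewrite invr_ge0 sqr_ge0.
apply: (@le_trans _ _ (\sum_(i < n) (2 * C1 / s) ^+ 2));
  last by rewrite sumr_const card_ord [leRHS]mulr_natl lexx.
apply: ler_sum => i _; rewrite mxE -expr2 -(real_normK (num_real (pderiv _ _ _))).
by rewrite ler_sqr ?nnegrE ?bnd // divr_ge0 ?mulr_ge0 // ltW.
Qed.

End cube_bump_gradient.

Lemma le_of_slack (R : realFieldType) (x y C t0 : R) : 0 <= C -> 0 < t0 ->
  (forall t, 0 < t <= t0 -> x <= y + C * t) -> x <= y.
Proof.
move=> C0 t00 h; apply/ler_addgt0Pr => e e0.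
have C1 : 0 < C + 1 by rewrite ltr_wpDl.
have m0 : 0 < Num.min t0 (e / (C + 1)) by rewrite lt_min t00 divr_gt0.
apply: le_trans (h (Num.min t0 (e / (C + 1))) _) _; first by rewrite m0 ge_min lexx.
rewrite lerD2l; apply: (@le_trans _ _ (C * (e / (C + 1)))).
  by rewrite ler_wpM2l // ge_min lexx orbT.
by rewrite mulrA ler_pdivrMr // mulrC ler_pM2l // lerDl.
Qed.

Lemma Rintegral_chebyshev d (T : measurableType d) (R : realType)
    (mu : {measure set T -> \bar R}) (K S : set T) (h : T -> R) (c : R) :
  measurable K -> measurable S -> S `<=` K -> mu.-integrable K (EFin \o h) -> 0 <= c ->
  (forall x, K x -> 0 <= h x) -> (forall x, S x -> c <= h x) ->
  (c%:E * mu S <= (\int[mu]_(x in K) h x)%:E)%E.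
Proof.
move=> mK mS SK ih c0 h0 hc.
rewrite /Rintegral fineK; last exact: (integrable_fin_num mK ih).
rewrite -integral_cst //.
have mh := measurable_int mu ih.
apply: (@le_trans _ _ (\int[mu]_(x in S) (h x)%:E)%E).
  apply: ge0_le_integral => //.
  exact: (measurable_funS mK SK mh).
by apply: ge0_subset_integral => //; move=> x Kx; rewrite lee_fin h0.
Qed.

Section energy_solutions.
Context {R : realType} {n : nat}.
Local Notation mu := (@lebesgue_rV R n).
Local Notation B1 := (@eball R n 0 1).

(** The conclusion of [energy_inequality] as a property of [u] alone. The decay argument and the key
    claim see neither A, f nor Du, so their constants depend only on the remaining data. *)
Definition energy_solution (lam Lam gamma C0 : R) (u : 'rV[R]_n -> R) : Prop :=
  [/\ {within B1, continuous u}, measurable_fun B1 u &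
  forall (K : set 'rV[R]_n) (eta : 'rV[R]_n -> R) (M l t : R),
  compact K -> K `<=` B1 -> smooth eta -> (forall x, 0 <= eta x) ->
  (forall x, ~ K x -> eta x = 0) -> 0 < M -> (forall x, K x -> u x <= M) ->
  0 < l -> 0 < t ->
  forall tau, 0 < tau <= l / 2 -> exists w : 'rV[R]_n -> R, [/\ smooth w,
    (forall x, K x -> `|w x - u x| <= tau) &
    lam / 2 * \int[mu]_(x in K) (ramp1 l t (w x) ^+ 2 * dot (grad w x) (grad w x) * eta x ^+ 2)
    + gamma * C0 * M `^ (gamma - 1) * \int[mu]_(x in K) (ramp l t (w x) * ramp1 l t (w x) * eta x ^+ 2)
    <= 2 * Lam ^+ 2 / lam * \int[mu]_(x in K) (ramp l t (w x) ^+ 2 * dot (grad eta x) (grad eta x)) + tau]].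

Definition excess (u : 'rV[R]_n -> R) z s l : R :=
  \int[mu]_(x in ccube z s) (Num.max (u x - l) 0 ^+ 2).

Variable u : 'rV[R]_n -> R.
Hypothesis cu : {within B1, continuous u}.
Hypothesis mu_ : measurable_fun B1 u.

Lemma excess_integrable z s l : ccube z s `<=` B1 ->
  mu.-integrable (ccube z s) (EFin \o (fun x => Num.max (u x - l) 0 ^+ 2)).
Proof.
move=> KB; have cK := @ccube_compact R n z s; have mK := @ccube_measurable R n z s.
have [c c0 hc] := compact_bounded_fun cK (continuous_subspaceW KB cu).
apply: (@bounded_integrable _ _ _ mu _ mK _ ((c + `|l|) ^+ 2) (compact_finite cK)).
  apply/measurable_funX/measurable_maxr; last exact: measurable_cst.
  apply: measurable_funB; last exact: measurable_cst.
  exact: (measurable_funS (eball_measurable 0 1) KB mu_).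
move=> x Kx; rewrite ger0_norm ?sqr_ge0 //; apply: le_trans (sqr_max0_le _) _.
rewrite -(real_normK (num_real _)) ler_sqr ?nnegrE ?addr_ge0 //.
by apply: le_trans (ler_normB _ _) _; rewrite lerD2r hc.
Qed.

Lemma excess_ge0 z s l : 0 <= excess u z s l.
Proof. by apply: Rintegral_ge0 => x _; rewrite sqr_ge0. Qed.

Lemma excess_anti z s l l' : ccube z s `<=` B1 -> l <= l' -> excess u z s l' <= excess u z s l.
Proof.
move=> KB ll; apply: le_Rintegral (ccube_measurable z s) (excess_integrable l' KB) (excess_integrable l KB) _.
have p0 (a : R) : 0 <= Num.max a 0 by rewrite le_max lexx orbT.
move=> x _; rewrite ler_sqr ?nnegrE ?p0 //.
by rewrite ge_max p0 andbT le_max lerD2l lerN2 ll.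
Qed.

End energy_solutions.

Section level_arithmetic.
Variable R : realFieldType.

(** In this and the next two lemmas [a] is a value of u and [b] one of w. Truncation is at l1,
    halfway between l and l + gap, with ramp width gap/2; an error tau <= gap/4 fits into the
    remaining room. *)
Lemma excess_above_le (l l1 gap tau a b : R) : l1 = l + gap / 2 -> tau <= gap / 4 -> 0 < gap ->
  b <= a + tau -> b - l1 <= a - l.
Proof. by move=> ->; lra. Qed.

Lemma excess_ge_of_level (l l1 gap tau a b : R) : l1 = l + gap / 2 -> tau <= gap / 4 ->
  b <= a + tau -> l1 < b -> gap / 4 <= a - l.
Proof. by move=> ->; lra. Qed.

Lemma excess_le_ramp_bound (l l1 gap t tau a b c : R) : l1 = l + gap / 2 -> t = gap / 2 ->
  a - tau <= b -> b - l1 - t <= c -> a - (l + gap) <= c + tau.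
Proof. by move=> -> ->; lra. Qed.

(** [I] is the excess, [J] the integral of the squared ramp, [G] the gradient energy, [V] the square
    integral on the half cube. Caccioppoli's inequality costs 1/s^2 and the increments gain (ep
    s)^2; what remains is of order ep^2 A0, and all terms with [tau] go to the last summand. *)
Lemma decay_estimate (lam Lam s kap2 ep I m tau N A0 q Ce G J V : R) :
  0 < lam -> 0 < s -> 0 < kap2 -> 0 < ep -> ep <= 1 / 4 -> 0 <= I -> 0 <= m ->
  0 < tau -> tau <= 1 -> 0 <= N -> 0 <= q / 4 ->
  A0 = 16 * N * Lam ^+ 2 * Ce / (lam ^+ 2 * kap2) + 1 -> ep * A0 <= q / 4 ->
  lam / 2 * kap2 * G <= 2 * Lam ^+ 2 / lam * (Ce / s ^+ 2) * J + tau -> J <= I ->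
  0 <= 2 * Lam ^+ 2 / lam * (Ce / s ^+ 2) ->
  V <= 2 * (2 * N * (ep * s) ^+ 2 * G) ->
  2 * V + 2 * tau ^+ 2 * m <= I * q + (2 * (8 * N * (ep * s) ^+ 2 / (lam * kap2)) + 2 * m) * tau.
Proof.
move=> lam0 s0 k0 ep0 ep4 I0 m0 tau0 tau1 N0 q0 AE epA hG JI c0 hV.
have lk : 0 < lam / 2 * kap2 by rewrite mulr_gt0 // divr_gt0.
have hG' : G <= (2 * Lam ^+ 2 / lam * (Ce / s ^+ 2) * I + tau) / (lam / 2 * kap2).
  by rewrite ler_pdivlMr // mulrC (le_trans hG) // lerD2r ler_wpM2l.
have n0 : 0 <= 2 * N * (ep * s) ^+ 2 by rewrite mulr_ge0 ?sqr_ge0 // mulr_ge0.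
have h1 : 2 * V <=
    4 * (2 * N * (ep * s) ^+ 2) * ((2 * Lam ^+ 2 / lam * (Ce / s ^+ 2) * I + tau) / (lam / 2 * kap2)).
  have := ler_wpM2l n0 hG'; lra.
have E : 4 * (2 * N * (ep * s) ^+ 2) * ((2 * Lam ^+ 2 / lam * (Ce / s ^+ 2) * I + tau) / (lam / 2 * kap2)) =
  2 * ep * (ep * (A0 - 1)) * I + 2 * (8 * N * (ep * s) ^+ 2 / (lam * kap2)) * tau.
  by rewrite AE; field; rewrite !gt_eqF.
rewrite E in h1.
have h2 : ep * (A0 - 1) <= q / 4 by apply: le_trans epA; rewrite ler_pM2l // gerBl.
have h3 : 2 * ep * (ep * (A0 - 1)) * I <= q * I.
  apply: ler_wpM2r => //; apply: (@le_trans _ _ (2 * ep * (q / 4)));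
    first by rewrite ler_wpM2l // mulr_ge0 // ltW.
  have := ler_wpM2r q0 ep4; lra.
have h4 : 2 * tau ^+ 2 * m <= 2 * m * tau.
  have -> : 2 * tau ^+ 2 * m = 2 * m * tau * tau by ring.
  by rewrite ler_piMr // mulr_ge0 ?mulr_ge0 // ltW.
lra.
Qed.

End level_arithmetic.

Section decay.
Context {R : realType} {n : nat}.
Local Notation mu := (@lebesgue_rV R n).
Local Notation B1 := (@eball R n 0 1).

Lemma continuous_mulr (f g : 'rV[R]_n -> R) : continuous f -> continuous g ->
  continuous (fun x => f x * g x).
Proof. by move=> cf cg x; exact: (cvgM (cf x) (cg x)). Qed.

Lemma Rintegral_subset_le (K K' : set 'rV[R]_n) (f : 'rV[R]_n -> R) :
  continuous f -> (forall x, 0 <= f x) -> compact K -> compact K' -> K `<=` K' ->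
  \int[mu]_(x in K) f x <= \int[mu]_(x in K') f x.
Proof.
move=> cf f0 cK cK' KK'.
have i1 := compact_integrable_rV cK cf; have i2 := compact_integrable_rV cK' cf.
have m1 := closed_measurable_rV (compact_closed_rV cK).
have m2 := closed_measurable_rV (compact_closed_rV cK').
apply: fine_le; [exact: (integrable_fin_num m1 i1)|exact: (integrable_fin_num m2 i2)|].
apply: (@ge0_subset_integral _ _ _ mu _ _ m1 m2 _ (measurable_int mu i2) _ KK').
by move=> x _; rewrite lee_fin.
Qed.

Lemma grad_ramp (w : 'rV[R]_n -> R) l t x : 0 < t -> smooth w ->
  grad (fun y => ramp l t (w y)) x = ramp1 l t (w x) *: grad w x.
Proof.
by move=> t0 sw; apply/rowP => i; rewrite !mxE; apply/pderivE/pderiv_ramp.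
Qed.

Definition bump_floor : R := expR (- (1 - (3 / 4) ^+ 2)^-1) ^+ n.

Lemma bump_floor_gt0 : 0 < bump_floor.
Proof. by rewrite exprn_gt0 // expR_gt0. Qed.

Lemma cube_bump_floor (z x : 'rV[R]_n) s : 0 < s -> `|x - z| <= s * (3 / 4) -> bump_floor <= cube_bump z s x.
Proof.
move=> s0 xz.
have := @cube_bump_ge R n z s (s * (3 / 4)) x s0 _ xz.
have -> : s * (3 / 4) / s = 3 / 4 by field; rewrite gt_eqF.
apply; apply/andP; split; first by rewrite mulr_ge0 ?ltW.
by rewrite -[ltRHS]mulr1 ltr_pM2l // ltr_pdivrMr // mul1r ltr_nat.
Qed.

(** Both left-hand terms are nonnegative, so each is bounded separately: the gradient term drives
    [decay_step], the zero-order term the key claim. The radius 3s/4 leaves room for shifts of size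
    s/4 from the cube of radius s/2. *)
Lemma energy_cube (lam Lam gamma C0 Ce : R) (u : 'rV[R]_n -> R) (z : 'rV[R]_n) (s M l t tau : R) :
  0 < lam -> 0 <= gamma * C0 ->
  (forall (z : 'rV[R]_n) (s : R) (x : 'rV[R]_n),
    0 < s -> dot (grad (cube_bump z s) x) (grad (cube_bump z s) x) <= Ce / s ^+ 2) ->
  energy_solution lam Lam gamma C0 u ->
  0 < s -> ccube z s `<=` B1 -> 0 < M -> (forall x, ccube z s x -> u x <= M) ->
  0 < l -> 0 < t -> 0 < tau <= l / 2 -> exists w : 'rV[R]_n -> R, [/\ smooth w,
    (forall x, ccube z s x -> `|w x - u x| <= tau),
    lam / 2 * bump_floor ^+ 2 * \int[mu]_(x in ccube z (s * (3 / 4)))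
        dot (grad (fun y => ramp l t (w y)) x) (grad (fun y => ramp l t (w y)) x)
    <= 2 * Lam ^+ 2 / lam * (Ce / s ^+ 2) * \int[mu]_(x in ccube z s) (ramp l t (w x) ^+ 2) + tau &
    gamma * C0 * M `^ (gamma - 1) * bump_floor ^+ 2 *
      \int[mu]_(x in ccube z (s * (3 / 4))) (ramp l t (w x) * ramp1 l t (w x))
    <= 2 * Lam ^+ 2 / lam * (Ce / s ^+ 2) * \int[mu]_(x in ccube z s) (ramp l t (w x) ^+ 2) + tau].
Proof.
move=> lam0 gC0 hCe [_ _ hE] s0 KB M0 uM l0 t0 tau0.
have cK := @ccube_compact R n z s; have mK := @ccube_measurable R n z s.
have seta := @cube_bump_smooth R n z s.
have eta_ge0 := @cube_bump_ge0 R n z s.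
have etaK x : ~ ccube z s x -> cube_bump z s x = 0.
  by move=> /negP; rewrite -ltNge => h; apply: cube_bump_eq0 => //; exact: ltW.
have [w [sw wu main]] := hE _ _ M l t cK KB seta eta_ge0 etaK M0 uM l0 t0 tau tau0.
exists w.
set X := \int[mu]_(x in ccube z s) (ramp1 l t (w x) ^+ 2 * _ * _) in main.
set Y := \int[mu]_(x in ccube z s) (ramp l t (w x) * _ * _) in main.
set Z := \int[mu]_(x in ccube z s) (ramp l t (w x) ^+ 2 * dot _ _) in main.
set J := \int[mu]_(x in ccube z s) (ramp l t (w x) ^+ 2).
have cr := smooth_continuous (smooth_ramp l t sw).
have cr1 := smooth_continuous (smooth_ramp1 l t sw).
have cdw := continuous_dot_grad sw sw.
have ce2 := continuous_mulr (smooth_continuous seta) (smooth_continuous seta).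
have cr2 := continuous_mulr cr cr.
have hZ : Z <= Ce / s ^+ 2 * J.
  rewrite -(RintegralZl _ mK (compact_integrable_rV cK cr2)).
  apply: (le_Rintegral mK (compact_integrable_rV cK (continuous_mulr cr2 (continuous_dot_grad seta seta)))
    (integrableZl mK _ (compact_integrable_rV cK cr2))).
  by move=> x _; rewrite mulrC ler_wpM2r ?sqr_ge0 // hCe.
have X0 : 0 <= X.
  by apply: Rintegral_ge0 => x _; exact: mulr_ge0 (mulr_ge0 (sqr_ge0 _) (dot_ge0 _)) (sqr_ge0 _).
have gg x : 0 <= ramp l t (w x) * ramp1 l t (w x).
  by rewrite mulr_ge0 ?ramp_ge0 //; have /andP[] := ramp1_01 l t0 (w x).
have Y0 : 0 <= Y by apply: Rintegral_ge0 => x _; exact: mulr_ge0 (gg x) (sqr_ge0 _).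
have main' : lam / 2 * X + gamma * C0 * M `^ (gamma - 1) * Y <= 2 * Lam ^+ 2 / lam * (Ce / s ^+ 2) * J + tau.
  apply: le_trans main _; rewrite lerD2r -[leRHS]mulrA ler_wpM2l //.
  exact: divr_ge0 (mulr_ge0 (ler0n _ 2) (sqr_ge0 _)) (ltW lam0).
have cK' := @ccube_compact R n z (s * (3 / 4)); have mK' := @ccube_measurable R n z (s * (3 / 4)).
have KK' : ccube z (s * (3 / 4)) `<=` ccube z s.
  apply: ccubeS; rewrite ler_piMr ?(ltW s0) // ler_pdivrMr // mul1r ler_nat //.
have sub (f : 'rV[R]_n -> R) : continuous f -> (forall x, 0 <= f x) ->
    bump_floor ^+ 2 * \int[mu]_(x in ccube z (s * (3 / 4))) f x <=
    \int[mu]_(x in ccube z s) (f x * cube_bump z s x ^+ 2).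
  move=> cf f0.
  have i1 := compact_integrable_rV cK (continuous_mulr cf ce2).
  have i2 := integrableS mK mK' KK' i1.
  have i3 := compact_integrable_rV cK' cf.
  rewrite -(RintegralZl _ mK' i3).
  apply: (@le_trans _ _ (\int[mu]_(x in ccube z (s * (3 / 4))) (f x * cube_bump z s x ^+ 2))).
    apply: (le_Rintegral mK' (integrableZl mK' _ i3) i2) => x Kx.
    rewrite mulrC ler_wpM2l // ler_sqr ?nnegrE ?(ltW bump_floor_gt0) //.
    exact: cube_bump_floor.
  apply: Rintegral_subset_le (continuous_mulr cf ce2) _ cK' cK KK' => x.
  by rewrite mulr_ge0 ?sqr_ge0.
have hX : bump_floor ^+ 2 * \int[mu]_(x in ccube z (s * (3 / 4)))
    dot (grad (fun y => ramp l t (w y)) x) (grad (fun y => ramp l t (w y)) x) <= X.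
  rewrite (_ : \int[mu]_(x in _) _ =
    \int[mu]_(x in ccube z (s * (3 / 4))) (ramp1 l t (w x) ^+ 2 * dot (grad w x) (grad w x))).
    apply: (sub _ (continuous_mulr (continuous_mulr cr1 cr1) cdw)) => x.
    exact: mulr_ge0 (sqr_ge0 _) (dot_ge0 _).
  apply: eq_Rintegral => x _; rewrite (grad_ramp l x t0 sw) dotZl dotC dotZl mulrA expr2 //.
have hY := sub _ (continuous_mulr cr cr1) gg.
have c0 : 0 <= gamma * C0 * M `^ (gamma - 1) by rewrite mulr_ge0 // powR_ge0.
split => //.
- rewrite -mulrA; apply: le_trans main'.
  apply: (@le_trans _ _ (lam / 2 * X)); first by rewrite ler_wpM2l // divr_ge0 // ltW.
  by rewrite lerDl mulr_ge0.
- rewrite -mulrA; apply: le_trans main'.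
  apply: (@le_trans _ _ (gamma * C0 * M `^ (gamma - 1) * Y)); first by rewrite ler_wpM2l.
  by rewrite lerDr mulr_ge0 // divr_ge0 // ltW.
Qed.

Lemma small_ratio (N : nat) (A : R) : 1 <= A ->
  exists ep : R, [/\ 0 < ep, ep <= 1 / 4 & ep * A <= (2 ^+ N)^-1].
Proof.
move=> A1; have A0 : 0 < A by exact: lt_le_trans A1.
have p1 : 1 <= 2 ^+ N :> R by rewrite exprn_ege1 // ler1n.
move: (2 ^+ N) p1 => p p1; have p0 : 0 < p by exact: lt_le_trans p1.
have d0 : 0 < 4 * p * A by rewrite mulr_gt0 // mulr_gt0.
exists (4 * p * A)^-1; split; first by rewrite invr_gt0.
  rewrite div1r lef_pV2 ?posrE // -mulrA ler_peMr // -[leLHS]mulr1; exact: ler_pM.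
rewrite invfM mulfVK ?gt_eqF // lef_pV2 ?posrE ?mulr_gt0 // ler_peMl ?(ltW p0) // ler1n //.
Qed.

(** Halving s divides (2 s)^n by 2^n and halving gap divides gap^2 by 4, so a gain of 2^(n+2) lets
    the hypothesis reproduce itself with gap/2. Smallness of the excess makes the truncation vanish
    on most of the cube; shifts of size ep s then yield a factor as small as desired. *)
Lemma decay_step (lam Lam : R) : 0 < lam -> lam <= Lam ->
  exists2 delta : R, 0 < delta & forall (gamma C0 : R) (u : 'rV[R]_n -> R),
    0 <= gamma * C0 -> energy_solution lam Lam gamma C0 u ->
    forall (z : 'rV[R]_n) (s l gap : R), 0 < s -> 0 < l -> 0 < gap -> ccube z s `<=` B1 ->
    excess u z s l <= delta * gap ^+ 2 * (2 * s) ^+ n ->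
    excess u z (s / 2) (l + gap) <= excess u z s l / 2 ^+ n.+2.
Proof.
move=> lam0 lamLam.
have [Ce Ce0 hCe] := @cube_bump_grad R n.
have kap0 := bump_floor_gt0; set kap := bump_floor in kap0.
have Lam0 : 0 < Lam by exact: lt_le_trans lamLam.
have kap2 : 0 < kap ^+ 2 by rewrite exprn_gt0.
have [A0 A0E] : exists x : R, x = 16 * n%:R * Lam ^+ 2 * Ce / (lam ^+ 2 * kap ^+ 2) + 1 by eexists.
have A01 : 1 <= A0.
  by rewrite A0E lerDr divr_ge0 ?mulr_ge0 //; exact: ltW.
have A00 : 0 < A0 by exact: lt_le_trans A01.
(* The exponent n + 4 gives ep A0 <= 2^-(n+2) / 4, as [decay_estimate] requires; ep <= 1/4 keeps
   shifted points in the cube of radius 3s/4. *)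
have [ep [ep0 ep4 epA]] := small_ratio n.+4 A01.
(* Where the ramp is nonzero, u - l >= gap/4, so Chebyshev bounds the measure by 16/gap^2 times the
   excess; dividing by 32 makes this half of (2 ep s)^n. *)
exists (ep ^+ n / 32); first by rewrite divr_gt0 // exprn_gt0.
move=> gamma C0 u gC0 hu z s l gap s0 l0 gap0 KB hI.
have [cu mu_ _] := hu.
set I := excess u z s l in hI *.
have cK := @ccube_compact R n z s; have mK := @ccube_measurable R n z s.
have [M1 M10 hM1] := compact_bounded_fun cK (continuous_subspaceW KB cu).
have M0 : 0 < M1 + 1 by rewrite ltr_wpDl.
have uM x : ccube z s x -> u x <= M1 + 1.
  by move=> Kx; apply: le_trans (ler_norm _) (le_trans (hM1 x Kx) _); rewrite lerDl.
have [l1 l1E] : exists x : R, x = l + gap / 2 by eexists.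
have [t tE] : exists x : R, x = gap / 2 by eexists.
have t0 : 0 < t by rewrite tE divr_gt0.
have l10 : 0 < l1 by rewrite l1E addr_gt0 // divr_gt0.
have [sg sgE] : exists x : R, x = ep * s by eexists.
have sg0 : 0 < sg by rewrite sgE mulr_gt0.
have I0 : 0 <= I by exact: excess_ge0.
have ss : s / 2 + sg <= s * (3 / 4).
  have -> : s * (3 / 4) = s / 2 + 1 / 4 * s by field.
  by rewrite sgE lerD2l ler_pM2r.
have KK : ccube z (s / 2 + sg) `<=` ccube z s.
  apply: ccubeS; apply: le_trans ss _; rewrite ler_piMr ?(ltW s0) // ler_pdivrMr // mul1r ler_nat //.
have KK2 : ccube z (s / 2) `<=` ccube z s by apply: ccubeS; rewrite ler_piMr ?(ltW s0) // invf_le1 // ler1n.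
have mu2 : 0 <= fine (mu (ccube z (s / 2))) by exact: fine_ge0.
have [C CE] : exists x : R,
    x = 2 * (8 * n%:R * sg ^+ 2 / (lam * kap ^+ 2)) + 2 * fine (mu (ccube z (s / 2))) by eexists.
have C_ge0 : 0 <= C.
  have h : 0 <= 8 * n%:R * sg ^+ 2 / (lam * kap ^+ 2).
    by rewrite divr_ge0 ?mulr_ge0 //; exact: ltW.
  by rewrite CE addr_ge0 // mulr_ge0.
have [tau0 tau0E] : exists x : R, x = Num.min 1 (Num.min (l1 / 2) (gap / 4)) by eexists.
have tau00 : 0 < tau0 by rewrite tau0E !lt_min ltr01 !divr_gt0.
(* The claim does not mention w, so it may be proved up to [C] tau for all small tau, with [C] fixed
   beforehand. *)
apply: (le_of_slack C_ge0 tau00) => tau /andP[tau_gt0].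
rewrite tau0E !le_min => /and3P[tau1 taul taug].
have taul' : 0 < tau <= l1 / 2 by rewrite tau_gt0.
have [w [sw wu hG _]] := energy_cube lam0 gC0 hCe hu s0 KB M0 uM l10 t0 taul'.
pose v x : R := ramp l1 t (w x).
have sv : smooth v by exact: smooth_ramp.
have cv := smooth_continuous sv.
have v_ge0 x : 0 <= v x by exact: ramp_ge0.
have wu1 x : ccube z s x -> u x - tau <= w x <= u x + tau by move/wu; rewrite ler_distl.
have max0 (a : R) : 0 <= Num.max a 0 by rewrite le_max lexx orbT.
have va x : ccube z s x -> v x <= Num.max (u x - l) 0.
  move=> Kx; apply: le_trans (ramp_le l1 t0 (w x)) _; rewrite ge_max max0 andbT le_max; apply/orP; left.
  have /andP[_ h] := wu1 x Kx; exact: (excess_above_le l1E taug gap0 h).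
have J_le : \int[mu]_(x in ccube z s) (v x ^+ 2) <= I.
  apply: (le_Rintegral mK (compact_integrable_rV cK (continuous_mulr cv cv)) (excess_integrable cu mu_ l KB)).
  by move=> x Kx; rewrite ler_sqr ?nnegrE // va.
have small : (mu (ccube z (s / 2 + sg) `&` [set y | (v y != 0)%R]) <= ((2 * sg) ^+ n / 2)%:E)%E.
  set S := _ `&` _.
  have mS : measurable S.
    apply: measurableI; first exact: ccube_measurable.
    apply: open_measurable_rV; rewrite (_ : [set y | _] = v @^-1` [set t | t != 0]) //.
    by apply: open_comp => [y _|]; [exact: cv|exact: open_neq].
  have g16 : 0 < gap ^+ 2 / 16 by rewrite divr_gt0 // exprn_gt0.
  have hS x : S x -> gap ^+ 2 / 16 <= Num.max (u x - l) 0 ^+ 2.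
    move=> [Kx /= vx]; have /andP[_ h] := wu1 x (KK x Kx).
    have lw : l1 < w x.
      by rewrite ltNge; apply/negP => h'; move/eqP: vx; rewrite /v ramp_le0.
    have -> : gap ^+ 2 / 16 = (gap / 4) ^+ 2 by field.
    rewrite ler_sqr ?nnegrE ?max0 ?divr_ge0 ?(ltW gap0) // le_max; apply/orP; left.
    exact: (excess_ge_of_level l1E taug h lw).
  have SK : S `<=` ccube z s by move=> x [/KK].
  have := Rintegral_chebyshev mK mS SK (excess_integrable cu mu_ l KB) (ltW g16)
    (fun x _ => sqr_ge0 _) hS.
  rewrite -/(excess u z s l) -/I muleC -lee_pdivlMr // => /le_trans; apply.
  rewrite -EFinM lee_fin ler_pdivrMr //; apply: (le_trans hI).
  rewrite sgE (_ : 2 * (ep * s) = ep * (2 * s)); last by ring.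
  rewrite [in leRHS](exprMn n ep) le_eqVlt; apply/orP; left; apply/eqP; by field.
have cdv := continuous_dot_grad sv sv.
have G_ge0 (K : set 'rV[R]_n) : 0 <= \int[mu]_(x in K) dot (grad v x) (grad v x).
  by apply: Rintegral_ge0 => x _; exact: dot_ge0.
set G := \int[mu]_(x in ccube z (s * (3 / 4))) _ in hG.
have hB h : `|h| <= sg -> \int[mu]_(x in ccube z (s / 2)) ((v (x + h) - v x) ^+ 2) <= 2 * n%:R * sg ^+ 2 * G.
  move=> hs; apply: le_trans (translate_increment z (s / 2) sv sg0 hs) _.
  apply: ler_wpM2l; first exact: mulr_ge0 (mulr_ge0 (ler0n _ 2) (ler0n _ n)) (sqr_ge0 _).
  apply: Rintegral_subset_le cdv (fun x => dot_ge0 _) _ _ (ccubeS ss); exact: ccube_compact.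
have vanish := vanishing_average cv sg0 small hB.
have m2 := @ccube_measurable R n z (s / 2); have c2 := @ccube_compact R n z (s / 2).
have last_step : excess u z (s / 2) (l + gap) <=
    2 * \int[mu]_(x in ccube z (s / 2)) (v x ^+ 2) + 2 * tau ^+ 2 * fine (mu (ccube z (s / 2))).
  have i1 := excess_integrable cu mu_ (l + gap) (subset_trans KK2 KB).
  have i2 := compact_integrable_rV c2 (continuous_mulr cv cv).
  have i3 : mu.-integrable (ccube z (s / 2)) (EFin \o cst (2 * tau ^+ 2)).
    by apply: compact_integrable_rV c2 _; exact: continuous_constr.
  have -> : 2 * tau ^+ 2 * fine (mu (ccube z (s / 2))) = \int[mu]_(x in ccube z (s / 2)) cst (2 * tau ^+ 2) x.
    by rewrite /Rintegral /= integral_cst // fineM // ge0_fin_numE // compact_finite.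
  rewrite -(RintegralZl 2 m2 i2) -(RintegralD m2 (integrableZl m2 2 i2) i3).
  apply: (le_Rintegral m2 i1 (integrableD m2 (integrableZl m2 2 i2) i3)) => x Kx.
  apply: (@le_trans _ _ ((v x + tau) ^+ 2)); last by rewrite -expr2 /=; exact: sqrD_le2.
  rewrite ler_sqr ?nnegrE ?max0 ?addr_ge0 ?(ltW tau_gt0) // ge_max addr_ge0 ?(ltW tau_gt0) // andbT.
  have /andP[h _] := wu1 x (KK2 x Kx); exact: (excess_le_ramp_bound l1E tE h (ramp_ge l1 t0 (w x))).
apply: (le_trans last_step); rewrite CE sgE.
have q4 : (2 ^+ n.+4 : R)^-1 = (2 ^+ n.+2)^-1 / 4.
  by rewrite 2!exprS -invfM; congr (_^-1); ring.
rewrite q4 in epA; rewrite sgE in vanish.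
have q0 : 0 <= (2 ^+ n.+2)^-1 / 4 :> R by rewrite divr_ge0 // invr_ge0 exprn_ge0.
have c0 : 0 <= 2 * Lam ^+ 2 / lam * (Ce / s ^+ 2).
  by apply: mulr_ge0; apply: divr_ge0; rewrite ?mulr_ge0 ?sqr_ge0 // ltW.
exact: (decay_estimate lam0 s0 kap2 ep0 ep4 I0 mu2 tau_gt0 tau1 (ler0n _ n) q0 A0E epA hG J_le c0 vanish).
Qed.

End decay.

(** * Non-degeneracy *)

(** [Z + 1] will be kappa. The hypotheses give q (Z + 1)^2 P <= 32 K F m D, and P <= delta m D / 256
    is needed: 64 * 128 = 32 * 256, and (Z + 1)^2 >= Z spares a square root. *)
Lemma scaling_estimate (R : realFieldType) (delta q K F m d2 D P Z G : R) :
  0 < delta -> 0 < q -> 0 < K -> 0 < F -> 0 < m -> 0 < d2 -> 0 <= D -> 0 <= P ->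
  Z = 64 * 128 * K * F / (delta * q) -> G * d2 = (Z + 1) ^+ 2 * m ->
  q * G * P <= 2 * (K / d2 * (16 * m ^+ 2 * (F * D))) ->
  4 * m * P <= delta * (m / 8) ^+ 2 * D.
Proof.
move=> delta0 q0 K0 F0 m0 d20 D0 P0 ZE GE h.
have Z0 : 0 < Z by rewrite ZE divr_gt0 // mulr_gt0 // mulr_gt0 // mulr_gt0.
have h1 : q * ((Z + 1) ^+ 2 * m) * P <= 32 * K * F * m ^+ 2 * D.
  have := ler_wpM2r (ltW d20) h.
  have -> : q * G * P * d2 = q * (G * d2) * P by ring.
  have -> : 2 * (K / d2 * (16 * m ^+ 2 * (F * D))) * d2 = 32 * K * F * m ^+ 2 * D.
    by field; rewrite gt_eqF.
  by rewrite GE.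
have h2 : q * (Z * m) * P <= q * ((Z + 1) ^+ 2 * m) * P.
  rewrite ler_wpM2r // ler_pM2l // ler_pM2r //; have := sqr_ge0 Z; rewrite !expr2; lra.
have h3 := le_trans h2 h1.
have KF : 0 < 32 * K * F by rewrite mulr_gt0 // mulr_gt0.
have E : q * (Z * m) * P = 32 * K * F * (64 * (4 * m * P) / delta).
  by rewrite ZE; field; rewrite !gt_eqF.
rewrite E (_ : 32 * K * F * m ^+ 2 * D = 32 * K * F * (m ^+ 2 * D)) in h3; last by ring.
rewrite ler_pM2l // ler_pdivrMr // in h3.
have -> : delta * (m / 8) ^+ 2 * D = m ^+ 2 * D * delta / 64 by field.
by rewrite ler_pdivlMr // mulrC.
Qed.

Lemma three_quarters (R : realFieldType) (d : R) : 0 < d -> d / 2 <= d * (3 / 4) /\ d * (3 / 4) <= d.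
Proof. by move=> d0; split; lra. Qed.

Section key_claim.
Context {R : realType} {n : nat}.
Local Notation mu := (@lebesgue_rV R n).
Local Notation B1 := (@eball R n 0 1).

Lemma pow2_eventually (a b : R) : 0 < a -> 0 < b -> exists j : nat, b / 2 ^+ j < a.
Proof.
move=> a0 b0; exists (Num.truncn (b / a)).+1.
have h : b / a < 2 ^+ (Num.truncn (b / a)).+1.
  by apply: lt_trans (truncnS_gt _) _; rewrite -natrX ltr_nat ltn_expl.
by rewrite ltr_pdivrMr ?exprn_gt0 // mulrC -ltr_pdivrMr.
Qed.

Lemma oscillation_bound (lam Lam : R) : 0 < lam -> lam <= Lam ->
  exists2 delta : R, 0 < delta & forall (gamma C0 : R) (u : 'rV[R]_n -> R),
    0 <= gamma * C0 -> energy_solution lam Lam gamma C0 u ->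
    forall (z : 'rV[R]_n) (s l gap : R), 0 < s -> 0 < l -> 0 < gap -> ccube z s `<=` B1 ->
    excess u z s l <= delta * gap ^+ 2 * (2 * s) ^+ n -> u z <= l + 2 * gap.
Proof.
move=> lam0 lamLam; have [delta d0 step] := @decay_step R n lam Lam lam0 lamLam.
exists delta => // gamma C0 u gC0 hu z s l gap s0 l0 gap0 KB hI.
have [cu mu_ _] := hu.
(* After one step up to l + gap there remains 2 (gap/2) = gap, so all levels stay below l + 2 gap;
   for j = 0, raising the level only lowers the excess. *)
have iter j : forall s l gap, 0 < s -> 0 < l -> 0 < gap -> ccube z s `<=` B1 ->
    excess u z s l <= delta * gap ^+ 2 * (2 * s) ^+ n ->
    excess u z (s / 2 ^+ j) (l + 2 * gap) <= delta * (gap / 2 ^+ j) ^+ 2 * (2 * (s / 2 ^+ j)) ^+ n.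
  elim: j => [|j IH] {s l gap s0 l0 gap0 KB hI} s l gap s0 l0 gap0 KB hI.
    rewrite expr0 !divr1; apply: le_trans hI; apply: excess_anti => //.
    by rewrite lerDl mulr_ge0 // ltW.
  have h := step gamma C0 u gC0 hu z s l gap s0 l0 gap0 KB hI.
  have s2 : s / 2 <= s by rewrite ler_piMr ?(ltW s0) // invf_le1 // ler1n.
  have -> : s / 2 ^+ j.+1 = s / 2 / 2 ^+ j by rewrite exprS invfM mulrA.
  have -> : gap / 2 ^+ j.+1 = gap / 2 / 2 ^+ j by rewrite exprS invfM mulrA.
  have -> : l + 2 * gap = l + gap + 2 * (gap / 2) by field.
  apply: IH; rewrite ?divr_gt0 ?addr_gt0 //; first exact: subset_trans (ccubeS s2) KB.
  apply: (le_trans h); rewrite ler_pdivrMr ?exprn_gt0 //; apply: (le_trans hI).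
  rewrite le_eqVlt; apply/orP; left; apply/eqP.
  have -> : 2 * (s / 2) = s by field.
  by rewrite exprMn !exprS; field.
rewrite leNgt; apply/negP => uz.
(* Near [z] one has u > L + e, so the excess at level [L] on a small cube is at least e^2 times the
   measure of the open cube. The iterated bound is delta (gap/2^j)^2 times that measure, smaller for
   large j. *)
pose L := l + 2 * gap; pose e := (u z - L) / 2.
have [e0 eE] : 0 < e /\ L + e < u z.
  by rewrite /e /L; move: uz; move: (l + 2 * gap) (u z) => a b ab; split; lra.
have Kz : ccube z s z by rewrite /ccube /= subrr normr0 ltW.
have cz := within_eball_continuous cu (KB z Kz).
have /nbhs_ballP[rho /= rho0 hrho] : \forall x \near z, L + e < u x by apply: (cvgr_gt _ cz).
have [j1 hj1] := pow2_eventually rho0 s0.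
have g20 : 0 < delta * gap ^+ 2 by rewrite mulr_gt0 // exprn_gt0.
have [j2 hj2] := pow2_eventually (exprn_gt0 2 e0) g20.
pose j := maxn j1 j2.
have mono (b : R) i : 0 < b -> (i <= j)%N -> b / 2 ^+ j <= b / 2 ^+ i.
  move=> b0 ij; rewrite ler_pM2l // lef_pV2 ?posrE ?exprn_gt0 //.
  by rewrite ler_weXn2l // ler1n.
have sj : s / 2 ^+ j < rho by apply: le_lt_trans hj1; apply: mono => //; exact: leq_maxl.
have dj : delta * gap ^+ 2 / 2 ^+ j < e ^+ 2 by apply: le_lt_trans hj2; apply: mono => //; exact: leq_maxr.
have h := iter j s l gap s0 l0 gap0 KB hI.
have sj0 : 0 < s / 2 ^+ j by rewrite divr_gt0 // exprn_gt0.
have jle : s / 2 ^+ j <= s by have := mono s 0%N s0 (leq0n _); rewrite expr0 divr1.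
set sg := s / 2 ^+ j in h sj sj0 jle.
have KBj : ccube z sg `<=` B1 by exact: subset_trans (ccubeS jle) KB.
have mK := @ccube_measurable R n z sg.
have mb : measurable (ball z sg) by exact/open_measurable_rV/ball_open.
have bK : ball z sg `<=` ccube z sg.
  by move=> x; rewrite -ball_normE /ccube /= distrC => /ltW.
have lowr x : ball z sg x -> e ^+ 2 <= Num.max (u x - L) 0 ^+ 2.
  move=> bx; have : L + e < u x by apply: hrho; exact: le_ball (ltW sj) _ bx.
  move=> h'; rewrite ler_sqr ?nnegrE ?le_max ?lexx ?orbT ?(ltW e0) //.
  by rewrite lerBrDl ltW.
have := Rintegral_chebyshev mK mb bK (excess_integrable cu mu_ L KBj) (sqr_ge0 e)
  (fun x _ => sqr_ge0 _) lowr.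
rewrite -[X in (_ * X <= _)%E]/(mu (ball z sg)) lebesgue_rV_ball // -EFinM lee_fin -/(excess u z sg L) => h2.
have := le_trans h2 h; rewrite ler_pM2r; last by rewrite exprn_gt0 // mulr_gt0.
apply/negP; rewrite -ltNge; apply: le_lt_trans dj.
rewrite expr_div_n mulrA ler_pM2l // lef_pV2 ?posrE ?exprn_gt0 //.
by rewrite expr2 ler_peMr ?exprn_ge0 // exprn_ege1 // ler1n.
Qed.

Lemma no_small_cube (lam Lam gamma C0 : R) : 0 < lam -> lam <= Lam -> 0 < gamma < 1 -> 0 < C0 ->
  exists2 kappa : R, 0 < kappa & forall u : 'rV[R]_n -> R, energy_solution lam Lam gamma C0 u ->
    forall z d, 0 < u z -> d = kappa * u z `^ ((2 - gamma) / 2) -> ccube z d `<=` B1 ->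
    ~ (forall x, ccube z d x -> u x <= 4 * u z).
Proof.
move=> lam0 lamLam /andP[g0 g1] C00.
have [delta d0 osc] := oscillation_bound lam0 lamLam.
have [Ce Ce0 hCe] := @cube_bump_grad R n.
have gC0 : 0 < gamma * C0 by rewrite mulr_gt0.
have Lam0 : 0 < Lam by exact: lt_le_trans lamLam.
have [kap2 kE] : exists x : R, x = @bump_floor R n ^+ 2 by eexists.
have kap0 : 0 < kap2 by rewrite kE exprn_gt0 // bump_floor_gt0.
have [K1 K1E] : exists x : R, x = 2 * Lam ^+ 2 / lam * Ce by eexists.
have K10 : 0 < K1 by rewrite K1E mulr_gt0 // divr_gt0 // mulr_gt0 // exprn_gt0.
have [q qE] : exists x : R, x = gamma * C0 * 4 `^ (gamma - 1) * kap2 by eexists.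
have q0 : 0 < q by rewrite qE mulr_gt0 // mulr_gt0 // powR_gt0.
have [Z ZE] : exists x : R, x = 64 * 128 * K1 * 4 ^+ n / (delta * q) by eexists.
have f0 : 0 < 4 ^+ n :> R by rewrite exprn_gt0.
have Z0 : 0 < Z by rewrite ZE divr_gt0 // mulr_gt0 // ?mulr_gt0.
exists (Z + 1); first by rewrite addr_gt0.
move=> u hu z d m0 dE KB uM.
have [cu mu_ _] := hu.
have [m mE] : exists m, m = u z by eexists.
rewrite -mE in m0 dE uM.
have d_gt0 : 0 < d by rewrite dE mulr_gt0 ?powR_gt0 // addr_gt0.
(* Level m/4, ramp width m/8 and error tau <= m/8 add up to m/2, so the ramp of w dominates u -
   m/2. *)
have [l lE] : exists x : R, x = m / 4 by eexists.
have [t tE] : exists x : R, x = m / 8 by eexists.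
have l0 : 0 < l by rewrite lE divr_gt0.
have t0 : 0 < t by rewrite tE divr_gt0.
have M0 : 0 < 4 * m by rewrite mulr_gt0.
have [Y YE] : exists x : R, x = K1 / d ^+ 2 * (16 * m ^+ 2 * (4 * d) ^+ n) by eexists.
have Y0 : 0 < Y.
  by rewrite YE mulr_gt0 ?divr_gt0 ?exprn_gt0 // mulr_gt0 ?mulr_gt0 ?exprn_gt0 // mulr_gt0.
(* Taking tau <= Y absorbs the error into the main right-hand term, at the price of a factor 2. *)
have [tau tauE] : exists x : R, x = Num.min (m / 8) Y by eexists.
have tau0 : 0 < tau by rewrite tauE lt_min Y0 divr_gt0.
have [ta tb] : tau <= m / 8 /\ tau <= Y by rewrite tauE !ge_min !lexx orbT.
have tl : 0 < tau <= l / 2 by rewrite tau0 lE; move: ta; lra.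
have [w [sw wu _]] := energy_cube lam0 (ltW gC0) hCe hu d_gt0 KB M0 uM l0 t0 tl.
set J := \int[mu]_(x in ccube z d) _; set P := \int[mu]_(x in _) _ => hP.
have cr := smooth_continuous (smooth_ramp l t sw).
have cr1 := smooth_continuous (smooth_ramp1 l t sw).
have mK := @ccube_measurable R n z d; have cK := @ccube_compact R n z d.
have wl x : ccube z d x -> w x - l <= 4 * m.
  move=> Kx; have := wu x Kx; rewrite ler_distl => /andP[_ h]; have := uM x Kx.
  by rewrite lE; move: h ta m0; lra.
have rampM x : ccube z d x -> ramp l t (w x) <= 4 * m.
  move=> Kx; apply: le_trans (ramp_le l t0 (w x)) _.
  by rewrite ge_max (ltW M0) andbT wl.
have J_le : J <= 16 * m ^+ 2 * (4 * d) ^+ n.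
  have i1 : mu.-integrable (ccube z d) (EFin \o cst (16 * m ^+ 2)).
    by apply: compact_integrable_rV cK _; exact: continuous_constr.
  apply: (@le_trans _ _ (\int[mu]_(x in ccube z d) cst (16 * m ^+ 2) x)).
    apply: (le_Rintegral mK (compact_integrable_rV cK (continuous_mulr cr cr)) i1) => x Kx.
    have -> : cst (16 * m ^+ 2) x = (4 * m) ^+ 2 by rewrite /=; ring.
    by rewrite -expr2 ler_sqr ?nnegrE ?ramp_ge0 ?(ltW M0) // rampM.
  rewrite /Rintegral /= integral_cst // fineM // ?ge0_fin_numE ?compact_finite //=.
  apply: ler_wpM2l; first exact: mulr_ge0 (ler0n _ 16) (sqr_ge0 _).
  rewrite -lee_fin fineK; first exact: ccube_measure_le.
  by rewrite ge0_fin_numE // compact_finite.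
have J_ge0 : 0 <= J by apply: Rintegral_ge0 => x _; exact: sqr_ge0.
have [d34 d1] := three_quarters d_gt0.
have m2 := @ccube_measurable R n z (d / 2); have c2 := @ccube_compact R n z (d / 2).
have m3 := @ccube_measurable R n z (d * (3 / 4)); have c3 := @ccube_compact R n z (d * (3 / 4)).
have K2K : ccube z (d / 2) `<=` ccube z d by apply: ccubeS; exact: le_trans d34 d1.
(* Since ramp <= (w - l) ramp1 <= 4 m ramp1, the squared ramp is bounded by the zero-order
   integrand. *)
have ex_le : excess u z (d / 2) (m / 2) <= 4 * m * P.
  have cr2 := continuous_mulr cr cr.
  apply: (@le_trans _ _ (\int[mu]_(x in ccube z (d / 2)) (ramp l t (w x) * ramp l t (w x)))).
    apply: (le_Rintegral m2 (excess_integrable cu mu_ (m / 2) (subset_trans K2K KB))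
      (compact_integrable_rV c2 cr2)) => x Kx.
    rewrite -expr2 ler_sqr ?nnegrE ?ramp_ge0 ?le_max ?lexx ?orbT // ge_max ramp_ge0 // andbT.
    apply: le_trans (ramp_ge l t0 (w x)).
    have := wu x (K2K x Kx); rewrite ler_distl => /andP[h _].
    by rewrite lE tE; move: h ta; lra.
  apply: le_trans (Rintegral_subset_le cr2 (fun x => sqr_ge0 _) c2 c3 (ccubeS d34)) _.
  have crr := continuous_mulr cr cr1.
  rewrite -(RintegralZl _ m3 (compact_integrable_rV c3 crr)).
  apply: (le_Rintegral m3 (compact_integrable_rV c3 cr2)
    (integrableZl m3 (4 * m) (compact_integrable_rV c3 crr))) => x Kx.
  rewrite [leRHS]mulrCA ler_wpM2l ?ramp_ge0 //; apply: le_trans (ramp_le_ramp1 l t0 (w x)) _.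
  rewrite ler_wpM2r ?(andP (ramp1_01 l t0 (w x))).1 //; apply: wl; exact: ccubeS d1 x Kx.
have P_le : gamma * C0 * (4 * m) `^ (gamma - 1) * kap2 * P <= 2 * Y.
  rewrite -kE in hP; apply: (le_trans hP).
  have -> : 2 * Y = Y + Y by ring.
  apply: lerD tb; rewrite YE.
  have -> : 2 * Lam ^+ 2 / lam * (Ce / d ^+ 2) = K1 / d ^+ 2 by rewrite K1E; ring.
  by rewrite ler_wpM2l // divr_ge0 ?sqr_ge0 // ltW.
have := osc gamma C0 u (ltW gC0) hu z (d / 2) (m / 2) (m / 8).
rewrite !divr_gt0 // => /(_ isT isT isT (subset_trans K2K KB)) concl.
suff /concl : excess u z (d / 2) (m / 2) <= delta * (m / 8) ^+ 2 * (2 * (d / 2)) ^+ n.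
  by rewrite -mE; move: m0; lra.
apply: (le_trans ex_le).
have -> : 2 * (d / 2) = d by field.
(* Scale invariance: the exponents gamma - 1 and 2 (2 - gamma)/2 add up to 1. *)
have Gd : m `^ (gamma - 1) * d ^+ 2 = (Z + 1) ^+ 2 * m.
  rewrite dE exprMn mulrCA; congr (_ * _).
  rewrite -powR_mulrn ?powR_ge0 // -powRrM -powRD; last by rewrite (gt_eqF m0) implybT.
  have -> : gamma - 1 + (2 - gamma) / 2 * 2%:R = 1 by field.
  by rewrite powRr1 // ltW.
have P0 : 0 <= P.
  apply: Rintegral_ge0 => x _; rewrite mulr_ge0 ?ramp_ge0 //.
  by have /andP[] := ramp1_01 l t0 (w x).
have qP : q * m `^ (gamma - 1) * P <= 2 * (K1 / d ^+ 2 * (16 * m ^+ 2 * (4 ^+ n * d ^+ n))).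
  rewrite -exprMn -YE; apply: le_trans P_le; rewrite powRM ?(ltW m0) // qE.
  by rewrite le_eqVlt; apply/orP; left; apply/eqP; ring.
exact: (scaling_estimate d0 q0 K10 f0 m0 (exprn_gt0 2 d_gt0) (exprn_ge0 n (ltW d_gt0)) P0 ZE Gd qP).
Qed.

End key_claim.

(** Only nonnegative bases are compared. The point y = 0 needs its own modulus e^(1/a), as the power
    need not be differentiable there. *)
Lemma powR_within (R : realType) (y a e : R) : 0 <= y -> 0 < a -> 0 < e ->
  exists2 d, 0 < d & forall t, 0 <= t -> `|t - y| < d -> `|t `^ a - y `^ a| < e.
Proof.
rewrite le_eqVlt => /orP[/eqP <-|y0] a0 e0.
  exists (e `^ a^-1); first by rewrite powR_gt0.
  move=> t t0; rewrite subr0 ger0_norm // powR0 ?gt_eqF // subr0 ger0_norm ?powR_ge0 // => te.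
  rewrite -[e]powRr1 ?(ltW e0) // -[X in _ < _ `^ X](@mulVf _ a) ?gt_eqF // powRrM.
  by rewrite gt0_ltr_powR ?nnegrE ?powR_ge0.
have cy : {for y, continuous (fun t : R => t `^ a)}.
  apply/differentiable_continuous/derivable1_diffP.
  by have [] := is_derive1_powR a y0.
have /cvgrPdist_lt/(_ e e0)/nbhs_ballP[d /= d0 hd] := cy.
by exists d => // t _ ty; rewrite distrC; apply: hd; rewrite /ball /= distrC.
Qed.

Theorem theorem3 (R : realType) (n : nat) (lam Lam gamma C0 : R) :
  (2 <= n)%N -> 0 < lam -> lam <= Lam -> 0 < gamma < 1 -> 0 < C0 ->
  exists c : R, 0 < c /\
    forall (p : R) (A : 'rV[R]_n -> 'M[R]_n) (f u : 'rV[R]_n -> R),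
      n%:R / 2 < p ->
      elliptic lam Lam A ->
      weak_Lp p (eball 0 1) f ->
      {ae @lebesgue_rV R n, forall x, eball 0 1 x -> C0 <= f x} ->
      nonneg_weak_solution gamma A f u ->
      forall (y0 : 'rV[R]_n) (r : R),
        boundary (positivity_set u) y0 -> 0 < r ->
        eball y0 (2 * r) `<=` eball 0 1 ->
        c * r `^ (2 / (2 - gamma)) <= sup (u @` boundary (eball y0 r)).
Proof.
move=> n2 lam0 lamLam g01 C00.
have [g0 g1] := andP g01.
have [kap kap0 key] := @no_small_cube R n lam Lam gamma C0 lam0 lamLam g01 C00.
have nR2 : 2 <= n%:R :> R by rewrite ler_nat.
have nR : 0 < n%:R :> R by apply: lt_le_trans nR2.
have [a aE] : exists a : R, a = (2 - gamma) / 2 by eexists.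
have a12 : 1 / 2 <= a by rewrite aE; lra.
have a0 : 0 < a by apply: lt_le_trans a12; rewrite divr_gt0.
(* With the cube radius rho = r/(2 n) used below, kap B r = rho/4. *)
have [B BE] : exists B : R, B = (8 * n%:R * kap)^-1 by eexists.
have B0 : 0 < B by rewrite BE invr_gt0 mulr_gt0 // mulr_gt0.
(* Then c^a = B, and the threshold S = c r^(2/(2 - gamma)) satisfies S^a = B r because a is the
   inverse of its exponent. *)
have [c cE] : exists c : R, c = B `^ a^-1 by eexists.
have c0 : 0 < c by rewrite cE powR_gt0.
have caB : c `^ a = B by rewrite cE -powRrM mulVf ?gt_eqF // powRr1 // ltW.
(* From n >= 2 one gets p > 1, so f is integrable on B_1 and the energy inequality applies. *)
exists c; split => // p A f u p_gt ellA wf fC0 [u0 cu [Du [H1u eqn]]] y0 r [by0 _] r0 sub.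
have p1 : 1 < p by apply: le_lt_trans p_gt; rewrite ler_pdivlMr // mul1r.
have jf : (@lebesgue_rV R n).-integrable (eball 0 1) (EFin \o f).
  have [mf weak] := wf.
  exact: (weak_Lp_integrable (eball_measurable 0 1) (eball_finite 0 1) p1 mf weak).
have hE : energy_solution lam Lam gamma C0 u.
  split; [exact: cu|exact: solution_measurable H1u|].
  exact: (energy_inequality lam0 lamLam g01 C00 ellA jf fC0 cu H1u eqn).
rewrite leNgt; apply/negP => supS.
have [S SE] : exists S : R, S = c * r `^ (2 / (2 - gamma)) by eexists.
rewrite -SE in supS.
have S0 : 0 < S by rewrite SE mulr_gt0 // powR_gt0.
have SaE : S `^ a = B * r.
  rewrite SE powRM ?powR_ge0 ?(ltW c0) // caB -powRrM aE.
  have -> : 2 / (2 - gamma) * ((2 - gamma) / 2) = 1 by field; rewrite gt_eqF // subr_gt0; lra.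
  by rewrite powRr1 // ltW.
have VB : closure (eball y0 r) `<=` eball 0 1.
  move=> x /closure_eball /= xr; apply: sub; apply: le_lt_trans xr _.
  by rewrite mulrDl mul1r ltrDl.
have cV := @closure_eball_compact R n y0 r.
have [M M0 hM] := compact_bounded_fun cV (continuous_subspaceW VB cu).
have ubd x : boundary (eball y0 r) x -> u x <= S.
  move=> bx; apply: ltW; apply: le_lt_trans supS; apply: sup_upper_bound; last by exists x.
  (* [sup] is an upper bound for nonempty sets bounded above: [x] gives nonemptiness, compactness of
     the closed ball the bound. *)
  split; first by exists (u x), x.
  exists M => _ [y [Vy _] <-]; exact: le_trans (ler_norm _) (hM y Vy).
have uS := max_principle lam0 lamLam g01 C00 ellA jf fC0 cu H1u eqn S0 VB ubd.
(* The sup-norm cube of this radius lies in the Euclidean ball of radius r/2. *)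
have [rho rhoE] : exists rho : R, rho = r / (2 * n%:R) by eexists.
have rho0 : 0 < rho by rewrite rhoE divr_gt0 // mulr_gt0.
have KV : ccube y0 rho `<=` eball y0 r.
  move=> x xr; rewrite /eball /=; apply: le_lt_trans (enorm_le_norm _) _.
  apply: (@le_lt_trans _ _ (n%:R * rho)); first by rewrite ler_pM2l.
  have -> : n%:R * rho = r / 2 by rewrite rhoE; field; rewrite gt_eqF.
  by rewrite ltr_pdivrMr // ltr_pMr // ltr1n.
have KB : ccube y0 rho `<=` eball 0 1 by move=> x /KV Vx; apply: VB; exact: subset_closure.
have [z0 [Uz0 z0y]] : exists z0, positivity_set u z0 /\ `|z0 - y0| < rho / 4.
  have rho4 : 0 < rho / 4 by rewrite divr_gt0.
  have [z [Uz bz]] := by0 _ (nbhsx_ballx y0 _ rho4).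
  by exists z; split => //; move: bz; rewrite -ball_normE /= distrC.
pose h x : R := u x `^ a.
have h_gt0 x : 0 < u x -> 0 < h x by move=> ux; rewrite /h powR_gt0.
pose psi x : R := h x - `|x - z0| / kap.
have cpsi : {within ccube y0 rho, continuous psi}.
  apply/subspace_continuousP => x Kx.
  have cux := within_eball_continuous cu (KB x Kx).
  have cn : (fun w : 'rV[R]_n => `|w - z0| / kap) @ within (ccube y0 rho) (nbhs x) --> `|x - z0| / kap.
    apply: cvg_within_filter; apply: cvgM; last exact: cvg_cst.
    by apply: cvg_norm; apply: cvgB; [exact: cvg_id|exact: cvg_cst].
  apply: (cvgB _ cn); apply/cvgrPdist_lt => e e0.
  have [dl dl0 hdl] := powR_within (u0 x (KB x Kx)) a0 e0.
  have : \forall w \near x, `|u x - u w| < dl by move/cvgrPdist_lt : cux; exact.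
  rewrite near_withinE; apply: filterS => w hw Kw; rewrite distrC; apply: hdl; last by rewrite distrC.
  exact/u0/KB.
have Kz0 : ccube y0 rho z0.
  by rewrite /ccube /=; apply: le_trans (ltW z0y) _; rewrite ler_piMr ?(ltW rho0) // invf_le1 // ler1n.
have [z Kz hz] := @compact_EVT_max _ R psi _ (ex_intro _ z0 Kz0) (@ccube_compact R n y0 rho) cpsi.
rewrite inE in Kz.
have hB x : ccube y0 rho x -> kap * h x <= rho / 4.
  move=> Kx; have ux : u x <= S by apply: uS; apply: subset_closure; exact: KV.
  have : h x <= B * r.
    rewrite -SaE /h; apply: ge0_ler_powR; rewrite ?nnegrE ?(ltW a0) ?(ltW S0) //.
    exact/u0/KB.
  rewrite -(ler_pM2l kap0) => /le_trans; apply.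
  rewrite BE rhoE le_eqVlt; apply/orP; left; apply/eqP.
  by field; rewrite !gt_eqF.
have psiz0 : 0 < psi z.
  have [_ uz0] := Uz0; apply: lt_le_trans (hz z0 _); last by rewrite inE.
  by rewrite /psi subrr normr0 mul0r subr0 h_gt0.
have zz0 : `|z - z0| < kap * h z.
  by move: psiz0; rewrite /psi subr_gt0 ltr_pdivrMr // mulrC.
have uz : 0 < u z.
  rewrite lt_neqAle u0 ?andbT; last exact: KB.
  apply/negP => /eqP uz; move: zz0.
  by rewrite /h -uz powR0 ?gt_eqF // mulr0 ltNge normr_ge0.
have zy : `|z - y0| < rho / 2.
  rewrite -[z](subrK z0) -addrA; apply: le_lt_trans (ler_normD _ _) _.
  have -> : rho / 2 = rho / 4 + rho / 4 by field.
  by apply: ltrD => //; apply: lt_le_trans zz0 _; exact: hB.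
(* z0 is within rho/4 of y0, z within rho/4 of z0, and the cube around z has radius at most
   rho/4. *)
have dK : ccube z (kap * h z) `<=` ccube y0 rho.
  move=> x xz; rewrite /ccube /= -[x](subrK z) -addrA; apply: le_trans (ler_normD _ _) _.
  apply: (@le_trans _ _ (rho / 4 + rho / 2)); first by apply: lerD (le_trans xz (hB z Kz)) (ltW zy).
  by have [] := three_quarters rho0; move=> _; lra.
have dE : kap * h z = kap * u z `^ ((2 - gamma) / 2) by rewrite /h aE.
apply: (key u hE z (kap * h z) uz dE (subset_trans dK KB)) => x xz.
have Kx := dK x xz.
rewrite leNgt; apply/negP => ux.
have : psi x <= psi z by apply: hz; rewrite inE.
have xzk : `|x - z| / kap <= h z by rewrite ler_pdivrMr // mulrC.
have tri : `|x - z0| / kap <= `|x - z| / kap + `|z - z0| / kap.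
  rewrite -mulrDl ler_pM2r ?invr_gt0 //; apply: le_trans (ler_normD _ _).
  by rewrite addrA subrK.
(* If u(x) > 4 u(z), then h more than doubles from z to x, while the penalty grows by at most |x -
   z|/kap <= h(z): psi(x) would exceed psi(z). *)
have big : 2 * h z < h x.
  have four : 2 <= 4 `^ a :> R.
    have -> : 4 = 2 `^ 2%:R :> R by rewrite powR_mulrn // expr2; ring.
    rewrite -powRrM -[leLHS]powRr1 // ler_powR ?ler1n //; lra.
  apply: (@le_lt_trans _ _ ((4 * u z) `^ a)).
    by rewrite powRM ?(ltW uz) // ler_wpM2r ?powR_ge0.
  by rewrite /h gt0_ltr_powR ?nnegrE ?mulr_ge0 ?(ltW uz) //; exact/u0/KB.
rewrite /psi; move: big xzk tri; lra.
Qed.
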